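(* Fix $T>0$ and an integer $d\ge1$. The set $\mathcal G_{\mathrm{qv}}\subset C([0,T];\mathbb R^d)$ is Borel, and $$\mathcal Q:\mathcal G_{\mathrm{qv}}\longrightarrow C_{\mathrm{fv}}([0,T];\mathbb R^{d\times d})$$ is Borel. If $P$ is any law on $C([0,T];\mathbb R^d)$ under which the coordinate process $X$ is a continuous semimartingale, then $$P(\mathcal G_{\mathrm{qv}})=1,\qquad \mathcal Q^{ij}(X)=[X^i,X^j]\quad P\text{-almost surely}$$ for every $i,j\in\{1,\dots,d\}$. Consequently, for every family $\mathcal P$ of such laws, $C([0,T];\mathbb R^d)\setminus\mathcal G_{\mathrm{qv}}$ is one Borel $\mathcal P$-polar set.
   Context: $C([0,T];\mathbb R^d)$ carries the uniform topology; semimartingale properties are relative to the usual augmentation of the canonical filtration of $X$. A set $N$ is $\mathcal P$-polar if $\sup_{P\in\mathcal P}P^*(N)=0$, $P^*$ being outer probability. Endogenous integral. For a càdlàg $h:[0,T]\to\mathbb R^{1\times d}$, $x\in C([0,T];\mathbb R^d)$ and $n\ge1$ let $\tau_0^n(h)=0$, $$\tau_{k+1}^n(h)=\inf\{t>\tau_k^n(h):\|h(t)-h(\tau_k^n(h))\|>2^{-n}\}\wedge T$$ (remaining at $T$ once $T$ is reached), and $$I_t^n(h,x)=\sum_{k\ge0}h(\tau_k^n(h))\bigl(x(t\wedge\tau_{k+1}^n(h))-x(t\wedge\tau_k^n(h))\bigr).$$ $\mathcal D^{1,d}$ is the set of pairs $(h,x)$ for which $I^n(h,x)$ converges uniformly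 on $[0,T]$; $\mathcal I(h,x)$ is the limit, with value $\mathcal I_t(h,x)$ at time $t$. Covariation. With $e_j$ the $j$-th coordinate vector, let $\chi^{ij}(x)_t=x^i_te_j^\top$ and $\mathcal D_{\mathrm{qv}}=\bigcap_{i,j}\{x\in C([0,T];\mathbb R^d):(\chi^{ij}(x),x)\in\mathcal D^{1,d}\}$. For $x\in\mathcal D_{\mathrm{qv}}$ define $$\mathcal Q^{ij}_t(x)=x^i_tx^j_t-x^i_0x^j_0-\mathcal I_t(\chi^{ij}(x),x)-\mathcal I_t(\chi^{ji}(x),x).$$ $C_{\mathrm{fv}}([0,T];\mathbb R^{d\times d})$ is the set of continuous matrix-valued paths with entries of finite total variation, with the trace Borel structure from $C([0,T];\mathbb R^{d\times d})$, and $\mathcal G_{\mathrm{qv}}=\{x\in\mathcal D_{\mathrm{qv}}:\mathcal Q(x)\in C_{\mathrm{fv}}([0,T];\mathbb R^{d\times d})\}$. *)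

(* Defs.v *)
From HB Require Import structures.
From mathcomp Require Import all_boot all_order all_algebra.
From mathcomp Require Import all_classical all_reals all_analysis.
Import Order.TTheory GRing.Theory Num.Theory.
Import numFieldNormedType.Exports.

Set Implicit Arguments.
Unset Strict Implicit.
Unset Printing Implicit Defensive.

Local Open Scope classical_set_scope.
Local Open Scope ring_scope.

(** * Path spaces *)

Definition timeset {R : realType} (T : R) : set R := `[0, T]%classic.

(** C([0,T]; R^{m x n}); R^d is the space of columns, i.e. n = 1. *)
Definition cpath {R : realType} (T : R) (m n : nat) : Type :=
  continuousType (timeset T) 'M[R]_(m, n).

Section cpath_pointed.
Context {R : realType} (T : R) (m n : nat).

Let cst0 : timeset T -> 'M[R]_(m, n) := fun=> 0.

Let continuous_cst0 : continuous cst0.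
Proof. exact: cst_continuous. Qed.

Definition cpath0 : cpath T m n := mkcts continuous_cst0.

HB.instance Definition _ := Choice.on (cpath T m n).
HB.instance Definition _ := isPointed.Build (cpath T m n) cpath0.

End cpath_pointed.

(** Real-time evaluation.  The value 0 outside [0, T] is a dummy: it is never
    used below. *)
Definition at_time {R : realType} (T : R) (m n : nat) (x : cpath T m n) :
  R -> 'M[R]_(m, n) := valL_ 0 (x : timeset T -> 'M[R]_(m, n)).

Definition uniform_open {R : realType} (T : R) (m n : nat) :
    set (set (cpath T m n)) :=
  @open (initial_topology
    (id : cpath T m n -> {uniform timeset T -> 'M[R]_(m, n)})).

Definition borel_cpath {R : realType} (T : R) (m n : nat) :=
  g_sigma_algebraType (@uniform_open R T m n).

(** * The endogenous integral *)

Section endogenous_integral.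
Context {R : realType} (T : R) (d : nat).

(** An integrand h is a function on all of R of which only the values on
    [0, T] matter. *)
Definition cadlag (h : R -> 'rV[R]_d) : Prop :=
  (forall t, 0 <= t < T -> h s @[s --> t^'+] --> h t) /\
  (forall t, 0 < t <= T -> cvg (h s @[s --> t^'-])).

(** The library norm on matrices is the maximum norm. *)
Definition euclid_norm (v : 'rV[R]_d) : R :=
  Num.sqrt (\sum_(j < d) v 0 j ^+ 2).

(** inf (S `|` [set T]) is the minimum of T and inf S, with inf set0 = +oo. *)
Fixpoint grid_time (n : nat) (h : R -> 'rV[R]_d) (k : nat) : R :=
  if k is k'.+1 then
    let r := grid_time n h k' in
    inf ([set t | r < t <= T /\ (2 ^+ n)^-1 < euclid_norm (h t - h r)]
         `|` [set T])
  else 0.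

Definition endo_sum (n : nat) (h : R -> 'rV[R]_d) (x : cpath T d 1) (t : R) : R :=
  limn (series (fun k =>
    (h (grid_time n h k) *m
       (at_time x (Order.min t (grid_time n h k.+1)) -
        at_time x (Order.min t (grid_time n h k)))) 0 0)).

Definition endo_domain : set ((R -> 'rV[R]_d) * cpath T d 1) :=
  [set hx | cadlag hx.1 /\
    exists g : R -> R,
      {uniform timeset T, (fun n => endo_sum n hx.1 hx.2) @ \oo --> g}].

Definition endo_int (h : R -> 'rV[R]_d) (x : cpath T d 1) (t : R) : R :=
  limn (fun n => endo_sum n h x t).

(** * Pathwise covariation *)

Definition chi (i j : 'I_d) (x : cpath T d 1) (t : R) : 'rV[R]_d :=
  at_time x t i 0 *: delta_mx 0 j.

Definition Dqv : set (cpath T d 1) :=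
  [set x | forall i j, endo_domain (chi i j x, x)].

Definition qcov (x : cpath T d 1) (t : R) : 'M[R]_d :=
  \matrix_(i, j)
    (at_time x t i 0 * at_time x t j 0 - at_time x 0 i 0 * at_time x 0 j 0
     - endo_int (chi i j x) x t - endo_int (chi j i x) x t).

(** [qcov x] as an element of C([0,T]; R^{d x d}); meaningful only if [qcov x]
    is continuous on [0, T], and the zero path otherwise. *)
Definition qcov_path (x : cpath T d 1) : cpath T d d :=
  match pselect (continuous (sigL (timeset T) (qcov x))) with
  | left c => mkcts c
  | right _ => cpath0 T d d
  end.

Definition Cfv : set (cpath T d d) :=
  [set y | forall i j, bounded_variation 0 T (fun t => at_time y t i j)].

Definition Gqv : set (cpath T d 1) :=
  [set x | [/\ Dqv x, {within timeset T, continuous (qcov x)} &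
               Cfv (qcov_path x)]].

End endogenous_integral.

Arguments Gqv {R} T d _.
Arguments Cfv {R} T d _.

(** * Continuous semimartingales on [0, T] *)

Section semimartingales.
Context {R : realType} (T : R) {disp : measure_display}
  {Omega : measurableType disp} (P : {measure set Omega -> \bar R})
  (F : R -> set (set Omega)).
Implicit Types X Y M N A B V : R -> Omega -> R.

Definition adapted X : Prop :=
  forall t, timeset T t ->
  forall B : set R, measurable B -> F t (X t @^-1` B).

Definition continuous_paths X : Prop :=
  forall w, {within timeset T, continuous (X ^~ w)}.

(** The last clause says that M s is a version of the conditional expectation
    of M t given F s. *)
Definition martingale M : Prop :=
  [/\ adapted M,
      forall t, timeset T t -> P.-integrable setT (EFin \o M t) &
      forall s t, 0 <= s -> s <= t -> t <= T -> forall E, F s E ->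
        (\int[P]_(w in E) (M t w)%:E = \int[P]_(w in E) (M s w)%:E)%E].

Definition stopping_time (tau : Omega -> R) : Prop :=
  (forall w, timeset T (tau w)) /\
  (forall t, timeset T t -> F t [set w | tau w <= t]).

Definition stopped M (tau : Omega -> R) : R -> Omega -> R :=
  fun t w => M (Order.min t (tau w)) w.

(** As the horizon T is included, a localizing sequence must reach T. *)
Definition continuous_local_martingale0 M : Prop :=
  [/\ adapted M, continuous_paths M, forall w, M 0 w = 0 &
      exists tau : nat -> Omega -> R,
        [/\ forall n, stopping_time (tau n),
            forall n w, tau n w <= tau n.+1 w,
            {ae P, forall w, \forall n \near \oo, tau n w = T} &
            forall n, martingale (stopped M (tau n))]].

Definition continuous_fv_process0 A : Prop :=
  [/\ adapted A, continuous_paths A, forall w, A 0 w = 0 &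
      forall w, bounded_variation 0 T (A ^~ w)].

Definition semimartingale_decomposition X M A : Prop :=
  [/\ continuous_local_martingale0 M, continuous_fv_process0 A &
      forall t w, timeset T t -> X t w = X 0 w + M t w + A t w].

Definition continuous_semimartingale X : Prop :=
  adapted X /\ exists M A, semimartingale_decomposition X M A.

(** V is a version of the bracket [X, Y] of continuous semimartingales: with M
    and N the local martingale parts, V is the continuous adapted process of
    finite variation, null at 0, such that M N - V is a local martingale. *)
Definition is_bracket X Y V : Prop :=
  exists M A N B,
    [/\ semimartingale_decomposition X M A,
        semimartingale_decomposition Y N B,
        continuous_fv_process0 V &
        continuous_local_martingale0 (fun t w => M t w * N t w - V t w)].

End semimartingales.

(** * The canonical space *)

Section canonical_space.
Context {R : realType} (T : R) (d : nat).

Definition law := probability (borel_cpath T d 1) R.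

Definition coord (i : 'I_d) : R -> cpath T d 1 -> R :=
  fun t x => at_time x t i 0.

Definition canonical_filtration (t : R) : set (set (cpath T d 1)) :=
  <<s [set E | exists s (U : set 'cV[R]_d),
         [/\ 0 <= s <= T, s <= t, open U &
             E = [set x | U (at_time x s)]]] >>.

(** Completed and made right-continuous; the time parameter is capped at T by
    [canonical_filtration] itself. *)
Definition usual_augmentation (P : law) (t : R) : set (set (cpath T d 1)) :=
  [set E | forall s, t < s ->
    <<s canonical_filtration s `|` P.-negligible >> E].

Definition completion (P : law) :
    {measure set (caratheodory_type (mu_ext P)) -> \bar R} :=
  @completed_measure_extension _ _ _ P.

(** The augmented filtration consists of sets that are measurable for the
    completion of P only, so semimartingales live on the completed space. *)
Definition semimartingale_law (P : law) : Prop :=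
  forall i : 'I_d,
    continuous_semimartingale T (completion P)
      (usual_augmentation P) (coord i).

Definition is_coord_bracket (P : law) (i j : 'I_d)
    (V : R -> cpath T d 1 -> R) : Prop :=
  is_bracket T (completion P) (usual_augmentation P)
    (coord i) (coord j) V.

(** [mu_ext P] is the outer probability of P.  The value 0 is added to the
    family so that its supremum is 0 when Ps is empty. *)
Definition polar (Ps : set law) (N : set (cpath T d 1)) : Prop :=
  ereal_sup ([set 0%E] `|` [set mu_ext P N | P in Ps]) = 0%E.

End canonical_space.

(* Main.v *)
From HB Require Import structures.
Require Import Defs.
From mathcomp Require Import all_boot all_order all_algebra.
From mathcomp Require Import all_classical all_reals all_analysis.
From mathcomp Require Import measurable_realfun.
From mathcomp Require Import lra ring.
Import Order.TTheory GRing.Theory Num.Theory.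
Import numFieldNormedType.Exports.

Set Implicit Arguments.
Unset Strict Implicit.
Unset Printing Implicit Defensive.

Local Open Scope classical_set_scope.
Local Open Scope ring_scope.

(** On the path space, everything is decided by countably many evaluations. The
    endogenous sums are Borel functions of the path, as the times of the endogenous
    grid are stopping times and as such depend measurably on the path
    ([grid_time_stopping], [adm_gsum]). Their uniform convergence is a Cauchy condition
    at dyadic times ([dyadic_cauchyP]), and a continuous function has finite variation
    if and only if its variations along the dyadic grids are bounded
    ([bounded_variation_dyadic]); so the set of good paths is Borel. The covariation is
    a limit of Borel functions at each time, and a path-valued map is Borel as soon as
    its evaluations are, because every uniformly open set is a countable union of sets
    that are described by evaluations ([uniform_open_tubes], [measurable_path]).

    Let now [X = X 0 + M + A] be a semimartingale and [f] a coordinate. The step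
    integrands of [f] along two successive endogenous grids differ by at most a multiple
    of [2^-n] everywhere. Against [A] the integrals then differ by a multiple of [2^-n]
    pathwise. Against [M], once localized, the difference is a martingale with mean
    square of order [4^-n] ([martingale_integral]); the maximal inequality and the
    Borel-Cantelli lemma bound it by [(3/4)^n] for all large [n], almost surely
    ([integral_small_eventually]). Hence the endogenous integrals converge uniformly,
    almost surely, and by the same estimate the limit does not change if the grid is
    replaced by the endogenous grid of a vector process of which [f] is one coordinate
    ([grid_integrals_close]).

    Use the endogenous grid of the vector formed by two coordinates [X], [Y] and their
    martingale parts [M], [N]. Summation by parts shows that the pathwise covariation is the limit of sums
    of products of increments of [X] and [Y], and equally of [M] and [N]. By polarization
    it is a difference of nondecreasing functions, hence of finite variation
    ([gcov_limit_controlled]); and [M N] minus these sums is a sum of two integral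
    processes, so that in the limit [M N] minus the covariation is a local martingale
    ([bracket_construction]). Thus the covariation is a bracket. It is the only one, since
    a continuous local martingale of finite variation vanishes
    ([fv_local_martingale_eq0]).

    No stochastic integral is constructed: [has_rint] records that left Riemann sums
    converge path by path, which is the case for all integrands that occur, and the
    martingale property is then inherited from the sums. *)

(** * Continuous paths on a compact interval *)

Lemma cvg_geometric_bound {R : realType} (c z : R) : 0 <= z < 1 ->
  (fun n => c * z ^+ n) @ \oo --> (0 : R).
Proof.
move=> /andP[z0 z1]; rewrite -(mulr0 c); apply: cvgM; first exact: cvg_cst.
by apply: cvg_expr; rewrite ger0_norm.
Qed.

Lemma cvg_half_pow {R : realType} (c : R) :
  (fun n => c * (2 ^+ n)^-1) @ \oo --> (0 : R).
Proof.
rewrite (_ : (fun n => _) = (fun n => c * 2^-1 ^+ n)).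
  by apply: cvg_geometric_bound; lra.
by apply/funext => n; rewrite exprVn.
Qed.

Section continuity.
Context {R : realType} (T : R).

Lemma within_contP (f : R -> R) : {within timeset T, continuous f} <->
  forall t, 0 <= t <= T -> forall e, 0 < e -> exists2 d, 0 < d &
    forall s, 0 <= s <= T -> `|t - s| < d -> `|f t - f s| < e.
Proof.
split=> [/subspace_continuousP cf t tT e e0|H].
  have /cvgrPdist_lt/(_ e e0) := cf t ltac:(by rewrite /timeset/= in_itv).
  rewrite /prop_near1 withinE /= => -[V /nbhs_ballP[d /= d0 dV] EV].
  exists d => // s sT ts.
  have : (V `&` timeset T) s.
    by split; [apply: dV; rewrite /ball/=|rewrite /timeset/= in_itv].
  by rewrite -EV => -[].
apply/subspace_continuousP => t; rewrite /timeset/= in_itv/= => tT.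
apply/cvgrPdist_lt => e e0; have [d d0 dP] := H t tT e e0.
rewrite /prop_near1 /within/=; apply/nbhs_ballP; exists d => // s.
rewrite /ball/= => ts; rewrite in_itv/= => sT; exact: dP.
Qed.

Lemma unif_cont (f : R -> R) : {within timeset T, continuous f} ->
  forall e, 0 < e -> exists2 d, 0 < d &
    forall s t, 0 <= s <= T -> 0 <= t <= T -> `|s - t| <= d ->
      `|f s - f t| < e.
Proof.
move=> /within_contP cf e e0.
have /compact_near_coveringP cK := @segment_compact R 0 T.
pose Q (d : R) (x : R) := 0 <= x <= T ->
  forall s, 0 <= s <= T -> `|x - s| <= d -> `|f x - f s| < e.
have : \forall d \near 0^'+, `[0, T]%classic `<=` Q d.
  apply: cK => x; rewrite /= in_itv/= => xT.
  have [d d0 dP] := cf x xT (e / 2) ltac:(by rewrite divr_gt0).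
  exists (ball x (d / 2), [set r | 0 < r < d / 2]).
    split => /=; first by apply: nbhsx_ballx; rewrite divr_gt0.
    near=> r; apply/andP; split=> //; near: r; apply: nbhs_right_lt.
    by rewrite divr_gt0.
  move=> [y r] /= [] ; rewrite /ball/= => xy /andP[r0 rd] yT s sT ys.
  have h1 : `|f x - f y| < e / 2 by apply: dP => //; lra.
  have h2 : `|f x - f s| < e / 2.
    apply: dP => //; have := ler_distD y x s; lra.
  rewrite distrC in h1; have := ler_distD (f x) (f y) (f s); lra.
move=> [d /= d0 dP].
exists (d / 2); first by rewrite divr_gt0.
move=> s t sT tT st.
have : Q (d / 2) s.
  apply: (dP (d / 2)) => /=; rewrite ?in_itv ?divr_gt0//.
  by rewrite sub0r normrN gtr0_norm ?divr_gt0//; lra.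
by apply.
Unshelve. all: by end_near. Qed.

Lemma unif_cont_finite (I : finType) (f : I -> R -> R) e :
  (forall i, {within timeset T, continuous (f i)}) -> 0 < e ->
  exists2 d, 0 < d & forall i s t, 0 <= s <= T -> 0 <= t <= T ->
    `|s - t| <= d -> `|f i s - f i t| < e.
Proof.
move=> cf e0.
have : forall l : seq I, exists2 d, 0 < d & forall i, i \in l -> forall s t,
    0 <= s <= T -> 0 <= t <= T -> `|s - t| <= d -> `|f i s - f i t| < e.
  elim=> [|i l [d d0 dP]]; first by exists 1.
  have [d' d'0 d'P] := unif_cont (@cf i) e0.
  exists (Order.min d d'); first by rewrite lt_min d0.
  move=> k; rewrite inE => /predU1P[->|kl] s t sT tT; rewrite le_min => /andP[h1 h2].
    exact: d'P.
  exact: dP.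
by move=> /(_ (enum I))[d d0 dP]; exists d => // i; apply: dP; rewrite mem_enum.
Qed.

Lemma unif_limit_continuous (u : nat -> R -> R) (l : R -> R) :
  (forall n, {within timeset T, continuous (u n)}) ->
  (forall e, 0 < e -> exists n, forall t, 0 <= t <= T -> `|l t - u n t| < e) ->
  {within timeset T, continuous l}.
Proof.
move=> cu ul; apply/within_contP => t tT e e0.
have e3 : 0 < e / 3 by rewrite divr_gt0.
have [n h] := ul _ e3; have /within_contP/(_ t tT _ e3)[d d0 dP] := cu n.
exists d => // s sT st; have k1 := h t tT; have k2 := h s sT; have k3 := dP s sT st.
have k5 := ler_distD (u n t) (l t) (l s); have k6 := ler_distD (u n s) (u n t) (l s).
rewrite [`|u n s - l s|]distrC in k6; lra.
Qed.

End continuity.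

(** * Left Riemann sums *)

Section left_riemann.
Context {R : realType} (T : R).
Implicit Types (K x y G : R -> R) (g : nat -> R) (L : nat).

Definition rsum K x g L : R :=
  \sum_(l < L) K (g l) * (x (g l.+1) - x (g l)).

Definition grid (s t d : R) g L :=
  [/\ g 0%N = s, g L = t &
      forall l, (l < L)%N -> g l <= g l.+1 <= g l + d].

(** [G] is an indefinite integral of [K] against [x]. For step integrands, and for
    continuous integrands of finite variation, the sums converge path by path, so
    that a single notion covers the finite variation and the martingale case. *)
Definition has_rint K x G := forall s t, 0 <= s -> s <= t -> t <= T ->
  forall e, 0 < e -> exists2 d, 0 < d &
    forall g L, grid s t d g L -> `|rsum K x g L - (G t - G s)| <= e.

Definition stop (a : R) x : R -> R := fun t => x (Order.min t a).

Definition ugrid (s t : R) (m l : nat) : R := s + (t - s) * (l%:R / 2 ^+ m).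

Lemma grid_mono s t d g L i j : grid s t d g L -> (i <= j)%N -> (j <= L)%N ->
  g i <= g j.
Proof.
move=> [_ _ H]; elim: j => [|j IH]; first by rewrite leqn0 => /eqP->.
rewrite leq_eqVlt => /predU1P[->//|ij jL]; rewrite ltnS in ij.
by apply: le_trans (IH ij (ltnW jL)) _; case/andP: (H _ jL).
Qed.

Lemma grid_mem s t d g L l : grid s t d g L -> (l <= L)%N -> s <= g l <= t.
Proof.
move=> H lL; have [g0 gL _] := H.
by rewrite -g0 -gL !(grid_mono H)//.
Qed.

Lemma grid_mem0 s t d g L l : 0 <= s -> t <= T -> grid s t d g L ->
  (l <= L)%N -> 0 <= g l <= T.
Proof. by move=> s0 tT /grid_mem H /H /andP[? ?]; apply/andP; split; lra. Qed.

Lemma gridW s t d d' g L : d <= d' -> grid s t d g L -> grid s t d' g L.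
Proof.
move=> dd' [g0 gL H]; split=> // l /H /andP[-> /=]; move/le_trans; apply.
by rewrite lerD2l.
Qed.

Lemma grid_ugrid s t m : s <= t ->
  grid s t ((t - s) / 2 ^+ m) (ugrid s t m) (2 ^ m).
Proof.
move=> st; have p0 : (0 : R) < 2 ^+ m by rewrite exprn_gt0.
split; rewrite /ugrid; first by rewrite mul0r mulr0 addr0.
  by rewrite natrX divff ?gt_eqF// mulr1 addrC subrK.
move=> l _; rewrite -(natr1 l) [(_ + 1) / _]mulrDl mulrDr mul1r.
have : 0 <= (t - s) / 2 ^+ m by rewrite divr_ge0 ?subr_ge0// ltW.
lra.
Qed.

Lemma has_rint_cvg K x G s t : 0 <= s -> s <= t -> t <= T ->
  has_rint K x G -> rsum K x (ugrid s t m) (2 ^ m) @[m --> \oo] --> G t - G s.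
Proof.
move=> s0 st tT H; apply/cvgrPdist_le => e e0.
have [d d0 dP] := H s t s0 st tT e e0.
have := cvg_half_pow (t - s).
move/cvgrPdist_le => /(_ d d0); apply: filterS => m.
rewrite sub0r normrN => hm; rewrite distrC; apply: dP.
by apply: gridW (grid_ugrid m st); apply: le_trans (ler_norm _) hm.
Qed.

Lemma eq_has_rint K K' x x' G G' :
  {in `[0, T], K =1 K'} -> {in `[0, T], x =1 x'} -> {in `[0, T], G =1 G'} ->
  has_rint K x G -> has_rint K' x' G'.
Proof.
move=> eK ex eG H s t s0 st tT e e0; have [d d0 dP] := H s t s0 st tT e e0.
exists d => // g L gr; rewrite -!eG ?in_itv/= ?s0 ?tT ?andbT//; try lra.
rewrite (_ : rsum _ _ _ _ = rsum K x g L); first exact: dP.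
apply: eq_bigr => l _; have lL := ltn_ord l.
by rewrite eK ?ex ?in_itv //=; apply: grid_mem0 gr _ => //; apply: ltnW.
Qed.

Lemma has_rintDl K K' x G G' : has_rint K x G -> has_rint K' x G' ->
  has_rint (K \+ K') x (G \+ G').
Proof.
move=> H H' s t s0 st tT e e0.
have [d d0 dP] := H s t s0 st tT (e / 2) ltac:(by rewrite divr_gt0).
have [d' d'0 d'P] := H' s t s0 st tT (e / 2) ltac:(by rewrite divr_gt0).
exists (Order.min d d'); first by rewrite lt_min d0.
move=> g L gr.
have h1 := dP g L (gridW _ gr); have h2 := d'P g L (gridW _ gr).
rewrite [e]splitr (_ : _ - _ = (rsum K x g L - (G t - G s)) +
   (rsum K' x g L - (G' t - G' s))); last first.
  rewrite (_ : rsum (K \+ K') x g L = rsum K x g L + rsum K' x g L) /=.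
    by ring.
  by rewrite /rsum -big_split; apply: eq_bigr => l _ /=; ring.
apply: le_trans (ler_normD _ _) _; apply: lerD.
  by apply: h1; rewrite ge_min lexx.
by apply: h2; rewrite ge_min lexx orbT.
Qed.

Lemma has_rintZ c K x G : has_rint K x G ->
  has_rint (fun s => c * K s) x (fun s => c * G s).
Proof.
move=> H s t s0 st tT e e0.
have c1 : 0 < `|c| + 1 by rewrite ltr_wpDl.
have [d d0 dP] := H s t s0 st tT (e / (`|c| + 1)) ltac:(by rewrite divr_gt0).
exists d => // g L /dP h.
rewrite (_ : _ - _ = c * (rsum K x g L - (G t - G s))); last first.
  rewrite (_ : rsum _ x g L = c * rsum K x g L); first by ring.
  by rewrite /rsum mulr_sumr; apply: eq_bigr => l _; rewrite mulrA.
rewrite normrM; apply: (@le_trans _ _ ((`|c| + 1) * (e / (`|c| + 1)))).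
  by apply: ler_pM => //; rewrite lerDl.
by rewrite mulrC divfK // gt_eqF.
Qed.

Lemma has_rintB K K' x G G' : has_rint K x G -> has_rint K' x G' ->
  has_rint (K \- K') x (G \- G').
Proof.
move=> H /(has_rintZ (-1)) H'; have := has_rintDl H H'.
by apply: eq_has_rint => s _ //=; rewrite mulN1r.
Qed.

Lemma has_rint0 x : has_rint (fun=> 0) x (fun=> 0).
Proof.
move=> s t s0 st tT e e0; exists 1 => // g L _.
rewrite /rsum big1 ?subrr ?normr0 ?ltW// => l _; exact: mul0r.
Qed.

Lemma has_rint_sum (n : nat) (K G : nat -> R -> R) x :
  (forall k, (k < n)%N -> has_rint (K k) x (G k)) ->
  has_rint (fun s => \sum_(k < n) K k s) x (fun s => \sum_(k < n) G k s).
Proof.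
elim: n => [|n IH] H.
  by apply: eq_has_rint (has_rint0 x) => s _ //; rewrite big_ord0.
have h : has_rint _ x _ := has_rintDl (IH (fun k kn => H k (ltnW kn))) (H n (ltnSn n)).
by apply: eq_has_rint h => s _ //=; rewrite big_ord_recr.
Qed.

(** The sums of the stopped integral along a grid are those of the integral
    itself along the grid stopped at [a]. *)
Lemma has_rint_stop a K x G : 0 <= a -> has_rint K x G ->
  has_rint (fun s => K s * (s < a)%R%:R) (stop a x) (stop a G).
Proof.
move=> a0 H s t s0 st tT e e0.
have [|||d d0 dP] := H (Order.min s a) (Order.min t a) _ _ _ e e0.
- by rewrite le_min s0.
- by rewrite le_min ge_min st /= ge_min lexx orbT.
- by rewrite ge_min tT.
exists d => // g L [g0 gL gM].
have -> : rsum (fun s => K s * (s < a)%R%:R) (stop a x) g L =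
    rsum K x (fun l => Order.min (g l) a) L.
  apply: eq_bigr => l _; rewrite /stop; case: (ltP (g l) a) => ga.
    by rewrite mulr1.
  rewrite mulr0 mul0r min_r ?subrr ?mulr0//.
  by apply: le_trans ga _; case/andP: (gM l (ltn_ord l)).
apply: dP; split; rewrite ?g0 ?gL// => l lL.
have /andP[h1 h2] := gM l lL.
case: (leP (g l) a) => ?; case: (leP (g l.+1) a) => ? //; lra.
Qed.

(** Only the grid interval that straddles [a] contributes an error. *)
Lemma has_rint_initial a (b : pred R) x : {within timeset T, continuous x} ->
  0 <= a -> (forall s, s < a -> b s) -> (forall s, b s -> s <= a) ->
  has_rint (fun s => (b s)%:R) x (stop a x).
Proof.
move=> cx a0 ab ba s t s0 st tT e e0.
have [d d0 dP] := unif_cont cx e0.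
exists d => // g L gr; have [g0 gL gM] := gr.
pose D l := (b (g l))%:R * (x (g l.+1) - stop a x (g l.+1)).
have -> : rsum (fun s => (b s)%:R) x g L - (stop a x t - stop a x s) =
    \sum_(l < L) D l.
  rewrite -g0 -gL -[X in _ - X](@telescope_sumr _ 0 L (fun l => stop a x (g l))) //.
  rewrite big_mkord -sumrB; apply: eq_bigr => l _; rewrite /D /stop.
  have /andP[h1 h2] := gM l (ltn_ord l).
  case: (boolP (b (g l))) => bl /=; first by rewrite (min_l (ba _ bl)); ring.
  have al : a <= g l by rewrite leNgt; apply: contra bl => /ab.
  by rewrite !min_r ?mul0r ?subrr//; lra.
suff : forall n, (n <= L)%N ->
   if b (g n) then \sum_(l < n) D l = 0 else `|\sum_(l < n) D l| <= e.
  move=> /(_ L (leqnn L)); case: ifP => // _ ->; by rewrite normr0 ltW.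
elim=> [|n IH] nL; first by rewrite big_ord0 normr0; case: ifP => // _; exact: ltW.
rewrite big_ord_recr /=; move: IH => /(_ (ltnW nL)).
have /andP[h1 h2] := gM n nL.
have /andP[b1 b2] := grid_mem0 s0 tT gr nL.
have /andP[b3 b4] := grid_mem0 s0 tT gr (ltnW nL).
case: (boolP (b (g n))) => bn; last first.
  have -> : D n = 0 by rewrite /D (negbTE bn) mul0r.
  rewrite addr0 => h; case: ifP => // bn'; exfalso.
  have e1 := ba _ bn'; have e2 : a <= g n by rewrite leNgt; apply: contra bn => /ab.
  move/negP: bn; apply; rewrite (_ : g n = g n.+1)//; lra.
have -> : D n = x (g n.+1) - stop a x (g n.+1) by rewrite /D bn mul1r.
move=> ->; rewrite add0r; case: ifP => bn'.
  by rewrite /stop min_l ?subrr// ba.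
rewrite /stop; case: (leP (g n.+1) a) => ga; first by rewrite subrr normr0 ltW.
have := ba _ bn => ?; apply/ltW/dP; [lra|lra|].
rewrite ger0_norm; lra.
Qed.

Lemma has_rint_le a x : {within timeset T, continuous x} -> 0 <= a ->
  has_rint (fun s => (s <= a)%R%:R) x (stop a x).
Proof.
move=> cx a0.
by apply: (has_rint_initial (b := fun s => s <= a) cx a0) => // s /ltW.
Qed.

Lemma has_rint_lt a x : {within timeset T, continuous x} -> 0 <= a ->
  has_rint (fun s => (s < a)%R%:R) x (stop a x).
Proof.
move=> cx a0.
by apply: (has_rint_initial (b := fun s => s < a) cx a0) => // s /ltW.
Qed.

End left_riemann.

(** * Paths of finite variation *)

Section controlled_paths.
Context {R : realType} (T : R).
Implicit Types (K x y G v : R -> R) (g : nat -> R) (L : nat).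

(** Bounded variation in the form in which it is used: [v] can be the total
    variation function, or any nondecreasing bound that limits of sums provide. *)
Definition controlled_by x v := forall s t, 0 <= s -> s <= t -> t <= T ->
  `|x t - x s| <= v t - v s.

Lemma bounded_variation_controlled x : 0 <= T -> bounded_variation 0 T x ->
  exists v, controlled_by x v.
Proof.
move=> T0 bvx; exists (fine \o total_variation 0 ^~ x) => s t s0 st tT /=.
have t0 := le_trans s0 st; have sT := le_trans st tT.
have f1 : total_variation 0 s x \is a fin_num.
  by apply/bounded_variationP => //; exact: bounded_variationl bvx.
have bvt : bounded_variation 0 t x by exact: bounded_variationl bvx.
have f2 : total_variation s t x \is a fin_num.
  by apply/bounded_variationP => //; exact: bounded_variationr bvt.
rewrite (total_variationD x s0 st) fineD// addrAC subrr add0r.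
by rewrite -lee_fin fineK//; exact: total_variation_ge.
Qed.

Lemma controlled_mono x v s t : controlled_by x v ->
  0 <= s -> s <= t -> t <= T -> v s <= v t.
Proof.
by move=> H s0 st tT; rewrite -subr_ge0; apply: le_trans (H s t s0 st tT).
Qed.

Lemma variation_controlled x v s : controlled_by x v -> itv_partition 0 T s ->
  variation 0 T x s <= v T - v 0.
Proof.
move=> H ps; rewrite /variation.
have ndv : {in `[0, T] &, nondecreasing_fun v}.
  move=> a b; rewrite !in_itv/= => /andP[a0 _] /andP[_ bT] ab.
  exact: (controlled_mono H).
rewrite -(nondecreasing_variation ndv ps) /variation.
apply: ler_sum_nat => i /andP[_ iS].
have h1 : 0 <= nth T (0 :: s) i.
  by apply: itv_partition_nth_ge ps => //; exact: ltnW.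
have h2 : nth T (0 :: s) i.+1 <= T by apply: itv_partition_nth_le ps.
have h3 : nth T (0 :: s) i <= nth T (0 :: s) i.+1.
  by case: ps => /(pathP T) => /(_ i iS) /ltW.
apply: le_trans (H _ _ h1 h3 h2) _; exact: ler_norm.
Qed.

Lemma controlled_bounded_variation x v : controlled_by x v ->
  bounded_variation 0 T x.
Proof.
by move=> H; exists (v T - v 0) => _ [s ps <-]; exact: variation_controlled.
Qed.

(** Each term of a left Riemann sum is at most [c] times an increment of [v], and
    these telescope. *)
Lemma has_rint_controlled c K x v G s t : 0 <= T ->
  (forall r, 0 <= r <= T -> `|K r| <= c) -> controlled_by x v ->
  has_rint T K x G -> 0 <= s -> s <= t -> t <= T ->
  `|G t - G s| <= c * (v t - v s).
Proof.
move=> T0 Kc xv H s0 st tT; apply/ler_addgt0Pr => e e0.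
have [d d0 dP] := H s t s0 st tT e e0.
have [m md] : exists m, (t - s) / 2 ^+ m <= d.
  have /cvgrPdist_le /(_ d d0) := cvg_half_pow (t - s).
  move=> [m _ /(_ m (leqnn m))]; rewrite sub0r normrN => h; exists m.
  by apply: le_trans (ler_norm _) h.
have gr := gridW md (grid_ugrid m st); have := dP _ _ gr.
set g := ugrid s t m in gr *; set L := (2 ^ m)%N in gr *.
have [g0 gL gM] := gr.
have h : `|rsum K x g L| <= c * (v t - v s).
  rewrite -g0 -gL -(@telescope_sumr _ 0 L (fun l => v (g l)))// big_mkord.
  rewrite mulr_sumr; apply: le_trans (ler_norm_sum _ _ _) _.
  apply: ler_sum => l _; rewrite normrM.
  have /andP[a1 a2] := grid_mem0 s0 tT gr (ltn_ord l).
  have /andP[a3 a4] := grid_mem0 s0 tT gr (ltnW (ltn_ord l)).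
  have /andP[a5 _] := gM l (ltn_ord l).
  by apply: ler_pM => //; [apply: Kc; rewrite a3|exact: xv].
move=> h2; have := ler_distD (rsum K x g L) (G t - G s) 0.
rewrite !subr0 [`|_ - rsum _ _ _ _|]distrC; lra.
Qed.

(** For a continuous path of bounded variation the square increments along a
    grid sum to at most the largest increment times the variation. *)
Lemma has_rint_sqr x v : {within timeset T, continuous x} ->
  controlled_by x v -> has_rint T x x (fun t => x t ^+ 2 / 2).
Proof.
move=> cx xv s t s0 st tT e e0.
have w0 : 0 <= v t - v s by rewrite subr_ge0; exact: (controlled_mono xv).
have [d d0 dP] := unif_cont cx (e := e / (v t - v s + 1))
  ltac:(rewrite divr_gt0//; lra).
exists d => // g L gr; have [g0 gL gM] := gr.
have -> : rsum x x g L - (x t ^+ 2 / 2 - x s ^+ 2 / 2) =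
   - (\sum_(l < L) (x (g l.+1) - x (g l)) ^+ 2) / 2.
  rewrite -g0 -gL -(@telescope_sumr _ 0 L (fun l => x (g l) ^+ 2 / 2))//.
  rewrite big_mkord -sumrB -sumrN mulr_suml; apply: eq_bigr => l _; by field.
rewrite ?normrN normrM ?normrN (ger0_norm (x := 2^-1))// ger0_norm; last first.
  by apply: sumr_ge0 => l _; exact: sqr_ge0.
suff : \sum_(l < L) (x (g l.+1) - x (g l)) ^+ 2 <=
    e / (v t - v s + 1) * (v t - v s).
  move=> h; have : e / (v t - v s + 1) * (v t - v s) <= e.
    rewrite -mulrA ler_piMr ?(ltW e0)// mulrC ler_pdivrMr; lra.
  lra.
have tv : v t - v s = \sum_(l < L) (v (g l.+1) - v (g l)).
  by rewrite -g0 -gL -(@telescope_sumr _ 0 L (fun l => v (g l)))// big_mkord.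
rewrite [X in _ * X]tv mulr_sumr; apply: ler_sum => l _.
have /andP[a1 a2] := grid_mem0 s0 tT gr (ltn_ord l).
have /andP[a3 a4] := grid_mem0 s0 tT gr (ltnW (ltn_ord l)).
have /andP[a5 a6] := gM l (ltn_ord l).
rewrite -[_ ^+ 2]ger0_norm ?sqr_ge0// normrX expr2.
apply: ler_pM => //; last exact: xv.
apply/ltW/dP; rewrite ?a1 ?a3//.
rewrite ger0_norm; lra.
Qed.

End controlled_paths.

(** * Integral and covariation sums along a grid *)

Section grid_sums.
Context {R : realType} (T : R).
Implicit Types (f x y z K G v : R -> R) (tau : nat -> R) (n k : nat).

Definition is_grid tau := [/\ tau 0%N = 0, forall k, tau k <= tau k.+1,
  forall k, tau k <= T & exists n, tau n = T].

(** As a grid reaches [T], the series below have finitely many nonzero terms.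
    The step integrand is left-continuous, hence predictable. *)
Definition gstep tau f t :=
  limn (series (fun k => f (tau k) * (tau k < t <= tau k.+1)%R%:R)).

Definition incr x (a b t : R) := x (Order.min t b) - x (Order.min t a).

Definition gsum tau f x t :=
  limn (series (fun k => f (tau k) * incr x (tau k) (tau k.+1) t)).

Definition gcov tau x y t :=
  limn (series (fun k =>
    incr x (tau k) (tau k.+1) t * incr y (tau k) (tau k.+1) t)).

Lemma cvg_series_fin (u : nat -> R) n : (forall k, (n <= k)%N -> u k = 0) ->
  series u @ \oo --> \sum_(k < n) u k.
Proof.
move=> u0; apply: cvg_near_cst; exists n => // m /= nm.
rewrite /series/= big_mkord -[in LHS](subnKC nm) big_split_ord /=.
by rewrite [X in _ + X]big1 ?addr0// => k _; rewrite u0//= leq_addr.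
Qed.

Lemma lim_series_fin (u : nat -> R) n : (forall k, (n <= k)%N -> u k = 0) ->
  limn (series u) = \sum_(k < n) u k.
Proof. by move=> u0; apply/cvg_lim => //; exact: cvg_series_fin. Qed.

Variable tau : nat -> R.
Hypothesis gtau : is_grid tau.

Lemma is_grid_mono : {homo tau : i j / (i <= j)%N >-> i <= j}.
Proof. by apply: homo_leq => //; [exact: le_trans|case: gtau]. Qed.

Lemma is_grid_end n k : tau n = T -> (n <= k)%N -> tau k = T.
Proof.
have [_ _ tT _] := gtau; move=> tn nk; apply/eqP; rewrite eq_le tT/=.
by rewrite -tn; exact: is_grid_mono.
Qed.

Lemma is_grid_ge0 k : 0 <= tau k.
Proof. by have [<- _ _ _] := gtau; exact: is_grid_mono. Qed.

Lemma incr_end x n k t : tau n = T -> (n <= k)%N -> t <= T ->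
  incr x (tau k) (tau k.+1) t = 0.
Proof.
move=> tn nk tT; rewrite /incr (is_grid_end tn nk).
by rewrite (is_grid_end tn (leqW nk)) subrr.
Qed.

Lemma gstepE f n t : tau n = T -> t <= T -> gstep tau f t =
  \sum_(k < n) f (tau k) * (tau k < t <= tau k.+1)%R%:R.
Proof.
move=> tn tT; apply: lim_series_fin => k nk.
by rewrite (is_grid_end tn nk) ltNge tT mulr0.
Qed.

Lemma gsumE f x n t : tau n = T -> t <= T -> gsum tau f x t =
  \sum_(k < n) f (tau k) * incr x (tau k) (tau k.+1) t.
Proof.
move=> tn tT; apply: lim_series_fin => k nk.
by rewrite (incr_end _ tn nk tT) mulr0.
Qed.

Lemma gcovE x y n t : tau n = T -> t <= T -> gcov tau x y t =
  \sum_(k < n) incr x (tau k) (tau k.+1) t * incr y (tau k) (tau k.+1) t.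
Proof.
move=> tn tT; apply: lim_series_fin => k nk.
by rewrite (incr_end _ tn nk tT) mul0r.
Qed.

Lemma gsum0 f x : 0 <= T -> gsum tau f x 0 = 0.
Proof.
move=> T0; have [_ _ _ [n tn]] := gtau.
rewrite (gsumE f x tn T0) big1// => k _; rewrite /incr !min_l ?is_grid_ge0//.
by rewrite subrr mulr0.
Qed.

(** A step integrand is a combination of indicators of initial intervals, each of
    which integrates to a stopped path. *)
Lemma has_rint_gstep f x : {within timeset T, continuous x} ->
  has_rint T (gstep tau f) x (gsum tau f x).
Proof.
move=> cx; have [_ tS tT [n tn]] := gtau.
have H k : (k < n)%N ->
   has_rint T (fun s => f (tau k) * ((s <= tau k.+1)%R%:R - (s <= tau k)%R%:R))
    x (fun s => f (tau k) * incr x (tau k) (tau k.+1) s).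
  move=> _; apply: has_rintZ; apply: has_rintB; apply: has_rint_le => //;
  exact: is_grid_ge0.
apply: eq_has_rint (has_rint_sum H) => // s; rewrite in_itv/= => /andP[s0 sT].
  rewrite (gstepE f tn sT); apply: eq_bigr => k _; congr (_ * _).
  case: (ltP (tau k) s) => ks /=; first by rewrite subr0.
  by rewrite (le_trans ks (tS k)) subrr.
by rewrite (gsumE f x tn sT).
Qed.

Lemma gstep_at f k t : tau k < t <= tau k.+1 -> gstep tau f t = f (tau k).
Proof.
move=> /andP[kt tk]; have [_ tS tT [n tn]] := gtau.
have tT' := le_trans tk (tT _).
rewrite (gstepE f tn tT').
have kn : (k < n)%N.
  rewrite ltnNge; apply/negP => nk; move: kt.
  by rewrite (is_grid_end tn nk) ltNge tT'.
rewrite (bigD1 (Ordinal kn))//= kt tk mulr1 big1 ?addr0// => j jk.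
have {}jk : (j : nat) != k by apply: contra jk => /eqP ?; apply/eqP/val_inj.
rewrite (_ : _ && _ = false) ?mulr0//; apply/negP => /andP[jt tj].
move: jk; rewrite neq_ltn => /orP[jk|kj].
  by move: (lt_le_trans kt tj); rewrite ltNge (is_grid_mono jk).
by move: (lt_le_trans jt tk); rewrite ltNge (is_grid_mono kj).
Qed.

Lemma gstep_0 f : 0 <= T -> gstep tau f 0 = 0.
Proof.
move=> T0; have [_ _ _ [n tn]] := gtau.
rewrite (gstepE f tn T0) big1// => k _.
by rewrite ltNge is_grid_ge0 mulr0.
Qed.

Lemma is_grid_cover t : 0 < t <= T -> exists k, tau k < t <= tau k.+1.
Proof.
move=> /andP[t0 tT]; have [tau0 _ _ [n tn]] := gtau.
have ex : exists k, t <= tau k by exists n; rewrite tn.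
case: (ex_minnP ex) => -[|k] tk kmin; first by move: tk; rewrite tau0; lra.
exists k; rewrite tk andbT ltNge; apply/negP => /kmin; by rewrite ltnn.
Qed.

Definition fine_for e f := forall k t, tau k <= t <= tau k.+1 ->
  `|f t - f (tau k)| <= e.

Lemma gstep_close e f t : fine_for e f -> 0 < t <= T ->
  `|gstep tau f t - f t| <= e.
Proof.
move=> fe /is_grid_cover [k kt]; rewrite (gstep_at f kt) distrC.
by apply: fe; case/andP: kt => /ltW -> ->.
Qed.

Lemma incr_le e f t k : fine_for e f -> `|incr f (tau k) (tau k.+1) t| <= e.
Proof.
have [_ tS tT _] := gtau; move=> fe; rewrite /incr.
have e0 : 0 <= e.
  apply: le_trans (fe k (tau k) _); first exact: normr_ge0.
  by rewrite lexx tS.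
case: (leP t (tau k)) => tk.
  by rewrite min_l ?subrr ?normr0//; exact: le_trans (tS k).
case: (leP t (tau k.+1)) => tk'; first by apply: fe; rewrite (ltW tk).
by apply: fe; rewrite lexx tS.
Qed.

(** The products of the two paths at the grid times telescope. This identity turns
    limits of integral sums into limits of covariation sums and back. *)
Lemma integration_by_parts x y t : 0 <= t <= T ->
  x t * y t - x 0 * y 0 = gsum tau x y t + gsum tau y x t + gcov tau x y t.
Proof.
move=> /andP[t0 tT]; have [tau0 tS _ [n tn]] := gtau.
rewrite !(gsumE _ _ tn tT) (gcovE _ _ tn tT) -!big_split /=.
pose w k := x (Order.min t (tau k)) * y (Order.min t (tau k)).
have -> : x t * y t - x 0 * y 0 = w n - w 0%N.
  by rewrite /w tn tau0 min_l// min_r.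
rewrite -(@telescope_sumr _ 0 n w)// big_mkord; apply: eq_bigr => k _.
rewrite /w /incr; have tk := tS k.
case: (leP t (tau k)) => h1; first by rewrite min_l; [ring|lra].
by case: (leP t (tau k.+1)) => h2; ring.
Qed.

(** Squares of completed increments stay in the sum; only the square of the increment
    in progress at time [s] may shrink, and it is at most [e ^+ 2]. *)
Lemma gcov_mono e z s t : fine_for e z -> 0 <= s -> s <= t -> t <= T ->
  gcov tau z z s - e ^+ 2 <= gcov tau z z t.
Proof.
move=> ze s0 st tT; have [tau0 tS _ [n tn]] := gtau.
have sT := le_trans st tT.
rewrite (gcovE _ _ tn tT) (gcovE _ _ tn sT).
pose D k (u : R) := incr z (tau k) (tau k.+1) u * incr z (tau k) (tau k.+1) u.
have D0 k u : 0 <= D k u by rewrite /D -expr2 sqr_ge0.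
have : (if (tau n <= s)%R then \sum_(k < n) D k s <= \sum_(k < n) D k t
  else \sum_(k < n) D k s - e ^+ 2 <= \sum_(k < n) D k t); last first.
  by case: ifP => // _; apply: le_trans; rewrite gerBl sqr_ge0.
elim: {tn} n => [|n]; first by rewrite !big_ord0 tau0 s0.
rewrite !big_ord_recr /=; have De : D n s <= e ^+ 2.
  rewrite /D -expr2 -[leLHS]ger0_norm ?sqr_ge0// normrX.
  by rewrite lerXn2r ?nnegrE ?(incr_le _ _ ze)//; apply: le_trans (incr_le s n ze).
have tn := tS n; have Dn := D0 n t.
case: (leP (tau n) s) => ns.
  case: (leP (tau n.+1) s) => nS; last lra.
  have -> : D n s = D n t; last lra.
  by rewrite /D /incr !min_r//; lra.
rewrite [tau n.+1 <= s]leNgt (lt_le_trans ns tn) /=.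
have -> : D n s = 0; last lra.
by rewrite /D /incr !min_l ?subrr ?mul0r//; lra.
Qed.

Lemma gcovDl x y z t : t <= T ->
  gcov tau (x \+ y) z t = gcov tau x z t + gcov tau y z t.
Proof.
move=> tT; have [_ _ _ [n tn]] := gtau.
rewrite !(gcovE _ _ tn tT) -big_split; apply: eq_bigr => k _.
by rewrite /incr /=; ring.
Qed.

Lemma gcovC x y t : gcov tau x y t = gcov tau y x t.
Proof.
congr (limn (series _)); apply/funext => k; exact: mulrC.
Qed.

Lemma gcovNl x z t : t <= T -> gcov tau (\- x) z t = - gcov tau x z t.
Proof.
move=> tT; have [_ _ _ [n tn]] := gtau.
rewrite !(gcovE _ _ tn tT) -sumrN; apply: eq_bigr => k _.
by rewrite /incr /=; ring.
Qed.

(** Each product is at most [e] times an increment of [v]. Hence paths of finite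
    variation do not contribute to limits of covariation sums. *)
Lemma gcov_controlled e x y v t : fine_for e x -> controlled_by T y v ->
  0 <= t <= T -> `|gcov tau x y t| <= e * (v t - v 0).
Proof.
move=> xe yv /andP[t0 tT]; have [tau0 tS tauT [n tn]] := gtau.
rewrite (gcovE _ _ tn tT).
pose w k := v (Order.min t (tau k)).
have -> : v t - v 0 = w n - w 0%N by rewrite /w tn tau0 min_l// min_r.
rewrite -(@telescope_sumr _ 0 n w)// big_mkord mulr_sumr.
apply: le_trans (ler_norm_sum _ _ _) _; apply: ler_sum => k _.
rewrite normrM; apply: ler_pM => //; first exact: incr_le.
apply: yv; first by rewrite le_min t0 is_grid_ge0.
  rewrite le_min !ge_min lexx /=; by rewrite tS orbT.
by rewrite ge_min tT.
Qed.

Lemma continuous_stop a x : 0 <= a -> {within timeset T, continuous x} ->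
  {within timeset T, continuous (stop a x)}.
Proof.
move=> a0 /within_contP cx; apply/within_contP => t tT e e0.
have /andP[t0 t1] := tT.
have [|d d0 dP] := cx (Order.min t a) _ e e0.
  by rewrite le_min t0 a0 ge_min t1.
exists d => // s /andP[s0 sT] st; apply: dP.
  by rewrite le_min s0 a0 ge_min sT.
apply: le_lt_trans st; rewrite /Order.min; case: ltP => ta; case: ltP => sa //.
- by rewrite !ler0_norm; lra.
- by rewrite !ger0_norm; lra.
- by rewrite subrr normr0.
Qed.

Lemma continuous_gsum f x : {within timeset T, continuous x} ->
  {within timeset T, continuous (gsum tau f x)}.
Proof.
move=> cx; have [_ _ _ [n tn]] := gtau.
have H k : {within timeset T, continuous
    (fun t => f (tau k) * incr x (tau k) (tau k.+1) t)}.
  apply/within_contP => t tT e e0.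
  have c1 : 0 < `|f (tau k)| + 1 by rewrite ltr_wpDl.
  have e1 : 0 < e / (`|f (tau k)| + 1) / 2 by rewrite !divr_gt0.
  have /within_contP/(_ t tT _ e1)[d d0 dP] := continuous_stop (is_grid_ge0 k) cx.
  have /within_contP/(_ t tT _ e1)[d' d'0 d'P] := continuous_stop (is_grid_ge0 k.+1) cx.
  exists (Order.min d d'); first by rewrite lt_min d0.
  move=> s sT; rewrite lt_min => /andP[sd sd'].
  have h1 := dP s sT sd; have h2 := d'P s sT sd'.
  rewrite -mulrBr normrM; apply: (@le_lt_trans _ _ ((`|f (tau k)| + 1) *
    `|incr x (tau k) (tau k.+1) t - incr x (tau k) (tau k.+1) s|)).
    by rewrite ler_wpM2r// lerDl.
  rewrite mulrC -ltr_pdivlMr// [ltRHS]splitr /incr.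
  rewrite (_ : _ - _ = (stop (tau k.+1) x t - stop (tau k.+1) x s) -
     (stop (tau k) x t - stop (tau k) x s)); last by rewrite /stop; ring.
  apply: le_lt_trans (ler_normB _ _) _; exact: ltrD.
apply/within_contP.
suff : forall m, {within timeset T, continuous
    (fun t => \sum_(k < m) f (tau k) * incr x (tau k) (tau k.+1) t)}.
  move=> /(_ n)/within_contP S t tT e e0; have [d d0 dP] := S t tT e e0.
  exists d => // s sT st; move: (dP s sT st).
  by rewrite !(gsumE f x tn)//; [case/andP: sT|case/andP: tT].
elim=> [|m IH]; first by apply/within_contP => t _ e e0; exists 1 => // s _ _;
  rewrite !big_ord0 subrr normr0.
rewrite (_ : (fun t => _) = (fun t => \sum_(k < m) f (tau k) * incr x (tau k) (tau k.+1) t)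
   \+ (fun t => f (tau m) * incr x (tau m) (tau m.+1) t)).
  exact: within_continuousD.
by apply/funext => t; rewrite big_ord_recr.
Qed.

End grid_sums.

(** * The endogenous grid *)

Section endogenous_grid.
Context {R : realType} (T : R) (q : nat).
Hypothesis T0 : 0 <= T.
Variables (n : nat) (h : R -> 'rV[R]_q).
Hypothesis ch : forall j, {within timeset T, continuous (fun t => h t 0 j)}.

Let tau := grid_time T n h.
Let c : R := (2 ^+ n)^-1.

Let c0 : 0 < c. Proof. by rewrite invr_gt0 exprn_gt0. Qed.

Definition exits (r : R) : set R :=
  [set t | r < t <= T /\ c < euclid_norm (h t - h r)].

Lemma grid_timeS k : tau k.+1 = inf (exits (tau k) `|` [set T]).
Proof. by []. Qed.

Lemma coord_le_euclid (v : 'rV[R]_q) j : `|v 0 j| <= euclid_norm v.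
Proof.
rewrite -sqrtr_sqr; apply: ler_wsqrtr.
by rewrite (bigD1 j)//= lerDl; apply: sumr_ge0 => i _; exact: sqr_ge0.
Qed.

Let nonempty r : exits r `|` [set T] !=set0. Proof. by exists T; right. Qed.

Let lbd r : r <= T -> lbound (exits r `|` [set T]) r.
Proof. by move=> rT t [[/andP[/ltW]]//|->]. Qed.

Let has_lb r : r <= T -> has_lbound (exits r `|` [set T]).
Proof. by move=> rT; exists r; exact: lbd. Qed.

Lemma grid_time_le k : tau k <= T.
Proof.
elim: k => [//|k IH]; rewrite grid_timeS.
by apply: ge_inf; [exact: has_lb|right].
Qed.

Lemma grid_time_nondec k : tau k <= tau k.+1.
Proof.
rewrite grid_timeS; apply: lb_le_inf; first exact: nonempty.
exact: lbd (grid_time_le k).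
Qed.

Lemma grid_time_near k t : tau k <= t < tau k.+1 ->
  euclid_norm (h t - h (tau k)) <= c.
Proof.
move=> /andP[kt tk]; rewrite leNgt; apply/negP => ht.
have tT := lt_le_trans tk (grid_time_le k.+1).
move: kt; rewrite le_eqVlt => /predU1P[kt|kt].
  move: ht; rewrite -kt subrr /euclid_norm big1 ?sqrtr0; first by move: c0; lra.
  by move=> j _; rewrite mxE expr0n.
move: tk; rewrite ltNge => /negP; apply; rewrite grid_timeS.
apply: ge_inf; first exact/has_lb/grid_time_le.
by left; split=> //; rewrite kt ltW.
Qed.

Lemma grid_time_ge0 k : 0 <= tau k.
Proof.
elim: k => [//|k IH]; apply: le_trans IH _; exact: grid_time_nondec.
Qed.

(** Before the exit the oscillation is at most [c] by definition, and at the exit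
    time by continuity. *)
Lemma grid_time_fine j : fine_for tau c (fun t => h t 0 j).
Proof.
move=> k t /andP[kt]; rewrite le_eqVlt => /predU1P[->|tk]; last first.
  have := coord_le_euclid (h t - h (tau k)) j; rewrite !mxE => /le_trans; apply.
  by apply: grid_time_near; rewrite kt.
have := grid_time_nondec k; rewrite le_eqVlt => /predU1P[<-|kS].
  by rewrite subrr normr0 ltW.
apply/ler_addgt0Pr => e e0.
have SI : 0 <= tau k.+1 <= T by rewrite grid_time_ge0 grid_time_le.
have /within_contP := ch (j := j); move=> /(_ _ SI e e0)[d d0 dP].
pose s := Order.max (tau k) (tau k.+1 - d / 2).
have sk : tau k <= s < tau k.+1.
  by rewrite le_max lexx /= gt_max kS /=; lra.
have /andP[s1 s2] := sk.
have sd : `|tau k.+1 - s| < d.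
  rewrite ger0_norm; last lra.
  have : tau k.+1 - d / 2 <= s by rewrite le_max lexx orbT.
  lra.
have sI : 0 <= s <= T.
  by have := grid_time_ge0 k; move/andP: SI; lra.
have h1 := dP s sI sd.
have h2 : `|h s 0 j - h (tau k) 0 j| <= c.
  have := coord_le_euclid (h s - h (tau k)) j; rewrite !mxE => /le_trans; apply.
  exact: grid_time_near.
have := ler_distD (h s 0 j) (h (tau k.+1) 0 j) (h (tau k) 0 j); lra.
Qed.

Lemma euclid_unif_cont : exists2 d, 0 < d &
  forall s t, 0 <= s <= T -> 0 <= t <= T -> `|s - t| <= d ->
    euclid_norm (h s - h t) <= c.
Proof.
have e0 : 0 < c / (q%:R + 1) by rewrite divr_gt0// ltr_wpDl.
have [d d0 dP] := unif_cont_finite ch e0.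
exists d => // s t sT tT st.
rewrite /euclid_norm -[leRHS]ger0_norm ?(ltW c0)// -sqrtr_sqr.
apply: ler_wsqrtr; apply: (@le_trans _ _ (\sum_(j < q) (c / (q%:R + 1)) ^+ 2)).
  apply: ler_sum => j _; rewrite !mxE -[leLHS]ger0_norm ?sqr_ge0// normrX.
  by rewrite lerXn2r ?nnegrE ?(ltW e0)//; apply/ltW/dP.
rewrite sumr_const card_ord -[_ *+ q]mulr_natl expr_div_n mulrCA.
rewrite ler_piMr ?sqr_ge0// ler_pdivrMr ?exprn_gt0 ?ltr_wpDl// mul1r.
have : (0 : R) <= q%:R by []. nra.
Qed.

(** By uniform continuity an exit takes at least a fixed time [d], so finitely many
    of them lead to [T]. *)
Lemma grid_time_end : exists k, tau k = T.
Proof.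
have [d d0 dP] := euclid_unif_cont.
have step k : Order.min (tau k + d) T <= tau k.+1.
  rewrite grid_timeS; apply: lb_le_inf; first exact: nonempty.
  move=> t [[/andP[kt tT] ht]|->]; last by rewrite ge_min lexx orbT.
  rewrite ge_min leNgt; apply/orP; left; apply/negP => td; move: ht.
  rewrite ltNge => /negP; apply; apply: dP => //; have k0 := grid_time_ge0 k; try lra.
  rewrite ger0_norm; lra.
have H k : Order.min (k%:R * d) T <= tau k.
  elim: k => [|k IH]; first by rewrite mul0r ge_min lexx.
  have := step k; rewrite -(natr1 k); move: IH; rewrite !ge_min.
  by move=> /orP[h1|h1] /orP[h2|h2]; apply/orP; [left|right|right|right]; lra.
exists (Num.truncn (T / d)).+1; apply/eqP; rewrite eq_le grid_time_le /=.
apply: le_trans (H _); rewrite le_min lexx andbT -ler_pdivrMr//.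
by apply/ltW/truncnS_gt.
Qed.

Lemma is_grid_grid_time : is_grid T tau.
Proof.
split=> //; [exact: grid_time_nondec|exact: grid_time_le|exact: grid_time_end].
Qed.

End endogenous_grid.

(** * Expectations *)

Lemma in_setb {U : Type} (b : U -> bool) (w : U) : (w \in [set v | b v]) = b w.
Proof. by apply/idP/idP; rewrite inE. Qed.

Section expectation.
Context {R : realType} {disp} {Omega : measurableType disp}
  (P : {measure set Omega -> \bar R}).
Hypothesis P1 : P setT = 1%E.
Implicit Types (f g Z D : Omega -> R) (E : set Omega) (Y : nat -> Omega -> R).

Definition Ex f : R := \int[P]_w f w.
Definition Int f := P.-integrable setT (EFin \o f).
Definition bdd f := exists c, forall w, `|f w| <= c.

Lemma Int_meas f : Int f -> measurable_fun setT f.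
Proof. by case/integrableP => /measurable_EFinP. Qed.

Lemma bdd_bounded f : bdd f -> [bounded f x | x in setT].
Proof.
move=> [c fc]; exists c; split; rewrite ?num_real// => x cx w _.
by apply: le_trans (fc w) (ltW cx).
Qed.

Lemma bddM f g : bdd f -> bdd g -> bdd (f \* g).
Proof.
move=> [a fa] [b gb]; exists (a * b) => w; rewrite normrM; exact: ler_pM.
Qed.

Lemma bddB f g : bdd f -> bdd g -> bdd (f \- g).
Proof.
move=> [a fa] [b gb]; exists (a + b) => w.
by apply: le_trans (ler_normB _ _) _; exact: lerD.
Qed.

Lemma bdd_Int f : measurable_fun setT f -> bdd f -> Int f.
Proof.
move=> mf bf; apply: measurable_bounded_integrable => //.
  by rewrite [X in (X < _)%E]P1 ltry.
exact: bdd_bounded.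
Qed.

Lemma IntMb Z f : measurable_fun setT Z -> bdd Z -> Int f -> Int (Z \* f).
Proof.
move=> mZ bZ If.
have := integrableMr measurableT mZ (bdd_bounded bZ) If.
by apply: eq_integrable.
Qed.

Lemma IntD f g : Int f -> Int g -> Int (f \+ g).
Proof. by move=> If Ig; apply: eq_integrable (integrableD measurableT If Ig). Qed.

Lemma IntB f g : Int f -> Int g -> Int (f \- g).
Proof. by move=> If Ig; apply: eq_integrable (integrableB measurableT If Ig). Qed.

Lemma IntZ c f : Int f -> Int (fun w => c * f w).
Proof.
by move=> If; apply: eq_integrable (integrableZl measurableT c If).
Qed.

Lemma Int_cst c : Int (fun=> c).
Proof. by apply: bdd_Int => //; exists `|c|. Qed.

Lemma Int_norm f : Int f -> Int (fun w => `|f w|).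
Proof. exact: integrable_norm. Qed.

Lemma Int_le f g : measurable_fun setT f -> Int g ->
  (forall w, `|f w| <= g w) -> Int f.
Proof.
move=> mf Ig fg; apply: (le_integrable measurableT _ _ Ig).
  exact/measurable_EFinP.
move=> w _ /=; rewrite lee_fin; apply: le_trans (fg w) (ler_norm _).
Qed.

Lemma Int_indic E : measurable E -> Int \1_E.
Proof.
move=> mE; apply: bdd_Int; first exact: measurable_indic.
by exists 1 => w; rewrite indicE; case: (w \in E); rewrite ?normr1 ?normr0.
Qed.

Lemma bdd_indic E : bdd (\1_E : Omega -> R).
Proof.
by exists 1 => w; rewrite indicE; case: (w \in E); rewrite ?normr1 ?normr0.
Qed.

Lemma IntMindic f E : measurable E -> Int f -> Int (f \* \1_E).
Proof.
move=> mE If.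
have := IntMb (measurable_indic mE) (bdd_indic E) If.
by apply: eq_integrable => // w _; rewrite /= mulrC.
Qed.

Lemma ExD f g : Int f -> Int g -> Ex (f \+ g) = Ex f + Ex g.
Proof. by move=> If Ig; rewrite /Ex RintegralD. Qed.

Lemma ExB f g : Int f -> Int g -> Ex (f \- g) = Ex f - Ex g.
Proof. by move=> If Ig; rewrite /Ex RintegralB. Qed.

Lemma ExZ c f : Int f -> Ex (fun w => c * f w) = c * Ex f.
Proof. by move=> If; rewrite /Ex RintegralZl. Qed.

Lemma Ex_cst c : Ex (fun=> c) = c.
Proof. by rewrite /Ex Rintegral_cst// [X in fine X]P1 mulr1. Qed.

Lemma eq_Ex f g : f =1 g -> Ex f = Ex g.
Proof. by move=> /funext->. Qed.

Lemma Ex_le f g : Int f -> Int g -> (forall w, f w <= g w) -> Ex f <= Ex g.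
Proof. by move=> If Ig fg; apply: le_Rintegral. Qed.

Lemma Ex_ge0 f : (forall w, 0 <= f w) -> 0 <= Ex f.
Proof. by move=> f0; apply: Rintegral_ge0. Qed.

Lemma Ex_norm f : Int f -> `|Ex f| <= Ex (fun w => `|f w|).
Proof. by move=> If; apply: le_normr_Rintegral. Qed.

Lemma EFin_Ex f : Int f -> (Ex f)%:E = (\int[P]_w (f w)%:E)%E.
Proof. by move=> If; rewrite fineK//; apply: integrable_fin_num. Qed.

Lemma integral_Ex f E : measurable E -> Int f ->
  (\int[P]_(w in E) (f w)%:E)%E = (Ex (f \* \1_E))%:E.
Proof.
move=> mE If; rewrite EFin_Ex; last exact: IntMindic.
rewrite integral_mkcond; apply: eq_integral => w _.
by rewrite patchE /= indicE; case: ifPn => _; rewrite ?mulr1 ?mulr0.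
Qed.

Lemma Ex_sum (L : nat) (f : nat -> Omega -> R) :
  (forall l, (l < L)%N -> Int (f l)) ->
  Int (fun w => \sum_(l < L) f l w) /\
  Ex (fun w => \sum_(l < L) f l w) = \sum_(l < L) Ex (f l).
Proof.
elim: L => [|L IH] If.
  split; first by apply: eq_integrable (Int_cst 0) => // w _ /=; rewrite big_ord0.
  by rewrite big_ord0 -[RHS](Ex_cst 0); apply: eq_Ex => w; rewrite big_ord0.
have [I1 E1] := IH (fun l lL => If l (ltnW lL)).
have e : (fun w => \sum_(l < L.+1) f l w) = (fun w => \sum_(l < L) f l w) \+ f L.
  by apply/funext => w; rewrite big_ord_recr.
rewrite e ExD ?E1 ?big_ord_recr//; last exact: If.
by split=> //; apply: IntD => //; exact: If.
Qed.

Lemma Ex_indic E : measurable E -> (Ex \1_E)%:E = P E.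
Proof.
move=> mE; rewrite EFin_Ex; last exact: Int_indic.
by rewrite integral_indic// setIT.
Qed.

Lemma Ex_eq0_ae f : Int f -> (forall w, 0 <= f w) -> Ex f = 0 ->
  {ae P, forall w, f w = 0}.
Proof.
move=> If f0 Ef.
have : (\int[P]_w `|(f w)%:E|)%E = 0%E.
  rewrite -(EFin_Ex (Int_norm If)) -[RHS]/(0%:E) -Ef; congr EFin.
  by apply: eq_Ex => w; rewrite ger0_norm.
move/(ae_eq_integral_abs P measurableT).
move=> /(_ (ltac:(exact/measurable_EFinP/Int_meas))).
by apply: filterS => w /(_ I) /= [].
Qed.

Lemma Ex_dct Y f g : (forall n, measurable_fun setT (Y n)) ->
  measurable_fun setT f ->
  {ae P, forall w, Y n w @[n --> \oo] --> f w} -> Int g ->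
  (forall n w, `|Y n w| <= g w) -> Ex (Y n) @[n --> \oo] --> Ex f.
Proof.
move=> mY mf Yf Ig Yg.
have m1 n : measurable_fun setT (EFin \o Y n) by exact/measurable_EFinP.
have m2 : measurable_fun setT (EFin \o f) by exact/measurable_EFinP.
have c1 : {ae P, forall w, setT w -> (Y n w)%:E @[n --> \oo] --> (f w)%:E}.
  by apply: filterS Yf => w h _; apply: cvg_EFin => //; exact: nearW.
have c2 : {ae P, forall w n, setT w -> (`|(Y n w)%:E| <= (g w)%:E)%E}.
  by apply: aeW => w n _ /=; rewrite lee_fin.
have [If _ h] := dominated_convergence measurableT m1 m2 c1 Ig c2.
have IY n : Int (Y n) by apply: Int_le (mY n) Ig _.
have e : [sequence (\int[P]_w (Y n w)%:E)%E]_n = EFin \o (fun n => Ex (Y n)).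
  by apply/funext => n /=; rewrite EFin_Ex.
rewrite e -(EFin_Ex If) in h.
exact: fine_cvg h.
Qed.

Lemma Int_sqr_le f : measurable_fun setT f -> Int (fun w => f w ^+ 2) -> Int f.
Proof.
move=> mf If2; apply: (@Int_le _ (fun w => 1 + f w ^+ 2)) => //.
  exact: IntD (Int_cst 1) If2.
move=> w /=; rewrite -[f w ^+ 2]real_normK ?num_real//.
have := normr_ge0 (f w); nra.
Qed.

(** Convergence almost surely together with a bound in the mean square gives
    convergence of the means: the deviation [D] satisfies
    [D <= min D k + D^2 / k], in which the first term has means tending to 0. *)
Lemma Ex_cvg_L2 Y f (C : R) : (forall n, measurable_fun setT (Y n)) ->
  measurable_fun setT f ->
  {ae P, forall w, Y n w @[n --> \oo] --> f w} ->
  (forall n, Int (fun w => Y n w ^+ 2)) ->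
  (forall n, Ex (fun w => Y n w ^+ 2) <= C) ->
  [/\ Int f, Int (fun w => f w ^+ 2), Ex (fun w => f w ^+ 2) <= C &
      forall E, measurable E ->
        Ex (Y n \* \1_E) @[n --> \oo] --> Ex (f \* \1_E)].
Proof.
move=> mY mf Yf IY2 EY.
have mf2 : measurable_fun setT (fun w => (f w ^+ 2)%:E).
  by apply/measurable_EFinP; exact: measurable_funX.
have mY2 n : measurable_fun setT (fun w => (Y n w ^+ 2)%:E).
  by apply/measurable_EFinP; exact: measurable_funX.
have fat : (\int[P]_w (f w ^+ 2)%:E <= C%:E)%E.
  have := @fatou _ _ _ P setT measurableT (fun n w => (Y n w ^+ 2)%:E) mY2
    (fun n w _ => ltac:(by rewrite lee_fin sqr_ge0)).
  have <- : (\int[P]_w (f w ^+ 2)%:E =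
      \int[P]_w limn_einf (fun n => (Y n w ^+ 2)%:E))%E.
    apply: ae_eq_integral => //.
      rewrite (_ : (fun w => _) = (fun w =>
          - limn_esup ((fun n => - (fun v => (Y n v ^+ 2)%:E) w)%E))%E).
        apply: measurableT_comp => //; apply: measurable_fun_limn_esup => n.
        exact: measurableT_comp.
      apply/funext => w; rewrite -[RHS]/(- limn_esup (-%E \o (fun n => (Y n w ^+ 2)%:E)))%E.
      by rewrite limn_esupN oppeK.
    apply: filterS Yf => w h _.
    have h2 : (Y n w ^+ 2)%:E @[n --> \oo] --> (f w ^+ 2)%:E.
      apply: cvg_EFin; first exact: nearW.
      by rewrite expr2; under eq_fun do rewrite expr2; exact: cvgM.
    rewrite is_cvg_limn_einfE; first by apply/esym/cvg_lim.
    by apply/cvg_ex; exists (f w ^+ 2)%:E.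
  move/le_trans; apply.
  rewrite limn_einf_lim; apply: lime_le; first exact: is_cvg_einfs.
  apply: nearW => n; apply: (@le_trans _ _ (\int[P]_w (Y n w ^+ 2)%:E)%E).
    by apply: ereal_inf_lbound; exists n => //=.
  by rewrite -EFin_Ex// lee_fin.
have If2 : Int (fun w => f w ^+ 2).
  apply/integrableP; split=> //; under eq_integral.
    by move=> w _; rewrite /= ger0_norm ?sqr_ge0//; over.
  by apply: le_lt_trans fat _; rewrite ltry.
have If : Int f by exact: Int_sqr_le.
have Ef : Ex (fun w => f w ^+ 2) <= C by rewrite -lee_fin EFin_Ex.
have IYn n : Int (Y n) by apply: Int_sqr_le => //; exact: IY2.
split=> // E mE.
have C0 : 0 <= C by apply: le_trans Ef; apply: Ex_ge0 => w; exact: sqr_ge0.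
pose D n w := `|Y n w - f w|.
have mD n : measurable_fun setT (D n).
  by apply: measurableT_comp => //; exact: measurable_funB.
have ID2 n : Int (fun w => D n w ^+ 2) /\ Ex (fun w => D n w ^+ 2) <= 4 * C.
  pose g w := 2 * Y n w ^+ 2 + 2 * f w ^+ 2.
  have Ig : Int g by apply: IntD; apply: IntZ.
  have Dg w : D n w ^+ 2 <= g w.
    rewrite /D /g -normrX ger0_norm ?sqr_ge0//.
    by have := sqr_ge0 (Y n w + f w); nra.
  have I : Int (fun w => D n w ^+ 2).
    apply: Int_le Ig _; first exact: measurable_funX.
    by move=> w; rewrite ger0_norm ?sqr_ge0.
  split=> //; apply: le_trans (Ex_le I Ig Dg) _.
  rewrite /g -[leLHS]/(Ex ((fun w => 2 * Y n w ^+ 2) \+ (fun w => 2 * f w ^+ 2))).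
  by rewrite ExD ?ExZ //; [have := EY n; lra|exact: IntZ..].
have ID n : Int (D n) by apply: Int_sqr_le => //; case: (ID2 n).
have De : Ex (D n) @[n --> \oo] --> (0 : R).
  apply/cvgrPdist_le => e e0.
  (* the square of [D] has mean at most [4 * C], so that its share is at most [e / 2] *)
  pose k := (8 * C + 1) / e.
  have k0 : 0 < k by rewrite divr_gt0// ltr_wpDl// mulr_ge0.
  pose m n w := Order.min (D n w) k.
  have mm n : measurable_fun setT (m n).
    by apply: measurable_minr.
  have Dm0 n w : 0 <= D n w by exact: normr_ge0.
  have mk n w : `|m n w| <= k.
    rewrite ger0_norm; first by rewrite /m ge_min lexx orbT.
    by rewrite /m le_min Dm0 ltW.
  have m0 : Ex (m n) @[n --> \oo] --> (0 : R).
    rewrite -(Ex_cst 0); apply: (Ex_dct mm _ _ (Int_cst k) mk) => //.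
    apply: filterS Yf => w h; apply/cvgrPdist_le => d d0.
    move/cvgrPdist_le : h => /(_ d d0); apply: filterS => n h.
    rewrite sub0r normrN ger0_norm; last by rewrite /m le_min Dm0 ltW.
    by rewrite /m ge_min /D distrC h.
  move/cvgrPdist_le : m0 => /(_ (e / 2) ltac:(by rewrite divr_gt0)).
  apply: filterS => n; rewrite !sub0r !normrN => hm.
  rewrite ger0_norm; last exact: Ex_ge0.
  have [I2 E2] := ID2 n.
  have Im : Int (m n) by apply: bdd_Int => //; exists k.
  have : Ex (D n) <= Ex (m n \+ (fun w => k^-1 * D n w ^+ 2)).
    apply: Ex_le => //; first by apply: IntD => //; exact: IntZ.
    move=> w /=; rewrite /m /Order.min; case: ltP => Dk.
      by rewrite lerDl mulr_ge0 ?sqr_ge0// invr_ge0 ltW.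
    apply: (@le_trans _ _ (k^-1 * D n w ^+ 2)); last by rewrite lerDr ltW.
    by rewrite expr2 mulrA ler_peMl// mulrC ler_pdivlMr// mul1r.
  rewrite ExD ?ExZ//; last exact: IntZ.
  have : k^-1 * Ex (fun w => D n w ^+ 2) <= e / 2.
    apply: (@le_trans _ _ (k^-1 * (4 * C))).
      by rewrite ler_wpM2l// invr_ge0 ltW.
    rewrite /k invf_div mulrAC ler_pdivrMr; last by rewrite ltr_wpDl// mulr_ge0.
    nra.
  move: hm; rewrite ger0_norm; last first.
    by apply: Ex_ge0 => w; rewrite /m le_min Dm0 ltW.
  lra.
apply/cvgrPdist_le => e e0; move/cvgrPdist_le : De => /(_ e e0).
apply: filterS => n; rewrite sub0r normrN ger0_norm; last first.
  by apply: Ex_ge0 => w; exact: normr_ge0.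
apply: le_trans; rewrite -ExB; [|exact: IntMindic..].
apply: le_trans (Ex_norm _) _; first by apply: IntB; exact: IntMindic.
apply: Ex_le => //; first by apply: Int_norm; apply: IntB; exact: IntMindic.
move=> w /=; rewrite -mulrBl normrM distrC ler_piMr//.
by rewrite indicE; case: (w \in E); rewrite ?normr1 ?normr0.
Qed.

End expectation.

(** * Filtrations *)

Section filtration.
Context {R : realType} {disp} {Omega : measurableType disp}
  (F : R -> set (set Omega)).

(** Shared by the usual augmentation of the canonical filtration and by the constant
    Borel filtration; through the latter, Borel measurability of the integral sums
    is a case of their adaptedness. *)
Record right_filtration : Prop := RightFiltration {
  filt_sigma : forall t, sigma_algebra setT (F t);
  filt_sub : forall t, F t `<=` measurable;
  filt_mono : forall s t, s <= t -> F s `<=` F t;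
  filt_right : forall t E, (forall s, t < s -> F s E) -> F t E }.

(** Measurability for [F t] as a property of functions, so that the closure
    properties of measurable functions apply. *)
Definition adm (t : R) (f : Omega -> R) :=
  measurable_fun setT (f : g_sigma_algebraType (F t) -> R).

Hypothesis FF : right_filtration.
Implicit Types (f g : Omega -> R) (E : set Omega) (s t : R).

Lemma adm_gen t : (F t).-sigma.-measurable = F t.
Proof. by apply: measurable_g_measurableTypeE; exact: filt_sigma FF t. Qed.

Lemma admP t f : adm t f <-> forall B : set R, measurable B -> F t (f @^-1` B).
Proof.
split=> [h B mB|h _ B mB]; rewrite ?setTI; last by rewrite adm_gen; exact: h.
by have := h measurableT B mB; rewrite setTI adm_gen.
Qed.

Lemma adm_le_trans s t f : s <= t -> adm s f -> adm t f.
Proof. by move=> st /admP h; apply/admP => B /h; exact: filt_mono FF _ _ st _. Qed.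

Lemma adm_meas t f : adm t f -> measurable_fun setT f.
Proof.
by move=> /admP h _ B /h; rewrite setTI; exact: (filt_sub FF).
Qed.

Lemma filtT t : F t setT.
Proof. by rewrite -adm_gen; exact: measurableT. Qed.

Lemma filtC t E : F t E -> F t (~` E).
Proof. by rewrite -adm_gen; exact: measurableC. Qed.

Lemma filtI t E E' : F t E -> F t E' -> F t (E `&` E').
Proof. by rewrite -adm_gen; exact: measurableI. Qed.

Lemma filtU t E E' : F t E -> F t E' -> F t (E `|` E').
Proof. by rewrite -adm_gen; exact: measurableU. Qed.

Lemma filtD t E E' : F t E -> F t E' -> F t (E `\` E').
Proof. by rewrite -adm_gen; exact: measurableD. Qed.

Lemma adm_indic t E : F t E -> adm t \1_E.
Proof.
move=> FE; have mE : (F t).-sigma.-measurable E by rewrite adm_gen.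
exact: (measurable_indic (T := g_sigma_algebraType (F t)) mE).
Qed.

Lemma adm_bool t (b : Omega -> bool) : F t [set w | b w] ->
  adm t (fun w => (b w)%:R).
Proof.
move=> /adm_indic; rewrite /adm; congr measurable_fun.
apply/funext => w; rewrite indicE; congr (nat_of_bool _)%:R.
by apply/idP/idP; rewrite inE.
Qed.

Lemma filt_bool t (f : Omega -> R) (Q : pred R) : adm t f ->
  measurable [set x | Q x] -> F t [set w | Q (f w)].
Proof. by move=> /admP h mQ; have := h _ mQ. Qed.

Lemma filt_le t f a : adm t f -> F t [set w | f w <= a].
Proof.
move=> af; apply: (filt_bool (Q := fun x => x <= a) af).
rewrite [X in measurable X](_ : _ = `]-oo, a]%classic)//.
Qed.

Lemma filt_lt t f a : adm t f -> F t [set w | f w < a].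
Proof.
move=> af; apply: (filt_bool (Q := fun x => x < a) af).
rewrite [X in measurable X](_ : _ = `]-oo, a[%classic)//.
Qed.

Lemma filt_gt t f a : adm t f -> F t [set w | a < f w].
Proof.
move=> /(filt_le a) /filtC; congr (F t _).
by apply/seteqP; split => w /=; rewrite ltNge => /negP.
Qed.

Lemma filt_ge t f a : adm t f -> F t [set w | a <= f w].
Proof.
move=> /(filt_lt a) /filtC; congr (F t _).
by apply/seteqP; split => w /=; rewrite leNgt => /negP.
Qed.

Lemma admD t f g : adm t f -> adm t g -> adm t (f \+ g).
Proof. exact: measurable_funD. Qed.

Lemma admB t f g : adm t f -> adm t g -> adm t (f \- g).
Proof. exact: measurable_funB. Qed.

Lemma admM t f g : adm t f -> adm t g -> adm t (f \* g).
Proof. exact: measurable_funM. Qed.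

Lemma adm_cst t c : adm t (fun=> c).
Proof. exact: measurable_cst. Qed.

Lemma adm_norm t f : adm t f -> adm t (fun w => `|f w|).
Proof. by move=> af; apply: measurableT_comp => //; exact: measurable_normr. Qed.

Lemma adm_sum t (L : nat) (f : nat -> Omega -> R) :
  (forall l, (l < L)%N -> adm t (f l)) ->
  adm t (fun w => \sum_(l < L) f l w).
Proof.
elim: L => [|L IH] H.
  by rewrite (_ : (fun w => _) = fun=> 0); [exact: adm_cst|];
     apply/funext => w; rewrite big_ord0.
rewrite (_ : (fun w => _) = (fun w => \sum_(l < L) f l w) \+ f L).
  by apply: admD; [apply: IH => l lL; apply: H; exact: ltnW|exact: H].
by apply/funext => w; rewrite big_ord_recr.
Qed.

Lemma adm_cvg t (f : nat -> Omega -> R) g : (forall n, adm t (f n)) ->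
  (forall w, f n w @[n --> \oo] --> g w) -> adm t g.
Proof.
move=> af fg; apply: (measurable_fun_cvg af) => w _; exact: fg.
Qed.

End filtration.

(** * Integrals against bounded martingales *)

Section martingales.
Context {R : realType} (T : R) {disp} {Omega : measurableType disp}
  (P : {measure set Omega -> \bar R}) (F : R -> set (set Omega)).
Hypothesis P1 : P setT = 1%E.
Hypothesis FF : right_filtration F.
Implicit Types (M K G : R -> Omega -> R) (E : set Omega) (s t : R).

Local Notation Ex := (Ex P).
Local Notation Int := (Int P).

Lemma adaptedP M : adapted T F M <-> forall t, 0 <= t <= T -> adm F t (M t).
Proof.
split=> H t tT; apply/(admP FF); apply: H.
  by rewrite /timeset/= in_itv.
by move: tT; rewrite /timeset/= in_itv.
Qed.

Lemma martingaleP M : martingale T P F M <->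
  [/\ forall t, 0 <= t <= T -> adm F t (M t),
      forall t, 0 <= t <= T -> Int (M t) &
      forall s t E, 0 <= s -> s <= t -> t <= T -> F s E ->
        Ex (M t \* \1_E) = Ex (M s \* \1_E)].
Proof.
split=> [[/adaptedP aM iM mM]|[aM iM mM]]; split.
- exact: aM.
- by move=> t tT; apply: iM; rewrite /timeset/= in_itv.
- move=> s t E s0 st tT sE; have mE := filt_sub FF sE.
  have := mM s t s0 st tT E sE.
  rewrite !integral_Ex//; first by case.
    by apply: iM; rewrite /timeset/= in_itv/= s0 (le_trans st).
  by apply: iM; rewrite /timeset/= in_itv/= tT (le_trans s0).
- exact/adaptedP.
- by move=> t; rewrite /timeset/= in_itv/= => tT; exact: iM.
- move=> s t s0 st tT E sE; have mE := filt_sub FF sE.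
  rewrite !integral_Ex ?(mM s t)//; apply: iM.
    by rewrite s0 (le_trans st).
  by rewrite tT (le_trans s0).
Qed.

(** A bounded [F s]-measurable variable is a uniform limit of combinations of
    indicators of events of [F s], on each of which [D] has mean 0. *)
Lemma Ex_orthogonal s (Z D : Omega -> R) : adm F s Z -> bdd Z -> Int D ->
  (forall E, F s E -> Ex (D \* \1_E) = 0) -> Ex (Z \* D) = 0.
Proof.
move=> aZ [c Zc] ID D0.
have c0 : 0 <= c by apply: le_trans (Zc point).
have ED : Ex D = 0.
  by rewrite -(D0 setT (filtT FF s)); apply: eq_Ex => w; rewrite /= indicT mulr1.
apply/eqP; rewrite -normr_le0; apply/ler_addgt0Pr => e e0; rewrite add0r.
pose A := Ex (fun w => `|D w|).
have A0 : 0 <= A by apply: Ex_ge0.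
(* [z] is [Z] shifted and scaled by [p], so that a staircase of unit steps is within
   1 of it; this costs at most [A / p <= e] in the mean. *)
pose p := (A + 1) / e.
have p0 : 0 < p by rewrite divr_gt0// ltr_wpDl.
pose z w := p * (Z w + c).
pose J := (Num.truncn (p * (c + c))).+1.
have zJ w : z w < J%:R.
  apply: le_lt_trans (truncnS_gt _); rewrite ler_wpM2l ?(ltW p0)// lerD2r.
  by apply: le_trans (Zc w); exact: ler_norm.
have z0 w : 0 <= z w.
  rewrite mulr_ge0 ?(ltW p0)//; have := Zc w; rewrite ler_norml; lra.
pose B j := [set w | j.+1%:R <= z w].
have FB j : F s (B j).
  apply: (filt_ge FF); apply: admM; first exact: adm_cst.
  by apply: admD => //; exact: adm_cst.
have zB w : `|z w - \sum_(j < J) \1_(B j) w| <= 1.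
  suff : forall n : nat, if (n%:R <= z w)%R then \sum_(j < n) \1_(B j) w = n%:R :> R
      else (z w - 1 <= \sum_(j < n) \1_(B j) w <= z w)%R.
    by move=> /(_ J); rewrite leNgt zJ /= => /andP[h1 h2]; rewrite ler_norml; lra.
  elim=> [|n IH]; first by rewrite z0 big_ord0.
  rewrite big_ord_recr /=; move: IH; case: (leP n%:R (z w)) => nz.
    move=> ->; rewrite indicE; case: (leP n.+1%:R (z w)) => nz'.
      by rewrite mem_set// -natr1.
    rewrite memNset ?addr0; last by rewrite /B /= leNgt nz'.
    by rewrite nz andbT; move: nz'; rewrite -natr1; lra.
  have nz' : z w < n.+1%:R by apply: lt_le_trans nz _; rewrite ler_nat.
  rewrite [n.+1%:R <= z w]leNgt nz' /= indicE memNset ?addr0//.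
  by rewrite /B /= leNgt nz'.
pose S w := \sum_(j < J) (D \* \1_(B j)) w.
have [IS ES] := @Ex_sum _ _ _ P P1 J (fun j => D \* \1_(B j))
  (fun j _ => IntMindic (filt_sub FF (FB j)) ID).
have {}ES : Ex S = 0 by rewrite /S ES big1// => j _; exact: D0.
have aZ' : measurable_fun setT Z := adm_meas FF aZ.
have IZD : Int (Z \* D) by apply: IntMb => //; exists c.
have H : (Z \* D) \+ (fun w => c * D w) =
    (fun w => p^-1 * ((z w - \sum_(j < J) \1_(B j) w) * D w)) \+ (fun w => p^-1 * S w).
  apply/funext => w /=.
  have -> : S w = (\sum_(j < J) \1_(B j) w) * D w.
    by rewrite /S mulr_suml; apply: eq_bigr => j _; rewrite /= mulrC.
  by rewrite /z; field; rewrite gt_eqF.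
have Iq : Int (fun w => (z w - \sum_(j < J) \1_(B j) w) * D w).
  apply: (IntMb (Z := fun w => z w - \sum_(j < J) \1_(B j) w)) => //.
    apply: (adm_meas FF (t := s)); apply: admB.
      apply: admM; first exact: adm_cst.
      by apply: admD => //; exact: adm_cst.
    by apply: (adm_sum (f := fun j => \1_(B j))) => j _; exact: (adm_indic FF).
  by exists 1.
have -> : Ex (Z \* D) = p^-1 * Ex (fun w => (z w - \sum_(j < J) \1_(B j) w) * D w).
  have := congr1 Ex H; rewrite !ExD//; try exact: IntZ.
  by rewrite !ExZ// ED ES !mulr0 !addr0.
rewrite normrM gtr0_norm ?invr_gt0//.
apply: (@le_trans _ _ (p^-1 * A)).
  rewrite ler_wpM2l ?invr_ge0 ?(ltW p0)//; apply: le_trans (Ex_norm Iq) _.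
  apply: Ex_le; [exact: Int_norm|exact: Int_norm|] => w.
  by rewrite normrM ler_piMl.
rewrite /p invf_div mulrAC ler_pdivrMr; [nra|exact: ltr_wpDl].
Qed.

Lemma martingale_orthogonal M s t Z : martingale T P F M ->
  0 <= s -> s <= t -> t <= T -> adm F s Z -> bdd Z ->
  Ex (Z \* (M t \- M s)) = 0.
Proof.
move=> /martingaleP[aM iM mM] s0 st tT aZ bZ.
have It : Int (M t) by apply: iM; rewrite tT (le_trans s0).
have Is : Int (M s) by apply: iM; rewrite s0 (le_trans st).
apply: Ex_orthogonal aZ bZ (IntB It Is) _ => E sE.
have mE := filt_sub FF sE.
rewrite -[RHS](subrr (Ex (M s \* \1_E))) -[X in X - _](mM s t)// -ExB; try exact: IntMindic.
by apply: eq_Ex => w /=; rewrite mulrBl.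
Qed.

Section transform.
Variables (M K : R -> Omega -> R) (c C : R).
Hypothesis mM : martingale T P F M.
Hypothesis Mc : forall t w, 0 <= t <= T -> `|M t w| <= c.
Hypothesis aK : forall t, 0 <= t <= T -> adm F t (K t).
Hypothesis KC : forall t w, 0 <= t <= T -> `|K t w| <= C.

Variables (s t d : R) (g : nat -> R) (L : nat).
Hypotheses (s0 : 0 <= s) (tT : t <= T) (gr : grid s t d g L).

Let S l w := rsum (K ^~ w) (M ^~ w) g l.

Lemma transform_adm l : (l <= L)%N -> adm F (g l) (S l).
Proof.
move=> lL.
apply: (adm_sum (f := fun i w => K (g i) w * (M (g i.+1) w - M (g i) w))) => i il.
have iL := leq_trans il lL.
have [_ aM _] := mM.
have /martingaleP[aM' _ _] := mM.
apply: admM; last first.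
  apply: admB; (apply: (adm_le_trans FF); last by
     apply: aM'; apply: grid_mem0 gr _ => //; rewrite ?(ltnW iL));
  by apply: (grid_mono gr) => //; rewrite ltnW.
apply: (adm_le_trans FF); last first.
  by apply: aK; apply: grid_mem0 gr _ => //; exact: ltnW.
by apply: (grid_mono gr) => //; exact: ltnW.
Qed.

Lemma transform_bdd l : (l <= L)%N -> bdd (S l).
Proof.
move=> lL; exists (\sum_(i < l) C * (c + c)) => w.
apply: le_trans (ler_norm_sum _ _ _) _; apply: ler_sum => i _.
have iL := leq_trans (ltn_ord i) lL.
have m1 := grid_mem0 s0 tT gr iL.
have m2 := grid_mem0 s0 tT gr (ltnW iL).
rewrite normrM; apply: ler_pM => //; first exact: KC.
by apply: le_trans (ler_normB _ _) _; apply: lerD; exact: Mc.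
Qed.

Lemma transform_step l : (l < L)%N ->
  [/\ 0 <= g l, g l <= g l.+1, g l.+1 <= T & s <= g l].
Proof.
move=> lL; have /andP[h1 h2] := grid_mem0 s0 tT gr lL.
have /andP[h3 h4] := grid_mem0 s0 tT gr (ltnW lL).
have /andP[h5 h6] := grid_mem gr (ltnW lL).
by split=> //; exact: (grid_mono gr).
Qed.

(** Each increment of [M] is orthogonal to the past. *)
Lemma transform_mean E l : F s E -> (l <= L)%N -> Ex (S l \* \1_E) = 0.
Proof.
move=> sE; have mE := filt_sub FF sE; elim: l => [|l IH] lL.
  by rewrite -[RHS](Ex_cst P1 0); apply: eq_Ex => w; rewrite /= /S /rsum big_ord0 mul0r.
have [g0 gS gT sg] := transform_step lL.
have -> : S l.+1 \* \1_E =
    (S l \* \1_E) \+ ((\1_E \* K (g l)) \* (M (g l.+1) \- M (g l))).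
  by apply/funext => w; rewrite /= /S /rsum big_ord_recr /=; ring.
have aZ : adm F (g l) (\1_E \* K (g l)).
  apply: admM; first by apply: (adm_indic FF); exact: (filt_mono FF) sg _ sE.
  by apply: aK; rewrite g0 (le_trans gS).
have bZ : bdd (\1_E \* K (g l)).
  exists C => w; rewrite normrM; have := KC w (t := g l); rewrite g0 (le_trans gS)//.
  move=> /(_ isT); apply: le_trans; rewrite ler_piMl// indicE.
  by case: (w \in E); rewrite ?normr1 ?normr0.
have /martingaleP[_ iM _] := mM.
rewrite ExD ?IH ?(ltnW lL)// ?(martingale_orthogonal mM)// ?addr0//.
  apply: IntMindic => //; apply: bdd_Int => //.
    exact: (adm_meas FF (transform_adm (ltnW lL))).
  exact: (transform_bdd (ltnW lL)).
apply: IntMb => //; first exact: (adm_meas FF aZ).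
by apply: IntB; apply: iM; rewrite ?g0 ?(le_trans g0)// (le_trans gS).
Qed.

(** By orthogonality the cross terms vanish, both in the square of the sum [S] and in
    the squares of the increments of [M]. *)
Lemma transform_sqr l : (l <= L)%N ->
  Ex (fun w => S l w ^+ 2) <=
    C ^+ 2 * (Ex (fun w => M (g l) w ^+ 2) - Ex (fun w => M (g 0%N) w ^+ 2)).
Proof.
have /martingaleP[aM iM _] := mM.
have bM r : 0 <= r <= T -> bdd (M r) by move=> rT; exists c => w; exact: Mc.
elim: l => [|l IH] lL.
  rewrite subrr mulr0 -(Ex_cst P1 0) le_eqVlt; apply/predU1P; left.
  by apply: eq_Ex => w; rewrite /= /S /rsum big_ord0 expr0n.
have [g0 gS gT sg] := transform_step lL.
have gl : 0 <= g l <= T by rewrite g0 (le_trans gS).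
have gl' : 0 <= g l.+1 <= T by rewrite gT (le_trans g0).
pose D := M (g l.+1) \- M (g l).
have aS := transform_adm (ltnW lL).
have bS := transform_bdd (ltnW lL).
have bK : bdd (K (g l)) by exists C => w; exact: KC.
have m1 : measurable_fun setT (M (g l)) := adm_meas FF (aM _ gl).
have m2 : measurable_fun setT (M (g l.+1)) := adm_meas FF (aM _ gl').
have mD : measurable_fun setT D by exact: measurable_funB.
have bD : bdd D by apply: bddB; exact: bM.
have mK : measurable_fun setT (K (g l)) := adm_meas FF (aK gl).
have mS : measurable_fun setT (S l) := adm_meas FF aS.
have e1 : (fun w => S l.+1 w ^+ 2) = (fun w => S l w ^+ 2) \+
    ((fun w => 2 * ((S l \* K (g l)) \* D) w) \+ ((K (g l) \* D) \* (K (g l) \* D))).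
  by apply/funext => w; rewrite /= /S /rsum big_ord_recr /= /D /=; ring.
have e2 : D \* D = ((fun w => M (g l.+1) w ^+ 2) \- (fun w => M (g l) w ^+ 2)) \+
    (fun w => - 2 * (M (g l) \* D) w).
  by apply/funext => w; rewrite /D /=; ring.
have IKD : Int ((K (g l) \* D) \* (K (g l) \* D)).
  by apply: bdd_Int => //; [do 2 apply: measurable_funM => //|do 2 apply: bddM => //].
have IDD : Int (D \* D) by apply: bdd_Int => //; [exact: measurable_funM|exact: bddM].
have IMD : Int (M (g l) \* D).
  by apply: bdd_Int => //; [exact: measurable_funM|apply: bddM => //; exact: bM].
have ISKD : Int ((S l \* K (g l)) \* D).
  by apply: bdd_Int => //; [do 2 apply: measurable_funM => //|do 2 apply: bddM => //].
have sq (f : Omega -> R) : measurable_fun setT f -> bdd f -> Int (fun w => f w ^+ 2).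
  move=> mf bf; apply: bdd_Int => //; first exact: measurable_funX.
  by case: (bddM bf bf) => a fa; exists a => w; rewrite expr2; exact: fa.
have IS2 := sq _ mS bS.
have I1 := sq _ m1 (bM _ gl); have I2 := sq _ m2 (bM _ gl').
have o1 : Ex ((S l \* K (g l)) \* D) = 0.
  apply: (martingale_orthogonal mM) => //; last exact: bddM.
  by apply: admM => //; exact: aK.
have o2 : Ex (M (g l) \* D) = 0.
  by apply: (martingale_orthogonal mM) => //; [exact: aM|exact: bM].
have EDD : Ex (D \* D) = Ex (fun w => M (g l.+1) w ^+ 2) - Ex (fun w => M (g l) w ^+ 2).
  rewrite e2 ExD ?ExB ?ExZ ?o2 ?mulr0 ?addr0//; [exact: IntB|exact: IntZ].
have h : Ex ((K (g l) \* D) \* (K (g l) \* D)) <= C ^+ 2 * Ex (D \* D).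
  rewrite -ExZ//; apply: Ex_le => //; first exact: IntZ.
  move=> w /=; rewrite mulrACA -!expr2 ler_wpM2r ?sqr_ge0//.
  have := KC w gl; rewrite -[K _ _ ^+ 2]real_normK ?num_real// => KC'.
  by rewrite lerXn2r// nnegrE; apply: le_trans KC'.
rewrite e1 ExD//; last by apply: IntD => //; exact: IntZ.
rewrite ExD// ?ExZ ?o1 ?mulr0 ?add0r//; last exact: IntZ.
have := IH (ltnW lL); rewrite EDD in h; lra.
Qed.

End transform.

(** The integral of a bounded adapted integrand against a bounded martingale,
    as a limit of martingale transforms that are bounded in mean square. *)
Lemma martingale_integral M K G c C : martingale T P F M ->
  (forall t w, 0 <= t <= T -> `|M t w| <= c) ->
  (forall t, 0 <= t <= T -> adm F t (K t)) ->
  (forall t w, 0 <= t <= T -> `|K t w| <= C) ->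
  (forall w, has_rint T (K ^~ w) (M ^~ w) (G ^~ w)) ->
  (forall w, G 0 w = 0) ->
  martingale T P F G /\
  forall t, 0 <= t <= T -> Int (fun w => G t w ^+ 2) /\
    Ex (fun w => G t w ^+ 2) <= C ^+ 2 * c ^+ 2.
Proof.
move=> mM Mc aK KC HG G0.
have /martingaleP[aM iM _] := mM.
pose S s t m w := rsum (K ^~ w) (M ^~ w) (ugrid s t m) (2 ^ m).
have Scvg s t w : 0 <= s -> s <= t -> t <= T ->
    S s t m w @[m --> \oo] --> G t w - G s w.
  by move=> s0 st tT; have := has_rint_cvg s0 st tT (HG w).
have Sadm s t m : 0 <= s -> s <= t -> t <= T -> adm F t (S s t m).
  move=> s0 st tT; have gr := @grid_ugrid R s t m st.
  have [_ gL _] := gr; rewrite -{1}gL; exact: (transform_adm mM aK s0 tT gr).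
have Gadm t : 0 <= t <= T -> adm F t (G t).
  move=> /andP[t0 tT]; apply: (@adm_cvg _ _ _ _ _ (fun m => S 0 t m)).
    by move=> m; apply: Sadm.
  by move=> w; have := Scvg 0 t w (lexx 0) t0 tT; rewrite G0 subr0.
have Sprop s t : 0 <= s -> s <= t -> t <= T ->
  [/\ Int (G t \- G s), Int (fun w => (G t \- G s) w ^+ 2),
     Ex (fun w => (G t \- G s) w ^+ 2) <= C ^+ 2 * c ^+ 2 &
     forall E, F s E -> Ex ((G t \- G s) \* \1_E) = 0].
  move=> s0 st tT.
  have gr m := @grid_ugrid R s t m st.
  have mS m : measurable_fun setT (S s t m) by apply: (adm_meas FF); exact: Sadm.
  have mG : measurable_fun setT (G t \- G s).
    by apply: measurable_funB; apply: (adm_meas FF); apply: Gadm;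
       rewrite ?s0 ?tT ?(le_trans s0)// (le_trans st).
  have IS2 m : Int (fun w => S s t m w ^+ 2).
    apply: bdd_Int => //; first exact: measurable_funX.
    have [a Sa] := transform_bdd Mc KC s0 tT (gr m) (leqnn _).
    exists (a ^+ 2) => w; rewrite normrX lerXn2r// ?nnegrE//; last exact: Sa.
    by apply: le_trans (Sa w).
  have ES2 m : Ex (fun w => S s t m w ^+ 2) <= C ^+ 2 * c ^+ 2.
    apply: le_trans (transform_sqr mM Mc aK KC s0 tT (gr m) (leqnn _)) _.
    rewrite ler_wpM2l ?sqr_ge0//.
    have tT' : 0 <= t <= T by rewrite tT (le_trans s0).
    have [_ -> _] := gr m.
    apply: (@le_trans _ _ (Ex (fun w => M t w ^+ 2))).
      by rewrite gerBl; apply: Ex_ge0 => w; exact: sqr_ge0.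
    have Mt w : M t w ^+ 2 <= c ^+ 2.
      rewrite -real_normK ?num_real// lerXn2r// ?nnegrE//; last exact: Mc.
      by apply: le_trans (Mc t w tT').
    rewrite -(Ex_cst P1 (c ^+ 2)); apply: Ex_le => //; last exact: Int_cst.
    apply: bdd_Int => //.
      by apply: measurable_funX; apply: (adm_meas FF); exact: aM.
    by exists (c ^+ 2) => w; rewrite ger0_norm ?sqr_ge0.
  have [|I1 I2 E2 cv] := Ex_cvg_L2 P1 mS mG _ IS2 ES2.
    by apply: aeW => w; exact: Scvg.
  split=> // E sE; have mE := filt_sub FF sE.
  have := cv E mE; rewrite (_ : (fun n => _) = fun=> 0).
    by move=> h; rewrite -(cvg_lim (@Rhausdorff R) h) lim_cst.
  apply/funext => m; exact: (transform_mean mM Mc aK KC s0 tT (gr m) sE (leqnn _)).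
have G00 t : G t \- G 0 = G t by apply/funext => w /=; rewrite G0 subr0.
have IG t : 0 <= t <= T -> Int (G t).
  by move=> /andP[t0 tT]; have [] := Sprop 0 t (lexx 0) t0 tT; rewrite G00.
split.
  apply/martingaleP; split=> // s t E s0 st tT sE.
  have [_ _ _ h] := Sprop s t s0 st tT.
  have mE := filt_sub FF sE.
  apply/eqP; rewrite -subr_eq0 -ExB; last 2 first.
    by apply: IntMindic => //; apply: IG; rewrite tT (le_trans s0).
    by apply: IntMindic => //; apply: IG; rewrite s0 (le_trans st).
  by rewrite -[X in _ == X](h E sE); apply/eqP/eq_Ex => w /=; rewrite mulrBl.
move=> t /andP[t0 tT]; have [_] := Sprop 0 t (lexx 0) t0 tT.
by rewrite G00.
Qed.

End martingales.

(** * Stopped martingales *)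

Section stopping.
Context {R : realType} (T : R) {disp} {Omega : measurableType disp}
  (P : {measure set Omega -> \bar R}) (F : R -> set (set Omega)).
Hypothesis T0 : 0 <= T.
Hypothesis P1 : P setT = 1%E.
Hypothesis FF : right_filtration F.
Implicit Types (M K G X : R -> Omega -> R) (E : set Omega) (s t : R).
Implicit Types (tau sigma : Omega -> R).

Local Notation Ex := (Ex P).
Local Notation Int := (Int P).

Lemma stopping_gt tau s : stopping_time T F tau -> 0 <= s <= T ->
  F s [set w | s < tau w].
Proof.
move=> [_ H] sT.
have /(filtC FF) := H s ltac:(by rewrite /timeset/= in_itv).
by congr (F s _); apply/seteqP; split => w /=; rewrite ltNge => /negP.
Qed.

Lemma stopping_min tau sigma : stopping_time T F tau ->
  stopping_time T F sigma ->
  stopping_time T F (fun w => Order.min (tau w) (sigma w)).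
Proof.
move=> [tT Ht] [sT Hs]; split=> [w|t tT'].
  have := tT w; have := sT w; rewrite /timeset/= !in_itv/=.
  by rewrite le_min ge_min => /andP[-> ->] /andP[-> ->].
have := filtU FF (Ht t tT') (Hs t tT').
congr (F t _); apply/seteqP; split => w /=; rewrite ge_min.
  by move=> [->|->]; rewrite ?orbT.
by move=> /orP.
Qed.

(** The stopped path is the limit of left Riemann sums of the indicator of
    [s < tau], every term of which is observed at time [t]. *)
Lemma adapted_stopped X tau : (forall t, 0 <= t <= T -> adm F t (X t)) ->
  continuous_paths T X -> stopping_time T F tau ->
  forall t, 0 <= t <= T -> adm F t (stopped X tau t).
Proof.
move=> aX cX st t tT; have /andP[t0 tT'] := tT; have [tauT _] := st.
have t_ge0 w : 0 <= tau w by have := tauT w; rewrite /timeset/= in_itv/= => /andP[].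
pose S m w := rsum (fun s => (s < tau w)%R%:R) (X ^~ w) (ugrid 0 t m) (2 ^ m).
have -> : stopped X tau t = X 0 \+ (stopped X tau t \- X 0).
  by apply/funext => w /=; rewrite addrC subrK.
apply: admD; first by apply: (adm_le_trans FF t0); apply: aX; rewrite lexx T0.
apply: (@adm_cvg _ _ _ _ _ S).
  move=> m; apply: (adm_sum (f := fun l w => (ugrid 0 t m l < tau w)%R%:R *
    (X (ugrid 0 t m l.+1) w - X (ugrid 0 t m l) w))) => l lm.
  have gr := @grid_ugrid R 0 t m t0.
  have m1 := grid_mem0 (lexx 0) tT' gr lm.
  have m2 := grid_mem0 (lexx 0) tT' gr (ltnW lm).
  have /andP[_ m3] := grid_mem gr lm; have /andP[_ m4] := grid_mem gr (ltnW lm).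
  apply: admM; last first.
    by apply: admB; [apply: (adm_le_trans FF m3)|apply: (adm_le_trans FF m4)]; exact: aX.
  apply: (adm_bool FF); apply: (filt_mono FF m4); exact: stopping_gt.
move=> w; have := has_rint_cvg (lexx 0) t0 tT' (has_rint_lt (cX w) (t_ge0 w)).
by rewrite /stop /stopped /= [Order.min 0 _]min_l.
Qed.

Lemma stopped_paths X tau : continuous_paths T X -> stopping_time T F tau ->
  continuous_paths T (stopped X tau).
Proof.
move=> cX [tauT _] w; apply: (continuous_stop (a := tau w)) (cX w).
by have := tauT w; rewrite /timeset/= in_itv/= => /andP[].
Qed.

(** Jensen's inequality for the absolute value: split [E] according to the sign of
    [M s]. *)
Lemma martingale_norm M s t E : martingale T P F M ->
  0 <= s -> s <= t -> t <= T -> F s E ->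
  Ex ((fun w => `|M s w|) \* \1_E) <= Ex ((fun w => `|M t w|) \* \1_E).
Proof.
move=> /(martingaleP T P FF)[aM iM mM] s0 st tT sE.
have sT : 0 <= s <= T by rewrite s0 (le_trans st).
have tT' : 0 <= t <= T by rewrite tT (le_trans s0).
pose A := E `&` [set w | 0 <= M s w]; pose B := E `&` [set w | M s w < 0].
have FA : F s A by apply: (filtI FF) => //; apply: (filt_ge FF); exact: aM.
have FB : F s B by apply: (filtI FF) => //; apply: (filt_lt FF); exact: aM.
have mA := filt_sub FF FA; have mB := filt_sub FF FB; have mE := filt_sub FF sE.
have -> : (fun w => `|M s w|) \* \1_E = (M s \* \1_A) \- (M s \* \1_B).
  apply/funext => w /=; rewrite !indicE /A /B !in_setI !in_setb.
  case: (w \in E) => /=; last by rewrite !mulr0 subrr.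
  case: (leP 0 (M s w)) => h; rewrite /= !mulr1 mulr0 ?subr0 ?sub0r.
    by rewrite ger0_norm.
  by rewrite ltr0_norm.
rewrite ExB ?(mM s t)//; try (apply: IntMindic => //; exact: iM).
rewrite -(mM s t) // -(mM s t)//.
rewrite -ExB; try (apply: IntMindic => //; exact: iM).
have It := iM t tT'.
apply: Ex_le; first by apply: IntB; exact: IntMindic.
  by apply: IntMindic => //; exact: Int_norm.
move=> w /=; rewrite !indicE /A /B !in_setI !in_setb.
case: (w \in E) => /=; last by rewrite !mulr0 subrr.
case: (leP 0 (M s w)) => h; rewrite /= !mulr1 mulr0 ?subr0 ?sub0r.
  exact: ler_norm.
by rewrite -normrN ler_norm.
Qed.

(** The value of [M] at the first grid time from [g l] on that is at least [sigma], and
    at [g L] if there is none. Summing forward from [l] makes downward induction on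
    [l] possible. *)
Definition grid_stop M sigma (g : nat -> R) (L l : nat) w := M (g l) w +
  \sum_(l <= i < L) (g i < sigma w)%R%:R * (M (g i.+1) w - M (g i) w).

Section grid_stopping.
Variables (M : R -> Omega -> R) (sigma : Omega -> R) (s t d : R)
  (g : nat -> R) (L : nat).
Hypothesis mM : martingale T P F M.
Hypothesis ssig : stopping_time T F sigma.
Hypotheses (s0 : 0 <= s) (tT : t <= T) (gr : grid s t d g L).

Local Notation V := (grid_stop M sigma g L).

Let VL w : V L w = M t w.
Proof. by have [_ gL _] := gr; rewrite /grid_stop big_geq// addr0 gL. Qed.

Let V_stop l w : (l <= L)%N -> sigma w <= g l -> V l w = M (g l) w.
Proof.
move=> lL sg; rewrite /grid_stop big_nat big1 ?addr0// => i /andP[li iL].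
by rewrite ltNge (le_trans sg) ?mul0r//; apply: (grid_mono gr) => //; exact: ltnW.
Qed.

Let V_go l w : (l < L)%N -> g l < sigma w -> V l w = V l.+1 w.
Proof.
move=> lL sg; rewrite /grid_stop big_ltn// sg mul1r; ring.
Qed.

Let gI l : (l <= L)%N -> 0 <= g l <= T.
Proof. exact: grid_mem0 gr. Qed.

Let IM r : 0 <= r <= T -> Int (M r).
Proof. by have /(martingaleP T P FF)[_ iM _] := mM; exact: iM. Qed.

Let IV l : (l <= L)%N -> Int (V l).
Proof.
move=> lL; have -> : V l = M (g l) \+ (fun w => \sum_(i < L)
   ((l <= i)%N%:R * (g i < sigma w)%R%:R) * (M (g i.+1) w - M (g i) w)).
  apply/funext => w; rewrite /grid_stop /=; congr (_ + _).
  rewrite (big_nat_widenl _ 0) // big_mkord big_mkcond; apply: eq_bigr => i _ /=.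
  by case: (l <= i)%N; rewrite ?mul1r ?mul0r.
apply: IntD; first exact: IM (gI lL).
have [] // := @Ex_sum _ _ _ P P1 L (fun i w =>
  ((l <= i)%N%:R * (g i < sigma w)%R%:R) * (M (g i.+1) w - M (g i) w)).
move=> i iL; apply: (IntMb (Z := fun w => (l <= i)%N%:R * (g i < sigma w)%R%:R)).
- apply: (adm_meas FF (t := g i)); apply: admM; first exact: adm_cst.
  by apply: (adm_bool FF); apply: stopping_gt => //; exact: gI (ltnW iL).
- exists 1 => w; rewrite normrM.
  by case: (l <= i)%N; case: (g i < sigma w); rewrite /= ?normr1 ?normr0 ?mulr0 ?mul0r ?mulr1.
- by apply: IntB; apply: IM; apply: gI => //; exact: ltnW.
Qed.

Let split_sets l E : (l < L)%N -> F (g l) E ->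
  [/\ F (g l) (E `&` [set w | sigma w <= g l]),
      F (g l.+1) (E `&` [set w | g l < sigma w]) &
      F (g l) (E `&` [set w | g l < sigma w])].
Proof.
move=> lL FE; have gl := gI (ltnW lL); have [_ Hs] := ssig.
have h : F (g l) (E `&` [set w | g l < sigma w]).
  by apply: (filtI FF) => //; exact: stopping_gt.
split=> //.
  by apply: (filtI FF) => //; apply: Hs; rewrite /timeset/= in_itv.
apply: (filt_mono FF) h; have [_ _ gM] := gr; by case/andP: (gM l lL).
Qed.

Let indic_split (a : R) (E : set Omega) w : \1_E w =
  \1_(E `&` [set w | sigma w <= a]) w + \1_(E `&` [set w | a < sigma w]) w :> R.
Proof.
rewrite !indicE !in_setI !in_setb.
by case: (w \in E) => //=; [case: leP|]; rewrite /= ?addr0 ?add0r.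
Qed.

(** Downward induction on [l]: on [sigma <= g l] nothing moves, and on the complement,
    which belongs to [F (g l)], the martingale property advances by one step. *)
Lemma stopped_mean l E : (l <= L)%N -> F (g l) E ->
  Ex (V l \* \1_E) = Ex (M (g l) \* \1_E).
Proof.
move=> lL; rewrite -(subKn lL); move: (L - l)%N (leq_subr l L) => j.
elim: j E => [|j IH] E jL FE.
  rewrite subn0 in FE *; apply: eq_Ex => w /=.
  by rewrite VL; have [_ -> _] := gr.
set i := (L - j.+1)%N in FE *.
have iL : (i < L)%N by rewrite /i -subSn// subSS leq_subr.
have iS : (L - j)%N = i.+1 by rewrite /i -subSn.
have [F1 F2 F3] := split_sets iL FE.
have [m1 m2] := (filt_sub FF F1, filt_sub FF F2).
have IVi := IV (ltnW iL); have IMi := IM (gI (ltnW iL)).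
have cut (f : Omega -> R) : Int f -> Ex (f \* \1_E) =
   Ex (f \* \1_(E `&` [set w | sigma w <= g i])) +
   Ex (f \* \1_(E `&` [set w | g i < sigma w])).
  move=> If; rewrite -ExD; try exact: IntMindic.
  by apply: eq_Ex => w /=; rewrite (indic_split (g i)) mulrDr.
rewrite !cut//; congr (_ + _).
  apply: eq_Ex => w /=; rewrite !indicE.
  case: (boolP (w \in _)) => [|_]; last by rewrite !mulr0.
  by rewrite inE => -[_ /= h]; rewrite V_stop// ltnW.
have := IH _ (ltnW jL); rewrite iS => /(_ _ F2).
have /(martingaleP T P FF)[_ _ mart] := mM.
have /andP[g0 _] := gI (ltnW iL); have /andP[_ gT] := gI iL.
rewrite (mart (g i) (g i.+1))//; last by have [_ _ gM] := gr; case/andP: (gM i iL).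
move=> <-; apply: eq_Ex => w /=; rewrite !indicE.
case: (boolP (w \in _)) => [|_]; last by rewrite !mulr0.
by rewrite inE => -[_ /= h]; rewrite V_go.
Qed.

(** The same induction, with Jensen's inequality on the part stopped at [g l]. As the
    bound involves only the fixed variable [M t], it provides the uniform
    integrability needed when the grid is refined. *)
Lemma stopped_tail k l E : (l <= L)%N -> F (g l) E ->
  Ex ((fun w => `|V l w|) \* \1_([set w | k < `|V l w|] `&` E)) <=
  Ex ((fun w => `|M t w|) \* \1_([set w | k < `|V l w|] `&` E)).
Proof.
move=> lL; rewrite -(subKn lL); move: (L - l)%N (leq_subr l L) => j.
elim: j E => [|j IH] E jL FE.
  have e : V (L - 0)%N = M t by apply/funext => w; rewrite subn0 VL.
  by rewrite e.
set i := (L - j.+1)%N in FE *.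
have iL : (i < L)%N by rewrite /i -subSn// subSS leq_subr.
have iS : (L - j)%N = i.+1 by rewrite /i -subSn.
have [F1 F2 F3] := split_sets iL FE.
have t0 : 0 <= t <= T.
  by have [_ <- _] := gr; exact: gI.
have mV i' : (i' <= L)%N -> measurable [set w | k < `|V i' w|].
  move=> i'L; rewrite -[X in measurable X]setTI.
  rewrite (_ : [set w | _] = (fun w => `|V i' w|) @^-1` `]k, +oo[%classic).
    apply: (Int_meas (Int_norm (IV i'L))) => //.
  by apply/seteqP; split => w /=; rewrite in_itv/= andbT.
set A := [set w | k < `|V i w|].
have cut (f : Omega -> R) : Int f -> Ex (f \* \1_(A `&` E)) =
   Ex (f \* \1_(A `&` (E `&` [set w | sigma w <= g i]))) +
   Ex (f \* \1_(A `&` (E `&` [set w | g i < sigma w]))).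
  move=> If; rewrite -ExD; try by apply: IntMindic => //; apply: measurableI;
    [exact: mV (ltnW iL)|apply: (filt_sub FF); eassumption].
  by apply: eq_Ex => w /=; rewrite (indic_split (g i)) !setIA mulrDr.
rewrite !cut; try (apply: Int_norm); [|exact: IM|exact: IV (ltnW iL)].
apply: lerD.
  have gi := gI (ltnW iL); have /andP[g0 _] := gi.
  pose B := [set w | k < `|M (g i) w|] `&` (E `&` [set w | sigma w <= g i]).
  have FB : F (g i) B.
    apply: (filtI FF) => //; apply: (filt_gt FF); apply: adm_norm.
    by have /(martingaleP T P FF)[aM _ _] := mM; exact: aM.
  have AB : A `&` (E `&` [set w | sigma w <= g i]) = B.
    apply/seteqP; split => w [/= h1 [h2 h3]]; split=> //; move: h1;
    by rewrite /A /= V_stop// ltnW.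
  rewrite AB; have := martingale_norm mM g0 _ tT FB.
  have -> : g i <= t by case/andP: (grid_mem gr (ltnW iL)).
  move=> /(_ isT); apply: le_trans; rewrite le_eqVlt; apply/predU1P; left.
  apply: eq_Ex => w /=; rewrite !indicE.
  case: (boolP (w \in _)) => [|_]; last by rewrite !mulr0.
  by rewrite inE => -[_ [_ /= h]]; rewrite V_stop// ltnW.
have := IH _ (ltnW jL); rewrite iS => /(_ _ F2) /=.
have -> : [set w | k < `|V i.+1 w|] `&` (E `&` [set w | g i < sigma w]) =
   A `&` (E `&` [set w | g i < sigma w]).
  apply/seteqP; split => w [/= h1 [h2 h3]]; split=> //; move: h1;
  by rewrite /A /= (V_go iL h3).
apply: le_trans; rewrite le_eqVlt; apply/predU1P; left.
apply: eq_Ex => w /=; rewrite !indicE.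
case: (boolP (w \in _)) => [|_]; last by rewrite !mulr0.
by rewrite inE => -[_ [_ /= h]]; rewrite (V_go iL h).
Qed.

Lemma stopped_value_Int : Int (V 0%N).
Proof. exact: IV. Qed.

Lemma stopped_valueE w : V 0%N w =
  M s w + rsum (fun r => (r < sigma w)%R%:R) (M ^~ w) g L.
Proof. by have [g0 _ _] := gr; rewrite /grid_stop g0 big_mkord. Qed.

End grid_stopping.
End stopping.

Section martingale_theorems.
Context {R : realType} (T : R) {disp} {Omega : measurableType disp}
  (P : {measure set Omega -> \bar R}) (F : R -> set (set Omega)).
Hypothesis T0 : 0 <= T.
Hypothesis P1 : P setT = 1%E.
Hypothesis FF : right_filtration F.
Implicit Types (M K G X : R -> Omega -> R) (E : set Omega) (s t : R).
Implicit Types (tau sigma : Omega -> R).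

Local Notation Ex := (Ex P).
Local Notation Int := (Int P).

(** The grid approximations of the stopped martingale have the right means;
    where they exceed the bound [c] by more than 1 they are dominated in mean
    by [M t], so the excess vanishes in the limit. *)
Lemma optional_stopping M sigma c : martingale T P F M ->
  continuous_paths T M -> stopping_time T F sigma ->
  (forall t w, 0 <= t <= T -> `|stopped M sigma t w| <= c) ->
  martingale T P F (stopped M sigma).
Proof.
move=> mM cM ssig Mc.
have /(martingaleP T P FF)[aM iM _] := mM.
have sM := adapted_stopped T0 FF aM cM ssig.
have mst t : 0 <= t <= T -> measurable_fun setT (stopped M sigma t).
  by move=> tT; exact: (adm_meas FF (sM t tT)).
have ist t : 0 <= t <= T -> Int (stopped M sigma t).
  by move=> tT; apply: bdd_Int => //; [exact: mst|exists c => w; exact: Mc].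
apply/(martingaleP T P FF); split=> // s t E s0 st tT FE.
have sT : 0 <= s <= T by rewrite s0 (le_trans st).
have tT' : 0 <= t <= T by rewrite tT (le_trans s0).
pose E' := E `&` [set w | s < sigma w].
have FE' : F s E'.
  apply: (filtI FF FE); exact: (stopping_gt FF ssig sT).
have mE := filt_sub FF FE; have mE' := filt_sub FF FE'.
have c0 : 0 <= c by apply: le_trans (Mc s point sT).
(* on the event [sigma <= s] the stopped process is constant from [s] on *)
suff key : Ex (stopped M sigma t \* \1_E') = Ex (M s \* \1_E').
  apply/eqP; rewrite -subr_eq0 -ExB; last 2 first.
    by apply: IntMindic => //; exact: ist.
    by apply: IntMindic => //; exact: ist.
  rewrite -[X in _ == X](subrr (Ex (M s \* \1_E'))) -[X in _ == X - _]key.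
  rewrite -ExB; try (by apply: IntMindic => //; first [exact: ist|exact: iM]).
  apply/eqP/eq_Ex => w /=; rewrite /E' !indicE in_setI in_setb /stopped.
  case: (w \in E); rewrite /= ?mulr0 ?subr0//.
  case: (ltP s (sigma w)) => h //=.
  by rewrite !mulr1 !mulr0 subr0 min_r ?subrr//; exact: le_trans st.
have gr m := @grid_ugrid R s t m st.
pose V m := grid_stop M sigma (ugrid s t m) (2 ^ m) 0.
have IV m : Int (V m) by exact: (stopped_value_Int P1 FF mM ssig s0 tT (gr m)).
have mV m : measurable_fun setT (V m) := Int_meas (IV m).
have Vcvg w : E' w -> V m w @[m --> \oo] --> stopped M sigma t w.
  move=> [_ /= sw]; have [sigT _] := ssig.
  have sig0 : 0 <= sigma w.
    by have := sigT w; rewrite /timeset/= in_itv/= => /andP[].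
  have := has_rint_cvg s0 st tT (has_rint_lt (cM w) sig0).
  move/(cvgD (cvg_cst (M s w))); rewrite /stop /stopped (min_l (ltW sw)).
  rewrite addrCA subrr addr0; apply: cvg_trans; apply: near_eq_cvg; apply: nearW => m /=.
  by rewrite /V (stopped_valueE _ _ (gr m)).
pose A m := [set w | c + 1 < `|V m w|].
have mA m : measurable (A m).
  rewrite -[X in measurable X]setTI.
  rewrite (_ : A m = (fun w => `|V m w|) @^-1` `]c + 1, +oo[%classic).
    exact: (Int_meas (Int_norm (IV m))).
  by apply/seteqP; split => w /=; rewrite in_itv/= andbT.
have notA w : E' w -> \forall m \near \oo, w \notin A m.
  move=> E'w; have := Vcvg w E'w; move/cvgrPdist_lt => /(_ 1 ltr01).
  apply: filterS => m h; rewrite notin_setE /A /=; apply/negP; rewrite -leNgt.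
  have := Mc t w tT'; have := ler_distD (stopped M sigma t w) (V m w) 0.
  rewrite !subr0 [`|V m w - _|]distrC; lra.
(* by domination: a path of [E'] lies in the excess set [A m] for finitely many [m] only *)
have tail0 : Ex ((fun w => `|M t w|) \* \1_(A m `&` E')) @[m --> \oo] --> (0 : R).
  rewrite -(Ex_cst P1 0).
  apply: (Ex_dct (g := fun w => `|M t w|)) => //.
  - move=> m; apply: (Int_meas (P := P)).
    apply: IntMindic; [exact: measurableI|apply: Int_norm; exact: iM].
  - apply: aeW => w; apply: cvg_near_cst.
    have [wE|wE] := pselect (E' w); last first.
      by apply: nearW => m /=; rewrite indicE in_setI (memNset wE) andbF mulr0.
    apply: filterS (notA w wE) => m wA.
    by rewrite /= indicE in_setI (negbTE wA) mulr0.
  - by apply: Int_norm; exact: iM.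
  - move=> m w /=; rewrite normrM normr_id ler_piMr// indicE.
    by case: (w \in _); rewrite ?normr1 ?normr0.
have body : Ex ((V m \* \1_E') \* \1_(~` A m)) @[m --> \oo] -->
    Ex (stopped M sigma t \* \1_E').
  apply: (Ex_dct (g := fun w => c + 1)) => //.
  - move=> m; apply: (Int_meas (P := P)).
    by apply: IntMindic; [exact: measurableC|exact: IntMindic].
  - by apply: (Int_meas (P := P)); apply: IntMindic => //; exact: ist.
  - apply: aeW => w; have [wE|wE] := pselect (E' w); last first.
      apply: cvg_near_cst; apply: nearW => m /=.
      by rewrite !indicE (memNset wE) !mulr0 mul0r.
    rewrite /= indicE (mem_set wE) mulr1; apply: cvg_trans (Vcvg w wE).
    apply: near_eq_cvg; apply: filterS (notA w wE) => m wA.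
    by rewrite /= !indicE in_setC wA !mulr1.
  - exact: Int_cst.
  - move=> m w /=; rewrite !indicE in_setC /A in_setb.
    case: (ltP (c + 1) `|V m w|) => h; rewrite /= ?mulr0 ?normr0 ?mulr1.
      by rewrite addr_ge0.
    by case: (w \in E'); rewrite ?mulr1 ?mulr0 ?normr0// addr_ge0.
have mean m : Ex (V m \* \1_E') = Ex (M s \* \1_E').
  have FE0 : F (ugrid s t m 0) E' by have [-> _ _] := gr m.
  rewrite (stopped_mean P1 FF mM ssig s0 tT (gr m) (leq0n _) FE0).
  by have [-> _ _] := gr m.
have tail m : `|Ex (V m \* \1_E') - Ex ((V m \* \1_E') \* \1_(~` A m))| <=
    Ex ((fun w => `|M t w|) \* \1_(A m `&` E')).
  have I1 : Int (V m \* \1_E') by exact: IntMindic.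
  have I2 : Int ((V m \* \1_E') \* \1_(~` A m)).
    by apply: IntMindic => //; exact: measurableC.
  have I3 : Int ((fun w => `|V m w|) \* \1_(A m `&` E')).
    by apply: IntMindic; [exact: measurableI|exact: Int_norm].
  have FE0 : F (ugrid s t m 0) E' by have [-> _ _] := gr m.
  apply: le_trans (stopped_tail P1 FF mM ssig s0 tT (gr m) (c + 1) (leq0n _) FE0).
  rewrite -ExB//; apply: le_trans (Ex_norm (IntB I1 I2)) _.
  apply: Ex_le => //; first by apply: Int_norm; exact: IntB.
  move=> w /=; rewrite !indicE in_setI in_setC.
  case: (w \in E'); rewrite ?mulr0 ?mul0r ?subrr ?normr0 ?andbF ?mulr0// andbT mulr1.
  by case: (w \in A m); rewrite /= ?mulr0 ?subr0 ?mulr1 ?subrr ?normr0.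
have : Ex ((V m \* \1_E') \* \1_(~` A m)) @[m --> \oo] --> Ex (M s \* \1_E').
  apply/cvgrPdist_le => e e0; move/cvgrPdist_le : tail0 => /(_ e e0).
  apply: filterS => m; rewrite sub0r normrN => h; rewrite -(mean m).
  apply: le_trans (tail m) _; apply: le_trans h; exact: ler_norm.
move=> h2; rewrite -(cvg_lim (@Rhausdorff R) body).
by rewrite (cvg_lim (@Rhausdorff R) h2).
Qed.

(** * The maximal inequality *)

Section maximal.
Variables (G : R -> Omega -> R) (e : R).
Hypothesis mG : martingale T P F G.
Hypothesis e0 : 0 < e.

Let exceed (p : nat -> R) l := [set w | exists2 j, (j < l)%N & e < `|G (p j) w|].

(** Split the event according to the first index at which [e] is exceeded: each piece
    belongs to the sigma-algebra of that time, so that Jensen's inequality compares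
    [G] there with [G T]. *)
Lemma maximal_grid (p : nat -> R) L : {homo p : i j / (i <= j)%N >-> i <= j} ->
  (forall j, (j < L)%N -> 0 <= p j <= T) ->
  (forall l, (l <= L)%N -> F T (exceed p l)) /\
  e * Ex \1_(exceed p L) <= Ex (fun w => `|G T w|).
Proof.
move=> pm pT; have /(martingaleP T P FF)[aG iG _] := mG.
have TT : 0 <= T <= T by rewrite T0 lexx.
have IGT := iG T TT.
have S0 : exceed p 0 = set0 by apply/seteqP; split => // w [].
have SS l : exceed p l.+1 = exceed p l `|` ([set w | e < `|G (p l) w|] `\` exceed p l).
  apply/seteqP; split => w /=.
    move=> [j]; rewrite ltnS leq_eqVlt => /predU1P[->|jl] h.
      by have [|] := pselect (exceed p l w); [left|right].
    by left; exists j.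
  by move=> [[j jl h]|[h _]]; [exists j => //; exact: ltnW|exists l].
have FS l j : (l <= L)%N -> (j < L)%N -> (l <= j)%N -> F (p j) (exceed p l).
  elim: l => [|l IH] lL jL lj.
    by rewrite S0 -(setCT); apply: (filtC FF); exact: (filtT FF).
  rewrite SS; have h := IH (ltnW lL) jL (ltnW lj).
  apply: (filtU FF) => //; apply: (filtD FF) => //; apply: (filt_gt FF).
  by apply: adm_norm; apply: (adm_le_trans FF (pm _ _ (ltnW lj))); apply: aG; exact: pT.
have FS' l : (l <= L)%N -> F T (exceed p l).
  elim: l => [|l IH] lL.
    by rewrite S0 -(setCT); apply: (filtC FF); exact: (filtT FF).
  rewrite SS; have h := IH (ltnW lL).
  apply: (filtU FF) => //; apply: (filtD FF) => //; apply: (filt_gt FF).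
  have pl := pT _ lL; have /andP[_ plT] := pl.
  by apply: adm_norm; apply: (adm_le_trans FF plT); apply: aG.
split=> //.
have mS l : (l <= L)%N -> measurable (exceed p l).
  by move=> lL; exact: filt_sub FF _ _ (FS' l lL).
suff : forall l, (l <= L)%N ->
    e * Ex \1_(exceed p l) <= Ex ((fun w => `|G T w|) \* \1_(exceed p l)).
  move=> /(_ L (leqnn L))/le_trans; apply; apply: Ex_le.
  - by apply: IntMindic; [exact: mS|exact: Int_norm].
  - exact: Int_norm.
  - by move=> w /=; rewrite ler_piMr// indicE; case: (w \in _).
elim=> [|l IH] lL.
  rewrite S0 indic0 (_ : _ \* _ = fun=> 0) ?Ex_cst ?mulr0//.
  by apply/funext => w /=; rewrite mulr0.
pose B := [set w | e < `|G (p l) w|] `\` exceed p l.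
have pl := pT _ lL; have /andP[pl0 plT] := pl.
have FB : F (p l) B.
  apply: (filtD FF); last exact: FS (ltnW lL) lL (leqnn l).
  by apply: (filt_gt FF); apply: adm_norm; exact: aG.
have mB := filt_sub FF FB; have mSl := mS l (ltnW lL).
have iS : \1_(exceed p l.+1) = (\1_(exceed p l) : Omega -> R) \+ \1_B.
  apply/funext => w; rewrite /= SS !indicE /B in_setU in_setD.
  by case: (w \in exceed p l) => /=; rewrite ?andbF ?andbT ?addr0 ?add0r.
rewrite iS ExD; try exact: Int_indic.
have -> : (fun w => `|G T w|) \* (\1_(exceed p l) \+ \1_B) =
   ((fun w => `|G T w|) \* \1_(exceed p l)) \+ ((fun w => `|G T w|) \* \1_B).
  by apply/funext => w /=; rewrite mulrDr.
rewrite ExD; try (apply: IntMindic => //; exact: Int_norm).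
rewrite mulrDr; apply: lerD; first exact: IH (ltnW lL).
apply: le_trans (martingale_norm FF mG pl0 plT (lexx T) FB).
rewrite -ExZ; last exact: Int_indic.
apply: Ex_le; first by apply: IntZ; exact: Int_indic.
  by apply: IntMindic => //; apply: Int_norm; exact: iG.
move=> w /=; rewrite indicE; case: (boolP (w \in B)) => [|_]; last by rewrite !mulr0.
by rewrite inE => -[/= h _]; rewrite !mulr1 ltW.
Qed.

Definition dyadic_exceed : set Omega :=
  [set w | exists m j, (j <= 2 ^ m)%N /\ e < `|G (ugrid 0 T m j) w|].

Lemma ugridS (s t : R) m j : ugrid s t m.+1 (j * 2) = ugrid s t m j.
Proof.
rewrite /ugrid natrM exprS; congr (_ + _ * _); field.
by rewrite expf_neq0.
Qed.

Lemma ugrid_mono (s t : R) m : s <= t ->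
  {homo ugrid s t m : i j / (i <= j)%N >-> i <= j}.
Proof.
move=> st i j ij; rewrite /ugrid lerD2l ler_wpM2l ?subr_ge0//.
by rewrite ler_wpM2r ?invr_ge0 ?exprn_ge0// ler_nat.
Qed.

(** The dyadic grids are nested, so their exceedance events increase to the whole
    event. *)
Lemma maximal_inequality : F T dyadic_exceed /\
  (P dyadic_exceed <= (Ex (fun w => `|G T w|) / e)%:E)%E.
Proof.
pose p m := ugrid 0 T m; pose U m := exceed (p m) (2 ^ m).+1.
have pT m j : (j < (2 ^ m).+1)%N -> 0 <= p m j <= T.
  by rewrite ltnS => jm; exact: grid_mem (grid_ugrid m T0) jm.
have H m := maximal_grid (ugrid_mono m T0) (pT m).
have FU m : F T (U m) by have [h _] := H m; exact: h.
have mU m := filt_sub FF (FU m).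
have UE : dyadic_exceed = \bigcup_m U m.
  apply/seteqP; split => w.
    by move=> [m [j [jm h]]]; exists m => //; exists j.
  by move=> [m _ [j jm h]]; exists m, j.
have Und : nondecreasing_seq U.
  apply/nondecreasing_seqP => m; apply/subsetPset => w [j jm h].
  exists (j * 2)%N; last by rewrite /p ugridS.
  by rewrite !ltnS in jm *; rewrite expnS mulnC leq_mul2l.
have FUU : F T (\bigcup_m U m).
  have := @bigcupT_measurable _ (g_sigma_algebraType (F T)) U.
  by rewrite (adm_gen FF); apply => m; exact: FU.
rewrite UE; split=> //.
have := nondecreasing_cvg_mu (mu := P) mU (filt_sub FF FUU) Und.
move=> h; rewrite -(cvg_lim _ h)//; apply: lime_le; first by apply/cvg_ex; exists (P (\bigcup_m U m)).
apply: nearW => m /=; rewrite -(Ex_indic P1 (mU m)) lee_fin ler_pdivlMr// mulrC.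
by have [_] := H m.
Qed.

End maximal.

End martingale_theorems.

(** * Dyadic times *)

Section dyadic_times.
Context {R : realType} (T : R).
Hypothesis T_gt0 : 0 < T.
Implicit Types (x : R -> R) (s t : R).

Lemma ugrid_mem m j : (j <= 2 ^ m)%N -> 0 <= ugrid 0 T m j <= T.
Proof. exact: grid_mem (grid_ugrid m (ltW T_gt0)). Qed.

Lemma dyadic_right t e : 0 <= t < T -> 0 < e ->
  exists m j, (j <= 2 ^ m)%N /\ t <= ugrid 0 T m j < t + e.
Proof.
move=> /andP[t0 tT] e0.
have [m mP] : exists m, T / 2 ^+ m < e.
  exists (Num.truncn (T / e)).
  have p0 : (0 : R) < 2 ^+ (Num.truncn (T / e)) by rewrite exprn_gt0.
  rewrite ltr_pdivrMr// mulrC -ltr_pdivrMr//; apply: lt_le_trans (truncnS_gt _) _.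
  by rewrite -natrX ler_nat ltn_expl.
have p0 : (0 : R) < 2 ^+ m by rewrite exprn_gt0.
pose z := t / T * 2 ^+ m; pose j := Num.truncn z.
have z0 : 0 <= z by rewrite mulr_ge0 ?(ltW p0)// divr_ge0 ?(ltW T_gt0).
have jz : j%:R <= z by rewrite /j truncn_le.
have zj : z < j.+1%:R by exact: truncnS_gt.
exists m, j.+1; split.
  rewrite -(ltr_nat R) natrX; apply: le_lt_trans jz _.
  by rewrite /z gtr_pMl// ltr_pdivrMr// mul1r.
rewrite /ugrid add0r subr0; apply/andP; split.
  have tz : t = T * (z / 2 ^+ m) by rewrite /z mulfK ?gt_eqF// mulrC divfK// gt_eqF.
  by rewrite [leLHS]tz ler_wpM2l ?(ltW T_gt0)// ler_wpM2r ?invr_ge0 ?(ltW p0) ?(ltW zj).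
apply: le_lt_trans (_ : t + T / 2 ^+ m < _); last by rewrite ltrD2l.
rewrite -(natr1 j) mulrDl mul1r mulrDr lerD2r.
have tz : t = T * (z / 2 ^+ m) by rewrite /z mulfK ?gt_eqF// mulrC divfK// gt_eqF.
by rewrite [leRHS]tz ler_wpM2l ?(ltW T_gt0)// ler_wpM2r ?invr_ge0 ?(ltW p0)//.
Qed.

Lemma path_le_dyadic x e : {within timeset T, continuous x} ->
  (forall m j, (j <= 2 ^ m)%N -> `|x (ugrid 0 T m j)| <= e) ->
  forall t, 0 <= t <= T -> `|x t| <= e.
Proof.
move=> /within_contP cx H t tT; have /andP[t0] := tT.
rewrite le_eqVlt => /predU1P[->|tT'].
  have := H 0%N 1%N isT; rewrite /ugrid expr0 divr1 mulr1 add0r subr0//.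
apply/ler_addgt0Pr => d d0; have [r r0 rP] := cx t tT d d0.
have [||m [j [jm /andP[h1 h2]]]] := @dyadic_right t r; rewrite ?t0//.
have h := rP _ (ugrid_mem jm).
have : `|t - ugrid 0 T m j| < r by rewrite ler0_norm; lra.
move=> /h; have := H m j jm.
have := ler_distD (x (ugrid 0 T m j)) (x t) 0; rewrite !subr0; lra.
Qed.

Lemma path_bounded x : {within timeset T, continuous x} ->
  exists b, forall t, 0 <= t <= T -> `|x t| <= b.
Proof.
move=> /within_contP cx.
have cy : {within timeset T, continuous (fun t => `|x t|)}.
  apply/within_contP => t tT e e0; have [d d0 dP] := cx t tT e e0.
  exists d => // s sT st; apply: le_lt_trans (dP s sT st); exact: ler_dist_dist.
have [c _ cP] := EVT_max (ltW T_gt0) cy.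
by exists `|x c| => t tT; apply: cP; rewrite in_itv.
Qed.

(** The Borel-Cantelli lemma for geometrically small probabilities. *)
Lemma summable_eventually {disp} {Omega : measurableType disp}
  (P : {measure set Omega -> \bar R}) (U : nat -> set Omega) (a z : R) :
  (forall n, measurable (U n)) -> 0 <= a -> 0 < z < 1 ->
  (forall n, (P (U n) <= (a * z ^+ n)%:E)%E) ->
  {ae P, forall w, \forall n \near \oo, ~ U n w}.
Proof.
move=> mU a0 /andP[z0 z1] PU; exists (lim_sup_set U); split.
- by apply: bigcapT_measurable => n; apply: bigcup_measurable => j _.
- apply: lim_sup_set_cvg0 => //.
  apply: (@le_lt_trans _ _ (a * (1 - z)^-1)%:E); last by rewrite ltry.
  apply: lime_le; first exact: is_cvg_nneseries.
  apply: nearW => n; apply: (@le_trans _ _ (\sum_(0 <= i < n) (a * z ^+ i)%:E)%E).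
    by apply: lee_sum => i _; exact: PU.
  rewrite sumEFin lee_fin; apply: geometric_le_lim => //.
  by rewrite ger0_norm// ltW.
- move=> w /= h n _; apply: contrapT => hn; apply: h; exists n => // j nj Uj.
  by apply: hn; exists j.
Qed.

End dyadic_times.

(** * Hitting times *)

Section hitting.
Context {R : realType} (T : R) {disp} {Omega : measurableType disp}
  (F : R -> set (set Omega)).
Hypothesis T_gt0 : 0 < T.
Hypothesis FF : right_filtration F.
Implicit Types (Q : R -> Omega -> Prop) (s t : R).

Let T0 : 0 <= T := ltW T_gt0.

Definition hit_set Q w : set R := [set t | 0 <= t <= T /\ Q t w] `|` [set T].

Definition hitting Q w : R := inf (hit_set Q w).

Lemma hit_set_lbound Q w : lbound (hit_set Q w) 0.
Proof. by move=> t [[/andP[]]//|->]. Qed.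

Lemma hitting_mem Q w : 0 <= hitting Q w <= T.
Proof.
apply/andP; split.
  by apply: lb_le_inf; [exists T; right|exact: hit_set_lbound].
by apply: ge_inf; [exists 0; exact: hit_set_lbound|right].
Qed.

Lemma hitting_le Q w t : 0 <= t <= T -> Q t w -> hitting Q w <= t.
Proof.
by move=> tT Qt; apply: ge_inf; [exists 0; exact: hit_set_lbound|left].
Qed.

(** Since [Q] persists for a moment after each time at which it holds, dyadic times
    detect it. *)
Lemma hitting_lt_dyadic Q w a : a <= T ->
  (forall t, 0 <= t < T -> Q t w -> exists2 e, 0 < e &
     forall s, t <= s < t + e -> s <= T -> Q s w) ->
  (hitting Q w < a <-> exists m j,
    [/\ (j <= 2 ^ m)%N, ugrid 0 T m j < a & Q (ugrid 0 T m j) w]).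
Proof.
move=> aT rQ; split=> [|[m [j [jm ja Qj]]]]; last first.
  by apply: le_lt_trans ja; apply: hitting_le => //; exact: ugrid_mem.
move=> /inf_lt []; first by exists T; right.
move=> t [[/andP[t0 tT] Qt]|->]; last by rewrite ltNge aT.
move=> ta; have tT' : 0 <= t < T by rewrite t0 (lt_le_trans ta).
have [e e0 eP] := rQ t tT' Qt.
have [|m [j [jm /andP[h1 h2]]]] := dyadic_right T_gt0 tT' (e := Order.min e (a - t)).
  by rewrite lt_min e0 subr_gt0.
have h3 : ugrid 0 T m j < t + e.
  by apply: lt_le_trans h2 _; rewrite lerD2l ge_min lexx.
have h4 : ugrid 0 T m j < a.
  by apply: lt_le_trans h2 _; rewrite addrC -lerBrDr ge_min lexx orbT.
exists m, j; split=> //; apply: eP; first by rewrite h1.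
by have /andP[] := ugrid_mem T_gt0 jm.
Qed.

(** Hitting is detected at dyadic times just after it happens, which is where the
    right-continuity of the filtration comes in. *)
Lemma hitting_stopping Q :
  (forall t, 0 <= t <= T -> F t [set w | Q t w]) ->
  (forall w t, 0 <= t < T -> Q t w -> exists2 e, 0 < e &
     forall s, t <= s < t + e -> s <= T -> Q s w) ->
  stopping_time T F (hitting Q).
Proof.
move=> FQ rQ.
have lt a : 0 <= a <= T -> F a [set w | hitting Q w < a].
  move=> /andP[a0 aT].
  pose A m j := if ((j <= 2 ^ m)%N && (ugrid 0 T m j < a)) then
     [set w | Q (ugrid 0 T m j) w] else set0.
  have FA m j : F a (A m j).
    rewrite /A; case: ifPn => [/andP[jm ja]|_].
      apply: (filt_mono FF (ltW ja)); apply: FQ; exact: ugrid_mem.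
    by rewrite -setCT; apply: (filtC FF); exact: (filtT FF).
  rewrite (_ : [set w | _] = \bigcup_m \bigcup_j A m j).
    have := @bigcupT_measurable _ (g_sigma_algebraType (F a)).
    rewrite (adm_gen FF) => H; apply: (H (fun m => \bigcup_j A m j)) => m.
    by apply: H => j; exact: FA.
  apply/seteqP; split => w /=.
    move/(hitting_lt_dyadic aT (rQ w)) => [m [j [jm ja Qj]]].
    by exists m => //; exists j => //; rewrite /A jm ja.
  move=> [m _ [j _]]; rewrite /A; case: ifPn => // /andP[jm ja] Qj.
  by apply/(hitting_lt_dyadic aT (rQ w)); exists m, j.
split=> [w|t]; rewrite /timeset/= in_itv/=; first exact: hitting_mem.
move=> /andP[t0]; rewrite le_eqVlt => /predU1P[->|tT].
  rewrite (_ : [set w | _] = setT); first exact: (filtT FF).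
  by apply/seteqP; split => w //= _; have /andP[] := hitting_mem Q w.
apply: (filt_right FF) => s ts.
pose r n := t + (Order.min s T - t) / 2 ^+ n.
have ms : 0 < Order.min s T - t by rewrite subr_gt0 lt_min ts.
have rt n : t < r n by rewrite ltrDl divr_gt0// exprn_gt0.
have rs n : r n <= Order.min s T.
  rewrite -lerBrDl ler_piMr// ?(ltW ms)// invf_le1 ?exprn_gt0//.
  by rewrite exprn_ege1// ler1n.
rewrite (_ : [set w | _] = \bigcap_n [set w | hitting Q w < r n]).
  have := @bigcapT_measurable _ (g_sigma_algebraType (F s)).
  rewrite (adm_gen FF); apply => n.
  have rsn := rs n; apply: (filt_mono FF (_ : r n <= s)).
    by apply: le_trans rsn _; rewrite ge_min lexx.
  apply: lt; rewrite (le_trans t0 (ltW (rt n)))/=.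
  by apply: le_trans rsn _; rewrite ge_min lexx orbT.
apply/seteqP; split => w /=; first by move=> h n _; exact: le_lt_trans h (rt n).
move=> h; apply/ler_addgt0Pr => e e0.
have [n nP] : exists n, (Order.min s T - t) / 2 ^+ n < e.
  exists (Num.truncn ((Order.min s T - t) / e)).
  rewrite ltr_pdivrMr ?exprn_gt0// mulrC -ltr_pdivrMr//.
  apply: lt_le_trans (truncnS_gt _) _.
  by rewrite -natrX ler_nat ltn_expl.
by apply/ltW; apply: lt_trans (h n I) _; rewrite /r ltrD2l.
Qed.

End hitting.

(** * Localization *)

Section localization.
Context {R : realType} (T : R) {disp} {Omega : measurableType disp}
  (P : {measure set Omega -> \bar R}) (F : R -> set (set Omega)).
Hypothesis T_gt0 : 0 < T.
Hypothesis P1 : P setT = 1%E.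
Hypothesis FF : right_filtration F.
Implicit Types (M N K G X : R -> Omega -> R) (s t : R).

Let T0 : 0 <= T := ltW T_gt0.

Local Notation Ex := (Ex P).
Local Notation Int := (Int P).

Definition level M (p : nat) := hitting T (fun t w => p%:R < `|M t w|).

Lemma level_stopping M p : adapted T F M -> continuous_paths T M ->
  stopping_time T F (level M p).
Proof.
move=> /(adaptedP T FF) aM cM; apply: hitting_stopping => //.
  by move=> t tT; apply: (filt_gt FF); apply: adm_norm; exact: aM.
move=> w t /andP[t0 tT] pM; have /within_contP cx := cM w.
have tI : 0 <= t <= T by rewrite t0 ltW.
have [d d0 dP] := cx t tI (`|M t w| - p%:R) ltac:(by rewrite subr_gt0).
exists d => // s /andP[ts std] sT.
have := dP s ltac:(by rewrite sT (le_trans t0)) ltac:(rewrite ler0_norm; lra).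
have := ler_distD (M s w) (M t w) 0; rewrite !subr0; lra.
Qed.

(** If [|M t|] exceeded [p], so would [|M s|] for some [s < t] by continuity, and the
    level would be hit before [t]. *)
Lemma level_bound M p w t : continuous_paths T M -> M 0 w = 0 ->
  0 <= t <= T -> t <= level M p w -> `|M t w| <= p%:R.
Proof.
move=> cM M0 tT tl; rewrite leNgt; apply/negP => pM.
have /andP[t0 t1] := tT.
have t_gt0 : 0 < t.
  rewrite lt_neqAle t0 andbT; apply/eqP => e.
  by move: pM; rewrite -e M0 normr0 ltNge ler0n.
have /within_contP cx := cM w.
have [d d0 dP] := cx t tT (`|M t w| - p%:R) ltac:(by rewrite subr_gt0).
pose s := Order.max 0 (t - d / 2).
have s0 : 0 <= s by rewrite le_max lexx.
have st : s < t by rewrite gt_max t_gt0 /=; lra.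
have ds : t - d / 2 <= s by rewrite le_max lexx orbT.
have sT : 0 <= s <= T by rewrite s0 (le_trans (ltW st)).
have h := dP s sT ltac:(rewrite ger0_norm; lra).
have ps : p%:R < `|M s w|.
  by have := ler_distD (M s w) (M t w) 0; rewrite !subr0; lra.
have := hitting_le T_gt0 (Q := fun t w => p%:R < `|M t w|) sT ps.
rewrite -/(level M p w); lra.
Qed.

Lemma level_mono M p w : level M p w <= level M p.+1 w.
Proof.
apply: lb_le_inf; first by exists T; right.
move=> t [[tT /= h]|->]; last by have /andP[] := hitting_mem T_gt0 (fun t w => p%:R < `|M t w|) w.
apply: hitting_le => //; apply: le_lt_trans h; by rewrite ler_nat.
Qed.

Lemma level_end M w : continuous_paths T M ->
  \forall p \near \oo, level M p w = T.
Proof.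
move=> cM; have [b bP] := path_bounded T_gt0 (cM w).
exists (Num.truncn b).+1 => // p /= bp.
rewrite /level /hitting /hit_set (_ : [set t | _] = set0) ?set0U ?inf1//.
apply/seteqP; split => // t [tT /= h]; move: h; rewrite ltNge => /negP; apply.
apply: le_trans (bP t tT) _; apply/ltW/(lt_le_trans (truncnS_gt b)).
by rewrite ler_nat.
Qed.

Definition localizes M (sigma : nat -> Omega -> R) :=
  (forall p, martingale T P F (stopped M (sigma p))) /\
  (forall p t w, 0 <= t <= T -> `|stopped M (sigma p) t w| <= p%:R).

(** Cap the given localizing times of both processes at their levels; the processes so
    stopped are bounded, and martingales by optional stopping. *)
Lemma localization M N : continuous_local_martingale0 T P F M ->
  continuous_local_martingale0 T P F N ->
  exists sigma : nat -> Omega -> R,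
    [/\ forall n, stopping_time T F (sigma n),
        forall n w, sigma n w <= sigma n.+1 w,
        {ae P, forall w, \forall n \near \oo, sigma n w = T},
        localizes M sigma & localizes N sigma].
Proof.
move=> [aM cM M0 [tM [sM mM eM lM]]] [aN cN N0 [tN [sN mN eN lN]]].
pose h p w := Order.min (level M p w) (level N p w).
have sh p : stopping_time T F (h p).
  by apply: stopping_min => //; exact: level_stopping.
pose sigma p w := Order.min (Order.min (tM p w) (tN p w)) (h p w).
have ssig p : stopping_time T F (sigma p).
  by apply: stopping_min => //; apply: stopping_min.
have sigma_le p w : sigma p w <= level M p w /\ sigma p w <= level N p w.
  by split; rewrite /sigma /h !ge_min lexx ?orbT.
have ss p t w : 0 <= t <= T -> 0 <= Order.min t (sigma p w) <= T.
  move=> /andP[t0 tT]; have [sT _] := ssig p.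
  have := sT w; rewrite /timeset/= in_itv/= => /andP[a b].
  by rewrite le_min t0 a ge_min tT.
have bM p t w : 0 <= t <= T -> `|stopped M (sigma p) t w| <= p%:R.
  move=> tT; rewrite /stopped; apply: (level_bound cM (M0 w) (ss p t w tT)).
  by have [a _] := sigma_le p w; rewrite ge_min a orbT.
have bN p t w : 0 <= t <= T -> `|stopped N (sigma p) t w| <= p%:R.
  move=> tT; rewrite /stopped; apply: (level_bound cN (N0 w) (ss p t w tT)).
  by have [_ a] := sigma_le p w; rewrite ge_min a orbT.
exists sigma; split=> //.
- move=> p w; rewrite /sigma /h !le_min !ge_min.
  by rewrite !(mM, mN, level_mono, orbT).
- apply: filterS2 eM eN => w eMw eNw.
  apply: filterS3 (filterI (level_end w cM) (level_end w cN)) eMw eNw => p [h1 h2] h3 h4.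
  by rewrite /sigma /h h1 h2 h3 h4 !minxx.
- split=> // p; pose rho w := Order.min (tN p w) (h p w).
  have e : stopped (stopped M (tM p)) rho = stopped M (sigma p).
    apply/funext => t; apply/funext => w; rewrite /stopped /rho /sigma.
    by congr (M _ w); rewrite /h -!minA; congr Order.min; rewrite [RHS]minC -!minA.
  rewrite -e; apply: (optional_stopping T0 P1 FF (c := p%:R)) => //.
  + apply: stopped_paths; [exact: cM|exact: sM].
  + exact: stopping_min.
  + by move=> t w tT; rewrite e; exact: bM.
- split=> // p; pose rho w := Order.min (tM p w) (h p w).
  have e : stopped (stopped N (tN p)) rho = stopped N (sigma p).
    apply/funext => t; apply/funext => w; rewrite /stopped /rho /sigma.
    congr (N _ w); rewrite /h -!minA; congr Order.min; congr Order.min.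
    by rewrite [RHS]minC -!minA.
  rewrite -e; apply: (optional_stopping T0 P1 FF (c := p%:R)) => //.
  + apply: stopped_paths; [exact: cN|exact: sN].
  + exact: stopping_min.
  + by move=> t w tT; rewrite e; exact: bN.
Qed.

End localization.

(** * Local martingales of finite variation and small integrals *)

Section integral_estimates.
Context {R : realType} (T : R) {disp} {Omega : measurableType disp}
  (P : {measure set Omega -> \bar R}) (F : R -> set (set Omega)).
Hypothesis T_gt0 : 0 < T.
Hypothesis P1 : P setT = 1%E.
Hypothesis FF : right_filtration F.
Implicit Types (D N : R -> Omega -> R) (s t : R).

Let T0 : 0 <= T := ltW T_gt0.

Local Notation Ex := (Ex P).
Local Notation Int := (Int P).

Lemma within_continuousM (f g : R -> R) : {within timeset T, continuous f} ->
  {within timeset T, continuous g} -> {within timeset T, continuous (f \* g)}.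
Proof. by move=> cf cg x; apply: cvgM; [exact: cf|exact: cg]. Qed.

Lemma adm_stopped_integrand (K : R -> Omega -> R) sigma s :
  adm F s (K s) -> stopping_time T F sigma -> 0 <= s <= T ->
  adm F s (fun w => K s w * (s < sigma w)%R%:R).
Proof.
move=> aK ss sT; apply: admM => //.
by apply: (adm_bool FF); exact: (stopping_gt FF ss sT).
Qed.

Lemma stopped_integrand_le (K : R -> Omega -> R) (sigma : Omega -> R) s w c :
  `|K s w| <= c -> `|K s w * (s < sigma w)%R%:R| <= c.
Proof.
move=> Kc; case: (s < sigma w); rewrite ?mulr1 ?mulr0 ?normr0//.
exact: le_trans Kc.
Qed.

Lemma stopping_ge0 sigma w : stopping_time T F sigma -> 0 <= sigma w.
Proof. by move=> [/(_ w)]; rewrite /timeset/= in_itv/= => /andP[]. Qed.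

(** The square of [D] is twice the integral of [D] against itself, since the
    sums of squared increments vanish; stopped at a bounded level, that
    integral is a martingale null at 0. *)
Lemma fv_local_martingale_eq0 D : continuous_local_martingale0 T P F D ->
  (forall w, bounded_variation 0 T (D ^~ w)) ->
  {ae P, forall w, forall t, 0 <= t <= T -> D t w = 0}.
Proof.
move=> lD bvD; have [sigma [ss _ es [mD bD] _]] := localization T_gt0 P1 FF lD lD.
have [/(adaptedP T FF) aD cD D0 _] := lD.
have sq p t : 0 <= t <= T -> {ae P, forall w, stopped D (sigma p) t w = 0}.
  move=> tT.
  pose K s w := D s w * (s < sigma p w)%R%:R.
  pose G s w := stopped D (sigma p) s w ^+ 2 / 2.
  have KE s w : K s w = stopped D (sigma p) s w * (s < sigma p w)%R%:R.
    by rewrite /K /stopped; case: ltP => //; rewrite !mulr0.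
  have aK s : 0 <= s <= T -> adm F s (K s).
    by move=> sT; apply: adm_stopped_integrand => //; exact: aD.
  have bK s w : 0 <= s <= T -> `|K s w| <= p%:R.
    move=> sT; rewrite KE; case: (s < sigma p w); rewrite ?mulr1 ?mulr0 ?normr0//.
    exact: bD.
  have rG w : has_rint T (K ^~ w) ((stopped D (sigma p)) ^~ w) (G ^~ w).
    have [v Dv] := bounded_variation_controlled T0 (bvD w).
    exact: (has_rint_stop (stopping_ge0 w (ss p)) (has_rint_sqr (cD w) Dv)).
  have G0 w : G 0 w = 0.
    by rewrite /G /stopped min_l ?D0 ?expr0n ?mul0r// stopping_ge0//; exact: ss.
  have [mG _] := martingale_integral P1 FF (mD p) (bD p) aK bK rG G0.
  have /(martingaleP T P FF)[_ iG mmG] := mG.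
  have EG : Ex (G t) = 0.
    have /andP[t0 t1] := tT.
    have := mmG 0 t setT (lexx 0) t0 t1 (filtT FF 0).
    rewrite (_ : G 0 \* \1_setT = fun=> 0) ?Ex_cst//.
      by move=> <-; apply: eq_Ex => w; rewrite /= indicT mulr1.
    by apply/funext => w; rewrite /= G0 mul0r.
  have := Ex_eq0_ae (iG t tT) _ EG.
  move=> /(_ (fun w => ltac:(by rewrite /G divr_ge0// sqr_ge0))).
  apply: filterS => w; rewrite /G => /eqP.
  by rewrite mulf_eq0 sqrf_eq0 invr_eq0 pnatr_eq0 orbF => /eqP.
have all : {ae P, forall w, forall p m j, (j <= 2 ^ m)%N ->
    stopped D (sigma p) (ugrid 0 T m j) w = 0}.
  apply/ae_foralln => p; apply/ae_foralln => m; apply/ae_foralln => j.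
  case: (leqP j (2 ^ m)) => jm; last by apply: aeW.
  by apply: filterS (sq p _ (ugrid_mem T_gt0 jm)).
apply: filterS2 all es => w H [p _ /(_ p (leqnn p)) sT] t tT.
apply/eqP; rewrite -normr_le0; move: t tT.
apply: (path_le_dyadic T_gt0 (cD w)) => m j jm.
have := H p m j jm; rewrite /stopped sT min_l; last first.
  by case/andP: (ugrid_mem T_gt0 jm).
by move=> ->; rewrite normr0.
Qed.

(** Doob's maximal inequality for the bounded localized integrals, followed by
    the Borel-Cantelli lemma. *)
Lemma integral_small_eventually (N : R -> Omega -> R)
    (K G : nat -> R -> Omega -> R) (a : R) :
  0 <= a -> continuous_local_martingale0 T P F N ->
  (forall n t, 0 <= t <= T -> adm F t (K n t)) ->
  (forall n t w, 0 <= t <= T -> `|K n t w| <= a / 2 ^+ n) ->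
  (forall n w, has_rint T (K n ^~ w) (N ^~ w) (G n ^~ w)) ->
  (forall n, continuous_paths T (G n)) ->
  (forall n w, G n 0 w = 0) ->
  {ae P, forall w, \forall n \near \oo, forall t, 0 <= t <= T ->
    `|G n t w| <= (3 / 4) ^+ n}.
Proof.
move=> a0 lN aK bK rG cG G0.
have [sigma [ss _ es [mN bN] _]] := localization T_gt0 P1 FF lN lN.
have TT : 0 <= T <= T by rewrite T0 lexx.
have e0 n : (0 : R) < (3 / 4) ^+ n by rewrite exprn_gt0.
have p20 n : (0 : R) < 2 ^+ n by rewrite exprn_gt0.
have loc p : {ae P, forall w, \forall n \near \oo, forall t, 0 <= t <= T ->
    `|stopped (G n) (sigma p) t w| <= (3 / 4) ^+ n}.
  pose b := a ^+ 2 * p%:R ^+ 2 + 1.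
  pose Gs n := stopped (G n) (sigma p).
  have b0 : 0 <= b by rewrite addr_ge0// mulr_ge0// sqr_ge0.
  have H n : martingale T P F (Gs n) /\
      Ex (fun w => `|Gs n T w|) <= b / 2 ^+ n.
    have [] := @martingale_integral _ T _ _ P F P1 FF (stopped N (sigma p))
      (fun s w => K n s w * (s < sigma p w)%R%:R) (Gs n) p%:R (a / 2 ^+ n)
      (mN p) (bN p).
    - move=> s sT; apply: adm_stopped_integrand => //; exact: aK.
    - by move=> s w sT; apply: stopped_integrand_le; exact: bK.
    - by move=> w; exact: (has_rint_stop (stopping_ge0 w (ss p)) (rG n w)).
    - by move=> w; rewrite /Gs /stopped min_l ?G0// stopping_ge0//; exact: ss.
    move=> mG /(_ T TT)[IG2 EG2]; split=> //.
    have /(martingaleP T P FF)[_ iG _] := mG.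
    (* [y <= 2^n y^2 / 2 + 2^-n / 2] turns the bound of order [4^-n] on the mean square
       into one of order [2^-n] on the mean *)
    apply: (@le_trans _ _ (Ex ((fun w => 2 ^+ n / 2 * Gs n T w ^+ 2) \+
        (fun=> (2 ^+ n)^-1 / 2)))).
      apply: Ex_le; first exact: (Int_norm (iG T TT)).
        by apply: IntD; [exact: IntZ|exact: Int_cst].
      move=> w /=; rewrite -[_ ^+ 2]real_normK ?num_real//.
      set y := `|_|.
      have -> : 2 ^+ n / 2 * y ^+ 2 + (2 ^+ n)^-1 / 2 =
         y + (2 ^+ n) * (y - (2 ^+ n)^-1) ^+ 2 / 2.
        by field; rewrite gt_eqF.
      by rewrite lerDl divr_ge0// mulr_ge0 ?sqr_ge0// ltW.
    rewrite ExD ?ExZ ?Ex_cst//; try exact: IntZ; try exact: Int_cst.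
    have : 2 ^+ n / 2 * Ex (fun w => Gs n T w ^+ 2) <=
        2 ^+ n / 2 * ((a / 2 ^+ n) ^+ 2 * p%:R ^+ 2).
      by rewrite ler_wpM2l// divr_ge0// ltW.
    have -> : 2 ^+ n / 2 * ((a / 2 ^+ n) ^+ 2 * p%:R ^+ 2) =
        a ^+ 2 * p%:R ^+ 2 / 2 ^+ n / 2 by field; rewrite gt_eqF.
    have : 0 <= b / 2 ^+ n by rewrite divr_ge0// ltW.
    rewrite /b mulrDl mul1r; lra.
  have mx n := maximal_inequality T0 P1 FF (proj1 (H n)) (e0 n).
  have mU n : measurable (dyadic_exceed T (Gs n) ((3 / 4) ^+ n)).
    exact: (filt_sub FF (proj1 (mx n))).
  (* the ratio [2 / 3] comes from [2^-n / (3 / 4)^n] *)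
  have := @summable_eventually _ _ _ P _ b (2 / 3) mU b0.
  have -> : 0 < (2 / 3 : R) < 1 by lra.
  move=> /(_ isT)[|A [mA A0 subA]].
    move=> n; have [_ h] := mx n; apply: le_trans h _; rewrite lee_fin.
    rewrite ler_pdivrMr//; apply: le_trans (proj2 (H n)) _.
    rewrite -mulrA ler_wpM2l// -exprMn.
    by rewrite (_ : 2 / 3 * (3 / 4) = (2^-1 : R)) ?exprVn//; field.
  exists A; split=> // w /= h; apply: subA => /= h2; apply: h.
  apply: filterS h2 => n nU; apply: path_le_dyadic => //.
    exact: (stopped_paths (cG n) (ss p)).
  move=> m j jm; rewrite leNgt; apply/negP => Gn; apply: nU.
  by exists m, j.
move/ae_foralln : loc => loc.
apply: filterS2 loc es => w H [p _ /(_ p (leqnn p)) sT].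
apply: filterS (H p) => n h t tT; have := h t tT.
by rewrite /stopped sT min_l//; case/andP: tT.
Qed.

End integral_estimates.

(** * Measurability of the endogenous grid *)

Section adapted_grids.
Context {R : realType} (T : R) {disp} {Omega : measurableType disp}
  (F : R -> set (set Omega)).
Hypothesis T_gt0 : 0 < T.
Hypothesis FF : right_filtration F.

Let T0 : 0 <= T := ltW T_gt0.

(** [tau < t] says that the stopped clock [min t tau] is less than [t], and the clock
    is adapted and continuous. *)
Lemma stopping_lt tau t : stopping_time T F tau -> 0 <= t <= T ->
  F t [set w | tau w < t].
Proof.
move=> st tT; have /andP[t0 tT'] := tT.
have H := @adapted_stopped _ T _ _ F T0 FF (fun s _ => s) tau.
have : adm F t (stopped (fun s _ => s) tau t).
  apply: H => //; first by move=> s _; exact: adm_cst.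
  by move=> w; apply/within_contP => s sT e e0; exists e.
move/(filt_lt FF t); congr (F t _); apply/seteqP.
by split => w /=; rewrite /stopped gt_min ltxx.
Qed.

Section grid.
Variables (q n : nat) (h : R -> Omega -> 'rV[R]_q).
Hypothesis ah : forall j, adapted T F (fun t w => h t w 0 j).
Hypothesis ch : forall j, continuous_paths T (fun t w => h t w 0 j).

Let tau k w := grid_time T n (h ^~ w) k.
Let c : R := (2 ^+ n)^-1.
Let c0 : 0 < c. Proof. by rewrite invr_gt0 exprn_gt0. Qed.

Let gtau w : is_grid T (tau ^~ w).
Proof. apply: is_grid_grid_time => // j; exact: ch. Qed.

Let S k t w := \sum_(j < q) (h t w 0 j - h (Order.min t (tau k w)) w 0 j) ^+ 2.

(** Taking the reference value at [min t (tau k)] instead of [tau k] makes the exit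
    condition at time [t] observable at time [t]. *)
Lemma grid_time_hitting k w : tau k.+1 w =
  hitting T (fun t w => tau k w < t /\ c ^+ 2 < S k t w) w.
Proof.
have E t : tau k w < t ->
    (c < euclid_norm (h t w - h (tau k w) w)) = (c ^+ 2 < S k t w).
  move=> kt; rewrite -(ltr_pXn2r (n := 2)) ?nnegrE ?(ltW c0) ?sqrtr_ge0//.
  rewrite /euclid_norm sqr_sqrtr; last by apply: sumr_ge0 => j _; exact: sqr_ge0.
  by congr (_ < _); apply: eq_bigr => j _; rewrite !mxE min_r// ltW.
transitivity (inf (exits T n (h ^~ w) (tau k w) `|` [set T])); first by [].
rewrite /hitting /hit_set; congr (inf (_ `|` _)).
apply/seteqP; split => t /= [].
  move=> /andP[kt tT] ct; split; last by rewrite -E.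
  by rewrite tT andbT (le_trans _ (ltW kt))//; exact: (is_grid_ge0 (gtau w) k).
move=> /andP[t0 tT] [kt ct]; split; first by rewrite kt tT.
by move: ct; rewrite -(E t kt).
Qed.

(** The exit condition is an open condition on continuous adapted processes, hence
    persists for a moment, and [hitting_stopping] applies by induction on [k]. *)
Lemma grid_time_stopping k : stopping_time T F (tau k).
Proof.
elim: k => [|k IH].
  split=> [w|t]; rewrite /timeset/= in_itv/= ?lexx// => /andP[t0 _].
  rewrite (_ : [set w | _] = setT); first exact: (filtT FF).
  by apply/seteqP; split.
have -> : tau k.+1 = hitting T (fun t w => tau k w < t /\ c ^+ 2 < S k t w).
  by apply/funext => w; exact: grid_time_hitting.
apply: hitting_stopping => //.
  move=> t tT; apply: (filtI FF); first exact: stopping_lt.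
  apply: (filt_gt FF).
  apply: measurable_sum => j; apply: measurable_funX; apply: admB.
    by have /(adaptedP T FF) := ah j; exact.
  have /(adaptedP T FF) aj := ah j.
  exact: (adapted_stopped T0 FF aj (@ch j) IH tT).
move=> w t /andP[t0 tT] [kt ct].
have cS : {within timeset T, continuous (S k ^~ w)}.
  rewrite /S; elim: (index_enum _) => [|j r IHr].
    by move=> x; under eq_fun do rewrite big_nil; exact: cvg_cst.
  rewrite (_ : (fun t => _) = (fun t => (h t w 0 j - h (Order.min t (tau k w)) w 0 j) ^+ 2)
      \+ (fun t => \sum_(j <- r) (h t w 0 j - h (Order.min t (tau k w)) w 0 j) ^+ 2)).
    have cj : {within timeset T, continuous
       (fun t => h t w 0 j - h (Order.min t (tau k w)) w 0 j)}.
      apply: within_continuousB; first exact: ch.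
      exact: (continuous_stop (stopping_ge0 w IH) (@ch j w)).
    by apply: within_continuousD => //; exact: (within_continuousM cj cj).
  by apply/funext => s; rewrite big_cons.
move/within_contP : cS => cS.
have tI : 0 <= t <= T by rewrite t0 ltW.
have [d d0 dP] := cS t tI (S k t w - c ^+ 2) ltac:(by rewrite subr_gt0).
exists d => // s /andP[ts std] sT; split; first exact: lt_le_trans ts.
have sI : 0 <= s <= T by rewrite sT (le_trans t0).
have h1 : `|t - s| < d by rewrite ler0_norm; lra.
have := dP s sI h1; have := ler_norm (S k t w - S k s w); lra.
Qed.

Variable f : R -> Omega -> R.
Hypothesis af : adapted T F f.
Hypothesis cf : continuous_paths T f.

Lemma adm_at_grid_time k t : 0 <= t <= T ->
  adm F t (fun w => f (tau k w) w * (tau k w < t)%R%:R).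
Proof.
move=> tT; have st := grid_time_stopping k.
rewrite (_ : (fun w => _) = stopped f (tau k) t \* (fun w => (tau k w < t)%R%:R)).
  apply: admM; last by apply: (adm_bool FF); exact: stopping_lt.
  by have /(adaptedP T FF) a := af; exact: (adapted_stopped T0 FF a cf st tT).
apply/funext => w; rewrite /= /stopped.
by case: (ltP (tau k w) t) => kt; rewrite ?mulr0.
Qed.

Lemma adm_gstep t : 0 <= t <= T ->
  adm F t (fun w => gstep (tau ^~ w) (f ^~ w) t).
Proof.
move=> tT; have /andP[t0 tT'] := tT.
pose u k w := f (tau k w) w * (tau k w < t <= tau k.+1 w)%R%:R.
apply: (@adm_cvg _ _ _ _ _ (fun m w => series (u ^~ w) m)); last first.
  move=> w; have [_ _ _ [m tm]] := gtau w.
  rewrite (gstepE (gtau w) _ tm tT'); apply: cvg_series_fin => k mk.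
  by rewrite /u (is_grid_end (gtau w) tm mk) ltNge tT' mulr0.
move=> m; rewrite (_ : (fun w => _) = (fun w => \sum_(k < m) u k w)).
  apply: (adm_sum (f := u)) => k _.
  rewrite (_ : u k = (fun w => f (tau k w) w * (tau k w < t)%R%:R) \*
     (fun w => (t <= tau k.+1 w)%R%:R)).
    apply: admM; first exact: adm_at_grid_time.
    apply: (adm_bool FF).
    have /(filtC FF) := stopping_lt (grid_time_stopping k.+1) tT.
    by congr (F t _); apply/seteqP; split => w /=; rewrite leNgt => /negP.
  apply/funext => w; rewrite /u /=.
  by case: (tau k w < t); case: (t <= _); rewrite /= ?mulr0 ?mulr1 ?mul0r.
by apply/funext => w; rewrite /series/= big_mkord.
Qed.

Variable x : R -> Omega -> R.
Hypothesis ax : adapted T F x.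
Hypothesis cx : continuous_paths T x.

Lemma adm_gsum t : 0 <= t <= T ->
  adm F t (fun w => gsum (tau ^~ w) (f ^~ w) (x ^~ w) t).
Proof.
move=> tT; have /andP[t0 tT'] := tT.
pose u k w := f (tau k w) w * incr (x ^~ w) (tau k w) (tau k.+1 w) t.
apply: (@adm_cvg _ _ _ _ _ (fun m w => series (u ^~ w) m)); last first.
  move=> w; have [_ _ _ [m tm]] := gtau w.
  rewrite (gsumE (gtau w) _ _ tm tT'); apply: cvg_series_fin => k mk.
  by rewrite /u (incr_end (gtau w) _ tm mk tT') mulr0.
have axt k : adm F t (fun w => x (Order.min t (tau k w)) w).
  have /(adaptedP T FF) a := ax.
  exact: (adapted_stopped T0 FF a cx (grid_time_stopping k) tT).
move=> m; rewrite (_ : (fun w => _) = (fun w => \sum_(k < m) u k w)).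
  apply: (adm_sum (f := u)) => k _.
  rewrite (_ : u k = (fun w => f (tau k w) w * (tau k w < t)%R%:R) \*
     (fun w => incr (x ^~ w) (tau k w) (tau k.+1 w) t)).
    by apply: admM; [exact: adm_at_grid_time|apply: admB].
  apply/funext => w; rewrite /u /=; case: (ltP (tau k w) t) => tk.
    by rewrite mulr1.
  have [_ /(_ k) tS _ _] := gtau w.
  by rewrite /incr !min_l ?subrr ?mulr0//; exact: le_trans tS.
by apply/funext => w; rewrite /series/= big_mkord.
Qed.

End grid.
End adapted_grids.

(** * Comparison of endogenous grids *)

Section geometric_cauchy.
Context {R : realType} (T : R).
Implicit Types (u : nat -> R -> R) (C : R).

Lemma geometric_step_le (a : nat -> R) C n0 : 0 <= C ->
  (forall n, (n0 <= n)%N -> `|a n - a n.+1| <= C * (3 / 4) ^+ n) ->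
  forall n k, (n0 <= n)%N ->
    `|a n - a (n + k)%N| <= 4 * C * (3 / 4) ^+ n.
Proof.
move=> C0 H n k nn.
suff : `|a n - a (n + k)%N| <= 4 * C * (3 / 4) ^+ n * (1 - (3 / 4) ^+ k).
  have x0 : (0 : R) <= 3 / 4 by lra.
  move/le_trans; apply; apply: ler_piMr; first by rewrite !mulr_ge0 ?exprn_ge0.
  by rewrite gerBl exprn_ge0.
elim: k => [|k IH]; first by rewrite addn0 subrr normr0 expr0 subrr mulr0.
apply: le_trans (ler_distD (a (n + k)%N) _ _) _.
apply: (@le_trans _ _ (4 * C * (3 / 4) ^+ n * (1 - (3 / 4) ^+ k) +
    C * (3 / 4) ^+ (n + k))).
  by apply: lerD => //; rewrite addnS; apply: H; exact: leq_trans (leq_addr _ _).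
rewrite le_eqVlt; apply/predU1P; left; rewrite exprD (exprS _ k); by field.
Qed.

(** The rate that the almost sure estimate [integral_small_eventually] yields. *)
Definition geometric_steps u := exists C, 0 <= C /\
  \forall n \near \oo, forall t, 0 <= t <= T ->
    `|u n t - u n.+1 t| <= C * (3 / 4) ^+ n.

Lemma geometric_unif_cvg u : geometric_steps u ->
  (forall t, 0 <= t <= T -> u n t @[n --> \oo] --> limn (u ^~ t)) /\
  (forall e, 0 < e -> \forall n \near \oo, forall t, 0 <= t <= T ->
     `|limn (u ^~ t) - u n t| < e).
Proof.
move=> [C [C0 [n0 _ H]]].
have step t : 0 <= t <= T -> forall n k, (n0 <= n)%N ->
    `|u n t - u (n + k)%N t| <= 4 * C * (3 / 4) ^+ n.
  by move=> St; apply: (geometric_step_le (a := u ^~ t)) => // n nn; exact: H.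
have g0 := @cvg_geometric_bound R (4 * C) (3 / 4) ltac:(lra).
have cv t : 0 <= t <= T -> u n t @[n --> \oo] --> limn (u ^~ t).
  move=> St; apply: cauchy_cvg; apply/cauchy_ballP => e e0.
  have /cvgrPdist_lt/(_ (e / 2) ltac:(by rewrite divr_gt0))[n1 _ hn] := g0.
  pose m := maxn n0 n1.
  have close n : (m <= n)%N -> `|u m t - u n t| < e / 2.
    move=> mn; rewrite -(subnKC mn); apply: le_lt_trans (step t St _ _ (leq_maxl _ _)) _.
    have := hn m (leq_maxr _ _); rewrite /= sub0r normrN; apply: le_lt_trans.
    exact: ler_norm.
  exists (ball (u m t) (e / 2), ball (u m t) (e / 2)) => /=.
    by split; exists m.
  move=> [y1 y2] [/= h1 h2] /=; move: h1 h2; rewrite /ball /=.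
  have := ler_distD (u m t) y1 y2.
  rewrite [`|y1 - u m t|]distrC; lra.
split=> // e e0; move/cvgrPdist_lt : g0 => /(_ e e0)[n1 _ hn].
exists (maxn n0 n1) => // n /=; rewrite geq_max => /andP[nn nn1] t St.
have := hn n nn1; rewrite /= sub0r normrN; apply: le_lt_trans.
rewrite distrC; apply: le_trans (ler_norm _).
have : (fun k => `|u n t - u (n + k)%N t|) @ \oo --> `|u n t - limn (u ^~ t)|.
  apply: cvg_norm; apply: cvgB; first exact: cvg_cst.
  have := cv t St; rewrite -(cvg_shiftn n); apply: cvg_trans.
  by under eq_fun do rewrite addnC.
move=> h; rewrite -(cvg_lim (@Rhausdorff R) h); apply: limr_le.
  by apply/cvg_ex; eexists; exact: h.
by apply: nearW => k; exact: step.
Qed.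

End geometric_cauchy.

(** The endogenous sums for processes: the integrand [f] is sampled along the grid of
    a vector process [h], of which it is meant to be one coordinate. Grids with
    different companions of [f] will be compared. *)
Definition gint {R : realType} (T : R) {Omega : Type} q
    (h : R -> Omega -> 'rV[R]_q) (f x : R -> Omega -> R) n t w :=
  gsum (grid_time T n (h ^~ w)) (f ^~ w) (x ^~ w) t.

Section comparison.
Context {R : realType} (T : R) {disp} {Omega : measurableType disp}
  (P : {measure set Omega -> \bar R}) (F : R -> set (set Omega)).
Hypothesis T_gt0 : 0 < T.
Hypothesis P1 : P setT = 1%E.
Hypothesis FF : right_filtration F.

Let T0 : 0 <= T := ltW T_gt0.

Definition grid_process q (h : R -> Omega -> 'rV[R]_q) :=
  forall j, adapted T F (fun t w => h t w 0 j) /\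
            continuous_paths T (fun t w => h t w 0 j).

Lemma grid_process_grid q (h : R -> Omega -> 'rV[R]_q) n w :
  grid_process h -> is_grid T (grid_time T n (h ^~ w)).
Proof. by move=> gh; apply: is_grid_grid_time => // j; have [_] := gh j; exact. Qed.

Lemma grid_process_fine q (h : R -> Omega -> 'rV[R]_q) n w j :
  grid_process h -> fine_for (grid_time T n (h ^~ w)) (2 ^+ n)^-1
     (fun t => h t w 0 j).
Proof. by move=> gh; apply: grid_time_fine => // i; have [_] := gh i; exact. Qed.

Lemma gsum_decomposition tau f x m a t : is_grid T tau ->
  (forall s, 0 <= s <= T -> x s = x 0 + m s + a s) -> 0 <= t <= T ->
  gsum tau f x t = gsum tau f m t + gsum tau f a t.
Proof.
move=> gt xE /andP[t0 tT]; have [_ _ tauT [n tn]] := gt.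
rewrite !(gsumE gt _ _ tn tT) -big_split; apply: eq_bigr => k _ /=.
rewrite -mulrDr; congr (_ * _); rewrite /incr.
have mI j : 0 <= Order.min t (tau j) <= T.
  by rewrite le_min t0 (is_grid_ge0 gt) ge_min tT.
by rewrite (xE _ (mI k.+1)) (xE _ (mI k)); ring.
Qed.

(** Two endogenous grids on which [f] oscillates little give integrands that
    are uniformly close, hence integrals that are close: pathwise for the part
    of finite variation, almost surely for the martingale part. With [e n = n.+1] this
    gives convergence along one grid, and with [e n = n] the same limit along
    another. *)
Lemma grid_integrals_close q1 q2 (h1 : R -> Omega -> 'rV[R]_q1)
    (h2 : R -> Omega -> 'rV[R]_q2) j1 j2 f X M A (e : nat -> nat) :
  (forall n, (n <= e n)%N) ->
  grid_process h1 -> grid_process h2 ->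
  (forall t w, h1 t w 0 j1 = f t w) -> (forall t w, h2 t w 0 j2 = f t w) ->
  semimartingale_decomposition T P F X M A ->
  {ae P, forall w, exists C, 0 <= C /\ \forall n \near \oo,
     forall t, 0 <= t <= T ->
    `|gint T h1 f X n t w - gint T h2 f X (e n) t w| <= C * (3 / 4) ^+ n}.
Proof.
move=> ne g1 g2 f1 f2 [lM [_ cA A0 bvA] XE].
have [af cf] : adapted T F f /\ continuous_paths T f.
  have [a c] := g1 j1; have -> : f = (fun t w => h1 t w 0 j1).
    by apply/funext => t; apply/funext => w; rewrite f1.
  by split.
have [aM cM M0 _] := lM.
pose K n t w := gstep (grid_time T n (h1 ^~ w)) (f ^~ w) t -
   gstep (grid_time T (e n) (h2 ^~ w)) (f ^~ w) t.
pose G n t w := gint T h1 f M n t w - gint T h2 f M (e n) t w.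
have fine1 n w : fine_for (grid_time T n (h1 ^~ w)) (2 ^+ n)^-1 (f ^~ w).
  have := (@grid_process_fine _ h1 n w j1 g1); congr fine_for.
  by apply/funext => t; rewrite f1.
have fine2 n w : fine_for (grid_time T n (h2 ^~ w)) (2 ^+ n)^-1 (f ^~ w).
  have := (@grid_process_fine _ h2 n w j2 g2); congr fine_for.
  by apply/funext => t; rewrite f2.
have Kb n t w : 0 <= t <= T -> `|K n t w| <= 2 / 2 ^+ n.
  move=> /andP[]; rewrite le_eqVlt => /predU1P[<- _|t0 tT].
    rewrite /K (gstep_0 (grid_process_grid n w g1) _ T0).
    rewrite (gstep_0 (grid_process_grid (e n) w g2) _ T0).
    by rewrite subrr normr0 divr_ge0// exprn_ge0.
  have tI : 0 < t <= T by rewrite t0.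
  have h3 := gstep_close (grid_process_grid n w g1) (fine1 n w) tI.
  have h4 := gstep_close (grid_process_grid (e n) w g2) (fine2 (e n) w) tI.
  have h5 : (2 ^+ (e n))^-1 <= (2 ^+ n)^-1 :> R.
    by rewrite lef_pV2 ?posrE ?exprn_gt0// ler_eXn2l ?ltr1n.
  rewrite /K; have := ler_distD (f t w) (gstep (grid_time T n (h1 ^~ w)) (f ^~ w) t)
    (gstep (grid_time T (e n) (h2 ^~ w)) (f ^~ w) t).
  rewrite [`|f t w - _|]distrC; lra.
have rK n w (x : R -> R) : {within timeset T, continuous x} ->
    has_rint T (K n ^~ w) x (fun t => gsum (grid_time T n (h1 ^~ w)) (f ^~ w) x t -
      gsum (grid_time T (e n) (h2 ^~ w)) (f ^~ w) x t).
  move=> cx; exact: (has_rintB (has_rint_gstep (grid_process_grid n w g1) _ cx)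
     (has_rint_gstep (grid_process_grid (e n) w g2) _ cx)).
have := @integral_small_eventually _ T _ _ P F T_gt0 P1 FF M K G 2 _ lM.
move=> /(_ ltac:(by [])) H.
have {H} : {ae P, forall w, \forall n \near \oo, forall t, 0 <= t <= T ->
    `|G n t w| <= (3 / 4) ^+ n}.
  apply: H.
  - move=> n t tT; apply: admB; apply: adm_gstep => // j.
    + by have [] := g1 j.
    + by have [] := g1 j.
    + by have [] := g2 j.
    + by have [] := g2 j.
  - exact: Kb.
  - by move=> n w; exact: rK.
  - move=> n w; apply: within_continuousB; apply: continuous_gsum => //;
    exact: grid_process_grid.
  - move=> n w; rewrite /G /gint (gsum0 (grid_process_grid n w g1) _ _ T0).
    by rewrite (gsum0 (grid_process_grid (e n) w g2) _ _ T0) subrr.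
apply: filterS => w H; have [v Av] := bounded_variation_controlled T0 (bvA w).
have v0 : 0 <= v T - v 0 by rewrite subr_ge0; exact: (controlled_mono Av).
exists (1 + 2 * (v T - v 0)); split; first by rewrite addr_ge0// mulr_ge0.
apply: filterS H => n Hn t tT; have /andP[t0 tT'] := tT.
have XEw s : 0 <= s <= T -> X s w = X 0 w + M s w + A s w.
  by move=> sT; apply: XE; rewrite /timeset/= in_itv.
rewrite /gint (gsum_decomposition _ (grid_process_grid n w g1) XEw tT).
rewrite (gsum_decomposition _ (grid_process_grid (e n) w g2) XEw tT).
set a1 := gsum _ _ (A ^~ w) t; set a2 := gsum _ _ (A ^~ w) t.
have hA : `|a1 - a2| <= 2 / 2 ^+ n * (v T - v 0).
  have := has_rint_controlled T0 (fun r => Kb n r w) Av (rK n w _ (cA w))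
    (lexx 0) t0 tT'.
  rewrite (gsum0 (grid_process_grid n w g1) _ _ T0).
  rewrite (gsum0 (grid_process_grid (e n) w g2) _ _ T0) subrr subr0.
  move/le_trans; apply; rewrite ler_wpM2l ?divr_ge0 ?exprn_ge0//.
  by rewrite lerD2r; apply: (controlled_mono Av).
have half : (2 ^+ n)^-1 <= (3 / 4) ^+ n :> R.
  rewrite -exprVn lerXn2r ?nnegrE//; lra.
have hM := Hn t tT.
have -> : gsum (grid_time T n (h1 ^~ w)) (f ^~ w) (M ^~ w) t + a1 -
    (gsum (grid_time T (e n) (h2 ^~ w)) (f ^~ w) (M ^~ w) t + a2) =
    G n t w + (a1 - a2) by rewrite /G /gint; ring.
apply: le_trans (ler_normD _ _) _; rewrite mulrDl mul1r; apply: lerD => //.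
apply: le_trans hA _; rewrite mulrAC.
by rewrite ler_wpM2l// mulr_ge0.
Qed.

End comparison.

(** * Limits of covariation sums *)

Section pathwise_bracket.
Context {R : realType} (T : R).
Hypothesis T_gt0 : 0 < T.
Implicit Types (x y a b c : R -> R) (tau : nat -> nat -> R).

Let T0 : 0 <= T := ltW T_gt0.

Lemma gcov_decomposition (tau : nat -> R) x m a y t : is_grid T tau ->
  (forall s, 0 <= s <= T -> x s = x 0 + m s + a s) -> 0 <= t <= T ->
  gcov tau x y t = gcov tau m y t + gcov tau a y t.
Proof.
move=> gt xE /andP[t0 tT]; have [_ _ tauT [n tn]] := gt.
rewrite !(gcovE gt _ _ tn tT) -big_split; apply: eq_bigr => k _ /=.
rewrite -mulrDl; congr (_ * _); rewrite /incr.
have mI j : 0 <= Order.min t (tau j) <= T.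
  by rewrite le_min t0 (is_grid_ge0 gt) ge_min tT.
by rewrite (xE _ (mI k.+1)) (xE _ (mI k)); ring.
Qed.

Lemma cvg_dist_le (u v : nat -> R) (r : nat -> R) (l : R) :
  (\forall n \near \oo, `|u n - v n| <= r n) ->
  r @ \oo --> (0 : R) -> u @ \oo --> l -> v @ \oo --> l.
Proof.
move=> uv r0 ul; apply/cvgrPdist_lt => e e0.
move/cvgrPdist_lt : ul => /(_ (e / 2) ltac:(by rewrite divr_gt0)) ul.
move/cvgrPdist_lt : r0 => /(_ (e / 2) ltac:(by rewrite divr_gt0)) r0.
apply: filterS3 uv ul r0 => n h1 h2; rewrite sub0r normrN => h3.
have := ler_distD (u n) l (v n); have := ler_norm (r n); lra.
Qed.

Lemma fine_forD (tau : nat -> R) e e' x y : fine_for tau e x ->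
  fine_for tau e' y -> fine_for tau (e + e') (x \+ y).
Proof.
move=> hx hy k t tk; rewrite /= opprD addrACA.
by apply: le_trans (ler_normD _ _) _; apply: lerD; [exact: hx|exact: hy].
Qed.

Lemma fine_forN (tau : nat -> R) e x : fine_for tau e x -> fine_for tau e (\- x).
Proof. by move=> hx k t /hx h; rewrite /= -opprD normrN. Qed.

(** The defect in [gcov_mono] vanishes in the limit. *)
Lemma gcov_square_limit tau z a : (forall n, is_grid T (tau n)) ->
  (forall n, fine_for (tau n) (2 / 2 ^+ n) z) ->
  (forall t, 0 <= t <= T -> gcov (tau n) z z t @[n --> \oo] --> a t) ->
  forall s t, 0 <= s -> s <= t -> t <= T -> a s <= a t.
Proof.
move=> gt ft ca s t s0 st tT.
have tI : 0 <= t <= T by rewrite tT (le_trans s0).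
have sI : 0 <= s <= T by rewrite s0 (le_trans st).
have h : (fun n => gcov (tau n) z z s - (2 / 2 ^+ n) ^+ 2) @ \oo --> a s.
  rewrite -[X in _ --> X](subr0 (a s)); apply: cvgB; first exact: ca.
  rewrite -(mulr0 (0 : R)); under eq_fun do rewrite expr2.
  by apply: cvgM; exact: cvg_half_pow.
rewrite -(cvg_lim (@Rhausdorff R) h) -(cvg_lim (@Rhausdorff R) (ca t tI)).
apply: ler_lim; [by apply/cvg_ex; eexists; exact: h|
  by apply/cvg_ex; eexists; exact: (ca t tI)|].
by apply: nearW => n; apply: (gcov_mono (gt n)).
Qed.

(** Polarization: [a + b + 2 c] and [a + b - 2 c] are limits of sums of squares,
    hence nondecreasing. *)
Lemma gcov_limit_controlled tau x y a b c : (forall n, is_grid T (tau n)) ->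
  (forall n, fine_for (tau n) (2 ^+ n)^-1 x) ->
  (forall n, fine_for (tau n) (2 ^+ n)^-1 y) ->
  (forall t, 0 <= t <= T -> gcov (tau n) x x t @[n --> \oo] --> a t) ->
  (forall t, 0 <= t <= T -> gcov (tau n) y y t @[n --> \oo] --> b t) ->
  (forall t, 0 <= t <= T -> gcov (tau n) x y t @[n --> \oo] --> c t) ->
  controlled_by T c (fun t => (a t + b t) / 2).
Proof.
move=> gt fx fy ca cb cc s t s0 st tT.
have e2 n : (2 ^+ n)^-1 + (2 ^+ n)^-1 = 2 / 2 ^+ n :> R by ring.
have hp : a s + b s + 2 * c s <= a t + b t + 2 * c t.
  apply: (@gcov_square_limit tau (x \+ y) (fun t => a t + b t + 2 * c t)) => //.
    by move=> n; rewrite -e2; exact: fine_forD.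
  move=> r rT; have /andP[_ rT'] := rT.
  rewrite (_ : (fun n => _) = (fun n => gcov (tau n) x x r + gcov (tau n) y y r +
      2 * gcov (tau n) x y r)).
    apply: cvgD; first by apply: cvgD; [exact: ca|exact: cb].
    by apply: cvgM; [exact: cvg_cst|exact: cc].
  apply/funext => n; rewrite (gcovDl (gt n))// gcovC (gcovDl (gt n))//.
  rewrite [gcov _ y (x \+ y) r]gcovC (gcovDl (gt n))// [gcov _ y x r]gcovC; ring.
have hm : a s + b s - 2 * c s <= a t + b t - 2 * c t.
  apply: (@gcov_square_limit tau (x \+ (\- y)) (fun t => a t + b t - 2 * c t)) => //.
    by move=> n; rewrite -e2; apply: fine_forD => //; exact: fine_forN.
  move=> r rT; have /andP[_ rT'] := rT.
  rewrite (_ : (fun n => _) = (fun n => gcov (tau n) x x r + gcov (tau n) y y r -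
      2 * gcov (tau n) x y r)).
    apply: cvgB; first by apply: cvgD; [exact: ca|exact: cb].
    by apply: cvgM; [exact: cvg_cst|exact: cc].
  apply/funext => n; rewrite (gcovDl (gt n))// gcovC (gcovDl (gt n))//.
  rewrite [gcov _ (\- y) (x \+ _) r]gcovC (gcovDl (gt n))//.
  rewrite [gcov _ x (\- y) r]gcovC !(gcovNl (gt n))//.
  rewrite [gcov _ y (\- y) r]gcovC (gcovNl (gt n))// [gcov _ y x r]gcovC; ring.
rewrite ler_norml; lra.
Qed.

End pathwise_bracket.

(** * The pathwise covariation is a bracket *)

Definition pathwise_cov {R : realType} (T : R) {Omega : Type}
    (X Y : R -> Omega -> R) qx qy (hx : R -> Omega -> 'rV[R]_qx)
    (hy : R -> Omega -> 'rV[R]_qy) t w :=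
  X t w * Y t w - X 0 w * Y 0 w -
  limn (fun n => gint T hx X Y n t w) - limn (fun n => gint T hy Y X n t w).

Section bracket.
Context {R : realType} (T : R) {disp} {Omega : measurableType disp}
  (P : {measure set Omega -> \bar R}) (F : R -> set (set Omega)).
Hypothesis T_gt0 : 0 < T.
Hypothesis P1 : P setT = 1%E.
Hypothesis FF : right_filtration F.
Hypothesis Fnegl : forall t E, P.-negligible E -> F t E.

Let T0 : 0 <= T := ltW T_gt0.

Local Notation Ex := (Ex P).
Local Notation Int := (Int P).
Local Notation grid_process := (grid_process T F).
Local Notation geometric_steps := (geometric_steps T).

(** Bounds in mean square let the martingale property pass to almost sure limits. *)
Lemma martingale_limit (L : nat -> R -> Omega -> R) V C :
  (forall n, martingale T P F (L n)) ->
  (forall n t, 0 <= t <= T -> Int (fun w => L n t w ^+ 2)) ->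
  (forall n t, 0 <= t <= T -> Ex (fun w => L n t w ^+ 2) <= C) ->
  (forall t, 0 <= t <= T -> {ae P, forall w, L n t w @[n --> \oo] --> V t w}) ->
  (forall t, 0 <= t <= T -> adm F t (V t)) ->
  martingale T P F V.
Proof.
move=> mL IL2 EL2 LV aV.
have H t : 0 <= t <= T -> Int (V t) /\ forall E, measurable E ->
    Ex (L n t \* \1_E) @[n --> \oo] --> Ex (V t \* \1_E).
  move=> tT; have mLt n : measurable_fun setT (L n t).
    by have /(martingaleP T P FF)[a _ _] := mL n; apply: (adm_meas FF (a t tT)).
  have [I _ _ c] := Ex_cvg_L2 P1 mLt (adm_meas FF (aV t tT)) (LV t tT)
    (fun n => IL2 n t tT) (fun n => EL2 n t tT).
  by split.
apply/(martingaleP T P FF); split=> //.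
  by move=> t tT; have [] := H t tT.
move=> s t E s0 st tT sE; have mE := filt_sub FF sE.
have [_ /(_ E mE) h1] := H t ltac:(by rewrite tT (le_trans s0)).
have [_ /(_ E mE) h2] := H s ltac:(by rewrite s0 (le_trans st)).
rewrite -(cvg_lim (@Rhausdorff R) h1) -(cvg_lim (@Rhausdorff R) h2).
suff -> : (fun n => Ex (L n t \* \1_E)) = (fun n => Ex (L n s \* \1_E)) by [].
apply/funext => n.
by have /(martingaleP T P FF)[_ _ m] := mL n; rewrite (m s t).
Qed.

Section construction.
Variables (X Y M A N B : R -> Omega -> R).
Variables (qx qy : nat) (hx : R -> Omega -> 'rV[R]_qx) (hy : R -> Omega -> 'rV[R]_qy).
Variables (jx : 'I_qx) (jy : 'I_qy).
Hypotheses (gx : grid_process hx) (gy : grid_process hy).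
Hypotheses (hxE : forall t w, hx t w 0 jx = X t w)
  (hyE : forall t w, hy t w 0 jy = Y t w).
Hypothesis dX : semimartingale_decomposition T P F X M A.
Hypothesis dY : semimartingale_decomposition T P F Y N B.

Local Notation Q := (pathwise_cov T X Y hx hy).

(** Its endogenous grid is fine for both processes and both martingale parts at once. *)
Definition joint t w : 'rV[R]_4 :=
  \row_(k < 4) nth 0 [:: X t w; Y t w; M t w; N t w] k.

(** The third clause expresses [Q] through the martingale parts alone, which is what
    the local martingale property of [M N - Q] rests on. *)
Definition regular w := [/\ geometric_steps (fun n t => gint T hx X Y n t w),
  geometric_steps (fun n t => gint T hy Y X n t w),
  forall t, 0 <= t <= T ->
    gcov (grid_time T n (joint ^~ w)) (M ^~ w) (N ^~ w) t @[n --> \oo] --> Q t w &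
  bounded_variation 0 T (Q ^~ w)].

Let aX : adapted T F X /\ continuous_paths T X.
Proof.
have [a c] := gx jx; have -> : X = (fun t w => hx t w 0 jx); last by split.
by apply/funext => t; apply/funext => w; rewrite hxE.
Qed.

Let aY : adapted T F Y /\ continuous_paths T Y.
Proof.
have [a c] := gy jy; have -> : Y = (fun t w => hy t w 0 jy); last by split.
by apply/funext => t; apply/funext => w; rewrite hyE.
Qed.

Let jE (k : 'I_4) t w : joint t w 0 k = nth 0 [:: X t w; Y t w; M t w; N t w] k.
Proof. by rewrite mxE. Qed.

Let gj : grid_process joint.
Proof.
have [[aM cM _ _] _ _] := dX; have [[aN cN _ _] _ _] := dY.
have [[aX' cX] [aY' cY]] := (aX, aY).
move=> k; have -> : (fun t w => joint t w 0 k) =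
    nth (fun=> cst 0) [:: X; Y; M; N] k.
  apply/funext => t; apply/funext => w; rewrite jE.
  by case: k => -[|[|[|[|]]]].
by case: k => -[|[|[|[|]]]].
Qed.

Let fine_coord n w (k : 'I_4) :
  fine_for (grid_time T n (joint ^~ w)) (2 ^+ n)^-1
    (fun t => nth 0 [:: X t w; Y t w; M t w; N t w] k).
Proof.
have := @grid_process_fine _ T _ _ F T_gt0 _ joint n w k gj; congr fine_for.
by apply/funext => t; rewrite jE.
Qed.

Let gridj n w : is_grid T (grid_time T n (joint ^~ w)).
Proof. exact: grid_process_grid. Qed.

(** The grids of [X] and [Y] are compared with those of the next order, which gives
    convergence, and with the joint grid, along which integration by parts shows that
    [Q] is the limit of the covariation sums of [X] and [Y]. In this limit the parts of
    finite variation disappear, and polarization bounds its variation. *)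
Lemma ae_regular : {ae P, forall w, regular w}.
Proof.
pose k0 : 'I_4 := @Ordinal 4 0 isT; pose k1 : 'I_4 := @Ordinal 4 1 isT.
pose k2 : 'I_4 := @Ordinal 4 2 isT; pose k3 : 'I_4 := @Ordinal 4 3 isT.
have jX t w : joint t w 0 k0 = X t w by rewrite jE.
have jY t w : joint t w 0 k1 = Y t w by rewrite jE.
have c1 := grid_integrals_close T_gt0 P1 FF leqnSn gx gx hxE hxE dY.
have c2 := grid_integrals_close T_gt0 P1 FF leqnSn gy gy hyE hyE dX.
have c3 := grid_integrals_close T_gt0 P1 FF leqnn gx gj hxE jX dY.
have c4 := grid_integrals_close T_gt0 P1 FF leqnn gy gj hyE jY dX.
have c5 := grid_integrals_close T_gt0 P1 FF leqnSn gj gj jX jX dX.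
have c6 := grid_integrals_close T_gt0 P1 FF leqnSn gj gj jY jY dY.
apply: filterS2 (filterI c1 (filterI c2 c3)) (filterI c4 (filterI c5 c6)).
move=> w [[C1 [C10 h1]] [[C2 [C20 h2]] [C3 [C30 h3]]]]
  [[C4 [C40 h4]] [[C5 [C50 h5]] [C6 [C60 h6]]]].
have g1 : geometric_steps (fun n t => gint T hx X Y n t w).
  by exists C1; split=> //; exact: h1.
have g2 : geometric_steps (fun n t => gint T hy Y X n t w).
  by exists C2; split=> //; exact: h2.
have g34 (C : R) := @cvg_geometric_bound R C (3 / 4) ltac:(lra).
have lim_of (u : nat -> R -> R) : geometric_steps u ->
    forall t, 0 <= t <= T -> u n t @[n --> \oo] --> limn (u ^~ t).
  by move=> /geometric_unif_cvg[].
pose J f x n t := gint T joint f x n t w.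
have cXY t : 0 <= t <= T -> J X Y n t @[n --> \oo] --> limn (fun n => gint T hx X Y n t w).
  move=> tT; apply: (cvg_dist_le _ (g34 C3) (lim_of _ g1 t tT)).
  by apply: filterS h3 => n h; exact: (h t tT).
have cYX t : 0 <= t <= T -> J Y X n t @[n --> \oo] --> limn (fun n => gint T hy Y X n t w).
  move=> tT; apply: (cvg_dist_le _ (g34 C4) (lim_of _ g2 t tT)).
  by apply: filterS h4 => n h; exact: (h t tT).
have g5 : geometric_steps (J X X).
  by exists C5; split=> //; exact: h5.
have g6 : geometric_steps (J Y Y).
  by exists C6; split=> //; exact: h6.
pose G n := grid_time T n (joint ^~ w).
have gG n : is_grid T (G n) by exact: gridj.
have gc f x n t : 0 <= t <= T -> gcov (G n) (f ^~ w) (x ^~ w) t =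
    f t w * x t w - f 0 w * x 0 w - J f x n t - J x f n t.
  move=> tT; have := integration_by_parts (gG n) (f ^~ w) (x ^~ w) tT.
  by rewrite /J /gint -/(G n) => ->; ring.
have covXY t : 0 <= t <= T -> gcov (G n) (X ^~ w) (Y ^~ w) t @[n --> \oo] --> Q t w.
  move=> tT; under eq_fun do rewrite gc//.
  apply: cvgB; last exact: cYX.
  by apply: cvgB; [exact: cvg_cst|exact: cXY].
have fX n : fine_for (G n) (2 ^+ n)^-1 (X ^~ w) := @fine_coord n w k0.
have fY n : fine_for (G n) (2 ^+ n)^-1 (Y ^~ w) := @fine_coord n w k1.
have fM n : fine_for (G n) (2 ^+ n)^-1 (M ^~ w) := @fine_coord n w k2.
have [lM [_ _ _ bvA] XE] := dX; have [lN [_ _ _ bvB] YE] := dY.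
split=> //.
- move=> t tT; have /andP[t0 tT'] := tT.
  have [va Av] := bounded_variation_controlled T0 (bvA w).
  have [vb Bv] := bounded_variation_controlled T0 (bvB w).
  apply: (cvg_dist_le _ (cvg_half_pow ((va t - va 0) + (vb t - vb 0))) (covXY t tT)).
  apply: nearW => n.
  have XEw s : 0 <= s <= T -> X s w = X 0 w + M s w + A s w.
    by move=> sT; apply: XE; rewrite /timeset/= in_itv.
  have YEw s : 0 <= s <= T -> Y s w = Y 0 w + N s w + B s w.
    by move=> sT; apply: YE; rewrite /timeset/= in_itv.
  rewrite (gcov_decomposition (Y ^~ w) (gG n) XEw tT).
  rewrite [gcov _ (M ^~ w) (Y ^~ w) t]gcovC (gcov_decomposition (M ^~ w) (gG n) YEw tT).
  rewrite [gcov _ (N ^~ w) _ t]gcovC [gcov _ (B ^~ w) _ t]gcovC.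
  rewrite [gcov _ (A ^~ w) _ t]gcovC.
  have hA := gcov_controlled (gG n) (fY n) Av tT.
  have hB := gcov_controlled (gG n) (fM n) Bv tT.
  rewrite (_ : _ - _ = gcov (G n) (M ^~ w) (B ^~ w) t + gcov (G n) (Y ^~ w) (A ^~ w) t);
    last by ring.
  apply: le_trans (ler_normD _ _) _; rewrite mulrDl addrC.
  by apply: lerD; rewrite mulrC.
- have XX t : 0 <= t <= T -> gcov (G n) (X ^~ w) (X ^~ w) t @[n --> \oo] -->
      X t w * X t w - X 0 w * X 0 w - limn (J X X ^~ t) - limn (J X X ^~ t).
    move=> tT; under eq_fun do rewrite gc//.
    by apply: cvgB; [apply: cvgB; [exact: cvg_cst|]|]; exact: lim_of.
  have YY t : 0 <= t <= T -> gcov (G n) (Y ^~ w) (Y ^~ w) t @[n --> \oo] -->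
      Y t w * Y t w - Y 0 w * Y 0 w - limn (J Y Y ^~ t) - limn (J Y Y ^~ t).
    move=> tT; under eq_fun do rewrite gc//.
    by apply: cvgB; [apply: cvgB; [exact: cvg_cst|]|]; exact: lim_of.
  apply: controlled_bounded_variation.
  exact: (gcov_limit_controlled gG fX fY XX YY covXY).
Qed.

Lemma pathwise_cov_continuous w : regular w ->
  {within timeset T, continuous (Q ^~ w)}.
Proof.
move=> [/geometric_unif_cvg[_ u1] /geometric_unif_cvg[_ u2] _ _].
have [[_ cX] [_ cY]] := (aX, aY).
have cl q (h : R -> Omega -> 'rV[R]_q) f x : grid_process h -> continuous_paths T x ->
    (forall e, 0 < e -> \forall n \near \oo, forall t, 0 <= t <= T ->
       `|limn (fun n => gint T h f x n t w) - gint T h f x n t w| < e) ->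
    {within timeset T, continuous (fun t => limn (fun n => gint T h f x n t w))}.
  move=> gh cx ul; apply: (unif_limit_continuous (u := fun n t => gint T h f x n t w)).
    move=> n; apply: continuous_gsum; last exact: cx.
    exact: grid_process_grid.
  by move=> e /ul[n _ /(_ n (leqnn n))]; exists n.
have c3 : {within timeset T, continuous (fun=> X 0 w * Y 0 w)}.
  by move=> t; exact: cvg_cst.
have c4 := within_continuousB (within_continuousM (cX w) (cY w)) c3.
exact: (within_continuousB (within_continuousB c4 (cl _ hx X Y gx cY u1)) (cl _ hy Y X gy cX u2)).
Qed.

Lemma pathwise_cov0 w : Q 0 w = 0.
Proof.
rewrite /pathwise_cov subrr.
have z q (h : R -> Omega -> 'rV[R]_q) f x : grid_process h ->
    limn (fun n => gint T h f x n 0 w) = 0.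
  move=> gh; rewrite (_ : (fun n => _) = fun=> 0) ?lim_cst//.
  by apply/funext => n; exact: (gsum0 (grid_process_grid T_gt0 n w gh) _ _ T0).
by rewrite !z// !subr0.
Qed.

(** Before [sigma] the step integrand takes values of [f] at earlier times, so that it
    inherits the bound of the stopped process. *)
Let stopped_gint (f : R -> Omega -> R) (N' : R -> Omega -> R) (k : 'I_4) sigma p n :
  (forall t w, joint t w 0 k = f t w) -> continuous_paths T N' ->
  stopping_time T F sigma -> martingale T P F (stopped N' sigma) ->
  (forall t w, 0 <= t <= T -> `|stopped f sigma t w| <= p) ->
  (forall t w, 0 <= t <= T -> `|stopped N' sigma t w| <= p) ->
  martingale T P F (stopped (gint T joint f N' n) sigma) /\
  forall t, 0 <= t <= T ->
    Int (fun w => stopped (gint T joint f N' n) sigma t w ^+ 2) /\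
    Ex (fun w => stopped (gint T joint f N' n) sigma t w ^+ 2) <= p ^+ 2 * p ^+ 2.
Proof.
move=> jf cN ss mN bf bN.
have [a c] := gj k.
have fE : (fun t w => joint t w 0 k) = f.
  by apply/funext => t; apply/funext => w; rewrite jf.
rewrite fE in a c.
apply: (@martingale_integral _ T _ _ P F P1 FF (stopped N' sigma)
  (fun s w => gstep (grid_time T n (joint ^~ w)) (f ^~ w) s * (s < sigma w)%R%:R)) => //.
- move=> s sT.
  pose K s w := gstep (grid_time T n (joint ^~ w)) (f ^~ w) s.
  have aK : adm F s (K s).
    by apply: adm_gstep => // j; have [] := gj j.
  exact: (adm_stopped_integrand FF aK ss sT).
- move=> s w sT; case: (ltP s (sigma w)) => ssig; last first.
    rewrite mulr0 normr0; apply: le_trans (bf s w sT); exact: normr_ge0.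
  rewrite mulr1; have /andP[] := sT; rewrite le_eqVlt => /predU1P[<- _|s0 sT'].
    rewrite (gstep_0 (gridj n w) _ T0) normr0.
    by apply: le_trans (bf s w sT); exact: normr_ge0.
  have [|i /andP[i1 i2]] := is_grid_cover (gridj n w) (t := s); first by rewrite s0.
  rewrite (gstep_at (gridj n w) _ (k := i)) ?i1//.
  set r := grid_time _ _ _ i in i1 *.
  have rT : 0 <= r <= T by rewrite (is_grid_ge0 (gridj n w)) (le_trans (ltW i1)).
  have := bf r w rT; rewrite /stopped min_l//.
  exact: le_trans (ltW i1) (ltW ssig).
- move=> w.
  have r := has_rint_gstep (gridj n w) (f ^~ w) (cN w).
  exact: (has_rint_stop (stopping_ge0 w ss) r).
- move=> w; rewrite /stopped min_l; last exact: (stopping_ge0 w ss).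
  exact: (gsum0 (gridj n w) _ _ T0).
Qed.

(** [V] is [Q], replaced by 0 on a negligible set, which the filtration contains. Along
    the joint grid [M N] minus the covariation sum is the sum of two integrals; once
    localized they are martingales bounded in mean square, and [martingale_limit]
    applies. *)
Lemma bracket_construction : exists V,
  [/\ continuous_fv_process0 T F V,
      continuous_local_martingale0 T P F (fun t w => M t w * N t w - V t w) &
      {ae P, forall w, regular w /\ forall t, V t w = Q t w}].
Proof.
have [E [mE E0 ED]] := ae_regular.
have reg w : (~` E) w -> regular w by move=> nE; apply: contrapT => /ED.
have FD t : F t (~` E).
  by apply: (filtC FF); apply: Fnegl; exists E; split.
have [lM [_ _ _ _] XE] := dX; have [lN [_ _ _ _] YE] := dY.
have [/(adaptedP T FF) aM cM M0 _] := lM; have [/(adaptedP T FF) aN cN N0 _] := lN.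
have [/(adaptedP T FF) aX' cX] := aX.
have [/(adaptedP T FF) aY' cY] := aY.
pose V t w := Q t w * \1_(~` E) w.
have VE w t : (~` E) w -> V t w = Q t w.
  by move=> nE; rewrite /V indicE mem_set// mulr1.
have V0 w t : E w -> V t w = 0.
  by move=> Ew; rewrite /V indicE memNset ?mulr0//=; apply.
have cV : continuous_paths T V.
  move=> w; have [Ew|Ew] := pselect (E w).
    rewrite (_ : V ^~ w = fun=> 0); last by apply/funext => t; exact: V0.
    by move=> t; exact: cvg_cst.
  rewrite (_ : V ^~ w = Q ^~ w); last by apply/funext => t; exact: VE.
  by apply: pathwise_cov_continuous; exact: reg.
have aV t : 0 <= t <= T -> adm F t (V t).
  move=> tT; have /andP[t0 tT'] := tT.
  have z0 : 0 <= (0 : R) <= T by rewrite lexx.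
  pose u n w := (X t w * Y t w - X 0 w * Y 0 w - gint T hx X Y n t w - gint T hy Y X n t w) *
    \1_(~` E) w.
  apply: (@adm_cvg _ _ _ _ _ u).
    move=> n; apply: admM; last exact: (adm_indic FF).
    have gadm q (h : R -> Omega -> 'rV[R]_q) f x : grid_process h ->
        adapted T F f -> continuous_paths T f -> adapted T F x -> continuous_paths T x ->
        adm F t (fun w => gint T h f x n t w).
      move=> gh af cf ax cx; apply: adm_gsum => // j; by have [] := gh j.
    have [[aX1 _] [aY1 _]] := (aX, aY).
    apply: admB; last exact: gadm.
    apply: admB; last exact: gadm.
    apply: admB; first by apply: admM; [exact: aX'|exact: aY'].
    by apply: admM; apply: (adm_le_trans FF t0); [exact: aX'|exact: aY'].
  move=> w; have [Ew|Ew] := pselect (E w).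
    rewrite (V0 _ _ Ew) (_ : (fun n => _) = fun=> 0); first exact: cvg_cst.
    by apply/funext => n; rewrite /u indicE memNset ?mulr0//=; apply.
  rewrite (VE _ _ Ew) (_ : (fun n => _) = (fun n => X t w * Y t w - X 0 w * Y 0 w -
    gint T hx X Y n t w - gint T hy Y X n t w)); last first.
    by apply/funext => n; rewrite /u indicE mem_set// mulr1.
  have [/geometric_unif_cvg[u1 _] /geometric_unif_cvg[u2 _] _ _] := reg w Ew.
  apply: cvgB; last exact: u2.
  by apply: cvgB; [exact: cvg_cst|exact: u1].
exists V; split.
- split.
  + exact/(adaptedP T FF).
  + exact: cV.
  + by move=> w; rewrite /V pathwise_cov0 mul0r.
  + move=> w; have [Ew|Ew] := pselect (E w).
      rewrite (_ : V ^~ w = fun=> 0); last by apply/funext => t; exact: V0.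
      apply: (controlled_bounded_variation (v := fun=> 0)) => s t _ _ _.
      by rewrite !subrr normr0.
    rewrite (_ : V ^~ w = Q ^~ w); last by apply/funext => t; exact: VE.
    by have [] := reg w Ew.
- have [sigma [ss ms es [mM bM] [mN bN]]] := localization T_gt0 P1 FF lM lN.
  pose Z t w := M t w * N t w - V t w.
  have aZ t : 0 <= t <= T -> adm F t (Z t).
    move=> tT; apply: admB; last exact: aV.
    by apply: admM; [exact: aM|exact: aN].
  have cZ : continuous_paths T Z.
    move=> w; apply: within_continuousB; last exact: cV.
    exact: within_continuousM (cM w) (cN w).
  split; first exact/(adaptedP T FF).
  + exact: cZ.
  + by move=> w; rewrite M0 mul0r /V pathwise_cov0 mul0r subrr.
  exists sigma; split; [exact: ss|exact: ms|exact: es|move=> p].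
  pose L1 n := stopped (gint T joint M N n) (sigma p).
  pose L2 n := stopped (gint T joint N M n) (sigma p).
  have H1 n := @stopped_gint M N (@Ordinal 4 2 isT) (sigma p) p%:R n
    (fun t w => jE _ t w) cN (ss p) (mN p) (bM p) (bN p).
  have H2 n := @stopped_gint N M (@Ordinal 4 3 isT) (sigma p) p%:R n
    (fun t w => jE _ t w) cM (ss p) (mM p) (bN p) (bM p).
  apply: (@martingale_limit (fun n t w => L1 n t w + L2 n t w) _
    (2 * (p%:R ^+ 2 * p%:R ^+ 2) + 2 * (p%:R ^+ 2 * p%:R ^+ 2))).
  + move=> n; have [m1 _] := H1 n; have [m2 _] := H2 n.
    have /(martingaleP T P FF)[a1 i1 e1] := m1.
    have /(martingaleP T P FF)[a2 i2 e2] := m2.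
    apply/(martingaleP T P FF); split.
    * by move=> t tT; apply: admD; [exact: a1|exact: a2].
    * by move=> t tT; apply: IntD; [exact: i1|exact: i2].
    * move=> s t U s0 st tT sU; have mU := filt_sub FF sU.
      have tI : 0 <= t <= T by rewrite tT (le_trans s0).
      have sI : 0 <= s <= T by rewrite s0 (le_trans st).
      have e r : (fun w => L1 n r w + L2 n r w) \* \1_U =
          (L1 n r \* \1_U) \+ (L2 n r \* \1_U).
        by apply/funext => w /=; rewrite mulrDl.
      rewrite !e !ExD; try (by apply: IntMindic => //; first [exact: i1|exact: i2]).
      by rewrite (e1 s t)// (e2 s t).
  + move=> n t tT; have [m1 /(_ t tT)[I1 _]] := H1 n; have [m2 /(_ t tT)[I2 _]] := H2 n.
    have /(martingaleP T P FF)[a1 _ _] := m1.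
    have /(martingaleP T P FF)[a2 _ _] := m2.
    apply: (@Int_le _ _ _ _ _ ((fun w => 2 * L1 n t w ^+ 2) \+ (fun w => 2 * L2 n t w ^+ 2))).
    * by apply: measurable_funX; apply: (adm_meas FF (t := t)); apply: admD; [exact: a1|exact: a2].
    * by apply: IntD; exact: IntZ.
    * move=> w; rewrite ger0_norm ?sqr_ge0//=.
      by have := sqr_ge0 (L1 n t w - L2 n t w); nra.
  + move=> n t tT; have [m1 /(_ t tT)[I1 E1]] := H1 n; have [m2 /(_ t tT)[I2 E2]] := H2 n.
    have /(martingaleP T P FF)[a1 _ _] := m1.
    have /(martingaleP T P FF)[a2 _ _] := m2.
    have IS : Int ((fun w => 2 * L1 n t w ^+ 2) \+ (fun w => 2 * L2 n t w ^+ 2)).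
      by apply: IntD; exact: IntZ.
    have le w : (L1 n t w + L2 n t w) ^+ 2 <=
        ((fun w => 2 * L1 n t w ^+ 2) \+ (fun w => 2 * L2 n t w ^+ 2)) w.
      by rewrite /=; have := sqr_ge0 (L1 n t w - L2 n t w); nra.
    apply: (@le_trans _ _ (Ex ((fun w => 2 * L1 n t w ^+ 2) \+ (fun w => 2 * L2 n t w ^+ 2)))).
      apply: Ex_le => //; apply: Int_le IS _.
        by apply: measurable_funX; apply: (adm_meas FF (t := t)); apply: admD; [exact: a1|exact: a2].
      by move=> w; rewrite ger0_norm ?sqr_ge0.
    rewrite ExD; try exact: IntZ.
    rewrite !ExZ//; apply: lerD; rewrite ler_wpM2l//.
  + move=> t tT; exists E; split=> // w /= nc; apply: contrapT => Ew; apply: nc.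
    have [_ _ cv _] := reg w Ew.
    have /andP[t0 tT'] := tT; have r0 := stopping_ge0 w (ss p).
    set r := Order.min t (sigma p w).
    have rT : 0 <= r <= T by rewrite le_min t0 r0 ge_min tT'.
    have := cv r rT; move/(cvgB (cvg_cst (M r w * N r w))).
    rewrite /stopped -/r (VE _ _ Ew); apply: cvg_trans; apply: near_eq_cvg.
    apply: nearW => n /=.
    have E1 : M r w * N r w - M 0 w * N 0 w =
        gint T joint M N n r w + gint T joint N M n r w +
        gcov (grid_time T n (joint ^~ w)) (M ^~ w) (N ^~ w) r :=
      integration_by_parts (gridj n w) (M ^~ w) (N ^~ w) rT.
    rewrite M0 N0 mul0r subr0 in E1.
    have L1E : L1 n t w = gint T joint M N n r w by [].
    have L2E : L2 n t w = gint T joint N M n r w by [].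
    rewrite L1E L2E E1.
    exact: addrK.
  + exact: (adapted_stopped T0 FF aZ cZ (ss p)).
- exists E; split=> // w /= nc; apply: contrapT => Ew; apply: nc.
  by split=> [|t]; [exact: reg|exact: VE].
Qed.

End construction.

Lemma continuous_local_martingale0B M N : continuous_local_martingale0 T P F M ->
  continuous_local_martingale0 T P F N ->
  continuous_local_martingale0 T P F (fun t w => M t w - N t w).
Proof.
move=> lM lN.
have [sigma [ss ms es [mM bM] [mN bN]]] := localization T_gt0 P1 FF lM lN.
have [/(adaptedP T FF) aM cM M0 _] := lM; have [/(adaptedP T FF) aN cN N0 _] := lN.
split.
- by apply/(adaptedP T FF) => t tT; apply: admB; [exact: aM|exact: aN].
- by move=> w; apply: within_continuousB; [exact: cM|exact: cN].
- by move=> w; rewrite M0 N0 subrr.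
exists sigma; split; [exact: ss|exact: ms|exact: es|move=> p].
have /(martingaleP T P FF)[a1 i1 e1] := mM p.
have /(martingaleP T P FF)[a2 i2 e2] := mN p.
apply/(martingaleP T P FF); split.
- by move=> t tT; apply: admB; [exact: a1|exact: a2].
- by move=> t tT; apply: IntB; [exact: i1|exact: i2].
move=> s t U s0 st tT sU; have mU := filt_sub FF sU.
have tI : 0 <= t <= T by rewrite tT (le_trans s0).
have sI : 0 <= s <= T by rewrite s0 (le_trans st).
have e r : stopped (fun t w => M t w - N t w) (sigma p) r \* \1_U =
    (stopped M (sigma p) r \* \1_U) \- (stopped N (sigma p) r \* \1_U).
  by apply/funext => w /=; rewrite /stopped mulrBl.
rewrite !e !ExB; try (by apply: IntMindic => //; first [exact: i1|exact: i2]).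
by rewrite (e1 s t)// (e2 s t).
Qed.

(** The difference of two brackets is a local martingale of finite variation. *)
Lemma bracket_unique M N V V' :
  continuous_fv_process0 T F V -> continuous_fv_process0 T F V' ->
  continuous_local_martingale0 T P F (fun t w => M t w * N t w - V t w) ->
  continuous_local_martingale0 T P F (fun t w => M t w * N t w - V' t w) ->
  {ae P, forall w, forall t, 0 <= t <= T -> V t w = V' t w}.
Proof.
move=> [_ _ _ bV] [_ _ _ bV'] l l'.
have := continuous_local_martingale0B l' l.
rewrite (_ : (fun t w => _) = (fun t w => V t w - V' t w)); last first.
  by apply/funext => t; apply/funext => w; ring.
move=> lD; have bD w : bounded_variation 0 T ((fun t w => V t w - V' t w) ^~ w).
  apply: bounded_variationD => //; exact: bounded_variationN.
apply: filterS (fv_local_martingale_eq0 T_gt0 P1 FF lD bD) => w H t tT.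
by apply/eqP; rewrite -subr_eq0; apply/eqP; exact: H.
Qed.

End bracket.

(** * The path space *)

Section path_space.
Context {R : realType} (T : R).
Hypothesis T_gt0 : 0 < T.

Let T0 : 0 <= T := ltW T_gt0.

Lemma unif_cvgP (u : nat -> R -> R) (g : R -> R) :
  {uniform timeset T, u @ \oo --> g} <->
  forall e, 0 < e -> \forall n \near \oo, forall t, 0 <= t <= T ->
    `|g t - u n t| < e.
Proof.
split=> [H e e0|H].
  have nb : nbhs (g : {uniform` timeset T -> R})
      [set h | forall t, timeset T t -> ball (g t) e (h t)].
    apply/uniform_nbhs; exists [set xy | ball xy.1 e xy.2]; split=> //.
    by rewrite -entourage_ballE; exists e.
  have [k _ hk] := H _ nb; exists k => //.
move=> U /uniform_nbhs [E [entE EU]].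
have [e e0 eE] : exists2 e : R, 0 < e & [set xy | ball xy.1 e xy.2] `<=` E.
  by move: entE; rewrite -entourage_ballE => -[e /= e0 eE]; exists e.
have [k _ hk] := H e e0; exists k => // n /hk h; apply: EU => t; rewrite /timeset/= in_itv/= => tT.
by apply: eE; exact: h.
Qed.

Section evaluation.
Variables (m n : nat).
Implicit Types (x y : cpath T m n) (t : R).

Lemma at_timeE x t (tT : t \in timeset T) :
  at_time x t = (x : timeset T -> 'M[R]_(m, n)) (exist _ t tT).
Proof.
by have /(congr1 (fun f => f (exist _ t tT))) :=
  valLK (0 : 'M[R]_(m, n)) (x : timeset T -> 'M[R]_(m, n)).
Qed.

Lemma timesetP t : t \in timeset T <-> 0 <= t <= T.
Proof. by rewrite inE /timeset/= in_itv. Qed.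

Lemma at_time_continuous x i j :
  {within timeset T, continuous (fun t => at_time x t i j)}.
Proof.
have cx : {within timeset T, continuous (at_time x)}.
  by apply/subspace_valL_continuousP'; exact: cts_fun.
apply: (@within_continuous_comp _ _ _ _ _ (fun v : 'M[R]_(m, n) => v i j) _ cx).
by move=> v _; exact: coord_continuous.
Qed.

Lemma within_matrix_continuous (f : R -> 'M[R]_(m, n)) :
  (forall i j, {within timeset T, continuous (fun t => f t i j)}) ->
  {within timeset T, continuous f}.
Proof.
move=> c; apply/subspace_continuousP => t tT; apply/cvg_ballP => e e0.
have ce i j : \forall s \near within (timeset T) (nbhs t), ball (f t i j) e (f s i j).
  have /subspace_continuousP/(_ t tT)/cvg_ballP := c i j; exact.
have : \forall s \near within (timeset T) (nbhs t),
    forall i j, ball (f t i j) e (f s i j).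
  by apply: filter_forall => i; apply: filter_forall => j; exact: ce.
by apply: filterS => s h; split.
Qed.

Lemma open_evaluation t (U : set 'M[R]_(m, n)) : 0 <= t <= T -> open U ->
  uniform_open [set x : cpath T m n | U (at_time x t)].
Proof.
move=> tT oU; rewrite /uniform_open.
have tt : t \in timeset T by apply/timesetP.
exists [set f : {uniform timeset T -> 'M[R]_(m, n)} | U (f (exist _ t tt))].
  rewrite openE => f /= Uf; rewrite /interior.
  apply/uniform_nbhs.
  have : nbhs (f (exist _ t tt)) U by exact: open_nbhs_nbhs.
  rewrite -nbhs_entourageE => -[E entE EU]; exists E; split=> // h Eh /=.
  by apply: EU; apply/xsectionP; exact: Eh.
by apply/seteqP; split => x /=; rewrite (at_timeE x tt).
Qed.

Lemma measurable_coordinate (G : set (set (cpath T m n))) t i j :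
  (forall U, open U -> G [set x | U (at_time x t)]) ->
  measurable_fun setT
    (fun x : g_sigma_algebraType G => at_time (x : cpath T m n) t i j).
Proof.
move=> GU; apply: (measurability _ (RGenOInfty.measurableE R)).
move=> _ [_ [a ->] <-]; rewrite setTI; apply: sub_sigma_algebra.
rewrite (_ : _ @^-1` _ = [set x | [set v : 'M[R]_(m, n) | a < v i j] (at_time x t)]).
  apply: GU; rewrite (_ : [set v | _] = (fun v : 'M[R]_(m, n) => v i j) @^-1` `]a, +oo[%classic).
    apply: open_comp; last exact: interval_open.
    by move=> v _; exact: coord_continuous.
  by apply/seteqP; split => v /=; rewrite in_itv/= andbT.
by apply/seteqP; split => x /=; rewrite in_itv/= andbT.
Qed.

End evaluation.

Section endogenous_integral.
Variable d : nat.
Implicit Types (x : cpath T d 1) (i j : 'I_d).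

Lemma chi_coord i j x t l : chi i j x t 0 l = Defs.coord i t x * (l == j)%:R.
Proof. by rewrite /chi /Defs.coord !mxE eqxx. Qed.

Definition chi_process i j : R -> cpath T d 1 -> 'rV[R]_d := fun t x => chi i j x t.

(** The integrand [chi i j] is a multiple of the [j]-th coordinate vector, so the matrix
    product is a product of two coordinates. *)
Lemma endo_sumE i j x n : endo_sum n (chi i j x) x =
  gint T (chi_process i j) (Defs.coord i) (Defs.coord j) n ^~ x.
Proof.
apply/funext => t; rewrite /endo_sum /gint /gsum; congr (limn (series _)).
apply/funext => k; set v := (X in (_ *m X) 0 0).
rewrite /chi -scalemxAl mxE; congr (_ * _).
rewrite mxE (bigD1 j)//= big1 => [|l lj]; last first.
  by rewrite !mxE (negbTE lj) andbF mul0r.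
by rewrite mxE !eqxx mul1r addr0 /v !mxE.
Qed.

Lemma qcovE i j x t : qcov x t i j =
  pathwise_cov T (Defs.coord i) (Defs.coord j) (chi_process i j) (chi_process j i) t x.
Proof.
rewrite /qcov mxE /pathwise_cov /Defs.coord /endo_int.
by congr (_ - limn _ - limn _); apply/funext => n; rewrite endo_sumE.
Qed.

Lemma chi_cadlag i j x : cadlag T (chi i j x).
Proof.
have /subspace_continuousP c : {within timeset T, continuous (chi i j x)}.
  apply: within_matrix_continuous => k l; rewrite ord1.
  under eq_fun do rewrite chi_coord.
  by apply: within_continuousM; [exact: at_time_continuous|move=> t; exact: cvg_cst].
have H t : 0 <= t <= T -> forall U, nbhs (chi i j x t) U ->
    exists2 e, 0 < e & forall s, 0 <= s <= T -> `|t - s| < e -> U (chi i j x s).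
  move=> tT U /(c t ltac:(by rewrite /timeset/= in_itv)).
  rewrite /= withinE => -[V /nbhs_ballP[e /= e0 eV] UV].
  exists e => // s sT st.
  have : (V `&` timeset T) s by split; [exact: eV|rewrite /timeset/= in_itv].
  by rewrite -UV => -[].
split=> t tT.
- have tT' : 0 <= t <= T by case/andP: tT => -> /ltW.
  move=> U /(H t tT')[e e0 eU]; have [t0 t1] := andP tT.
  suff : \forall s \near t^'+, U (chi i j x s) by [].
  near=> s; apply: eU.
    apply/andP; split; first by apply: le_trans t0 _; near: s; exact: nbhs_right_ge.
    by apply/ltW; near: s; exact: nbhs_right_lt.
  rewrite distrC ger0_norm; last by rewrite subr_ge0; near: s; exact: nbhs_right_ge.
  by rewrite ltrBlDl; near: s; apply: nbhs_right_lt; rewrite ltrDl.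
- have tT' : 0 <= t <= T by case/andP: tT => /ltW -> ->.
  apply/cvg_ex; exists (chi i j x t) => U /(H t tT')[e e0 eU]; have [t0 t1] := andP tT.
  suff : \forall s \near t^'-, U (chi i j x s) by [].
  near=> s; apply: eU.
    apply/andP; split; first by apply/ltW; near: s; exact: nbhs_left_gt.
    by apply: le_trans t1; near: s; exact: nbhs_left_le.
  rewrite ger0_norm; last by rewrite subr_ge0; near: s; exact: nbhs_left_le.
  by rewrite ltrBlDl -ltrBlDr; near: s; apply: nbhs_left_gt; rewrite gtrBl.
Unshelve. all: by end_near. Qed.

End endogenous_integral.
End path_space.

(** * Criteria at dyadic times *)

Section dyadic_criteria.
Context {R : realType} (T : R).
Hypothesis T_gt0 : 0 < T.
Implicit Types (u : nat -> R -> R) (f : R -> R).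

Let T0 : 0 <= T := ltW T_gt0.

(** Uniform convergence in terms of countably many values and natural thresholds, so
    that it is a measurable condition on the sequence. *)
Definition dyadic_cauchy u := forall k : nat, exists N : nat, forall n m p l,
  (N <= n)%N -> (N <= m)%N -> (l <= 2 ^ p)%N ->
  `|u n (ugrid 0 T p l) - u m (ugrid 0 T p l)| <= k.+1%:R^-1.

Lemma invS_lt (e : R) : 0 < e -> exists k : nat, k.+1%:R^-1 < e.
Proof.
move=> e0; exists (Num.truncn e^-1).
rewrite invf_plt ?posrE//; exact: truncnS_gt.
Qed.

Lemma dyadic_cauchy_limit u :
  (forall n, {within timeset T, continuous (u n)}) -> dyadic_cauchy u ->
  forall e, 0 < e -> \forall n \near \oo, forall t, 0 <= t <= T ->
    `|limn (u ^~ t) - u n t| < e.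
Proof.
move=> cu H.
have step k : exists N : nat, forall n m t, (N <= n)%N -> (N <= m)%N ->
    0 <= t <= T -> `|u n t - u m t| <= k.+1%:R^-1.
  have [N NP] := H k; exists N => n m t Nn Nm; move: t.
  apply: (path_le_dyadic T_gt0 (x := fun t => u n t - u m t)).
    exact: within_continuousB.
  by move=> p l lp; exact: NP.
have cv t : 0 <= t <= T -> u n t @[n --> \oo] --> limn (u ^~ t).
  move=> tT; apply: cauchy_cvg; apply/cauchy_ballP => e e0.
  have [k ke] := invS_lt e0; have [N NP] := step k.
  pose e' := k.+1%:R^-1 : R.
  have e'e : 0 < (e - e') / 2 by rewrite divr_gt0// subr_gt0.
  have [k2 ke2] : exists k2 : nat, k2.+1%:R^-1 < e / 2 by apply: invS_lt; rewrite divr_gt0.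
  have [N2 N2P] := step k2.
  exists (ball (u N2 t) (e / 2), ball (u N2 t) (e / 2)) => /=.
    split; exists N2 => // n /= Nn; rewrite /ball/=;
    by apply: le_lt_trans ke2; exact: N2P.
  move=> [y1 y2] [/= h1 h2]; move: h1 h2; rewrite /ball /=.
  have := ler_distD (u N2 t) y1 y2.
  rewrite [`|y1 - u N2 t|]distrC; lra.
move=> e e0; have [k ke] := invS_lt e0; have [N NP] := step k.
exists N => // n /= Nn t tT; apply: le_lt_trans ke.
have h : (fun m => `|u m t - u n t|) @ \oo --> `|limn (u ^~ t) - u n t|.
  by apply: cvg_norm; apply: cvgB; [exact: cv|exact: cvg_cst].
rewrite -(cvg_lim (@Rhausdorff R) h); apply: limr_le.
  by apply/cvg_ex; eexists; exact: h.
by exists N => // m /= Nm; apply: NP.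
Qed.

Lemma dyadic_cauchyP u : (forall n, {within timeset T, continuous (u n)}) ->
  (exists g, {uniform timeset T, u @ \oo --> g}) <-> dyadic_cauchy u.
Proof.
move=> cu; split=> [[g /unif_cvgP H] k|H]; last first.
  exists (fun t => limn (u ^~ t)); apply/unif_cvgP; exact: dyadic_cauchy_limit.
pose e := k.+1%:R^-1 : R; have k0 : 0 < e / 2 by rewrite /e divr_gt0.
have [N _ NP] := H _ k0; exists N => n m p l Nn Nm lp.
have tT := ugrid_mem T_gt0 lp.
have h1 := NP n Nn _ tT; have h2 := NP m Nm _ tT.
have := ler_distD (g (ugrid 0 T p l)) (u n (ugrid 0 T p l)) (u m (ugrid 0 T p l)).
rewrite -/e [`|u n (ugrid 0 T p l) - g (ugrid 0 T p l)|]distrC.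
move: h1 h2 => /=; lra.
Qed.

Lemma dyadic_cauchy_cvg u t : (forall n, {within timeset T, continuous (u n)}) ->
  dyadic_cauchy u -> 0 <= t <= T -> u n t @[n --> \oo] --> limn (u ^~ t).
Proof.
move=> cu H tT; apply/cvgrPdist_lt => e e0.
by apply: filterS (dyadic_cauchy_limit cu H e0) => n; apply.
Qed.

Lemma dyadic_cauchy_continuous u :
  (forall n, {within timeset T, continuous (u n)}) -> dyadic_cauchy u ->
  {within timeset T, continuous (fun t => limn (u ^~ t))}.
Proof.
move=> cu H; apply: (unif_limit_continuous cu) => e e0.
by have [n _ /(_ n (leqnn n))] := dyadic_cauchy_limit cu H e0; exists n.
Qed.

Definition dyadic_index p (t : R) : nat := Num.truncn (t / T * 2 ^+ p).

Let index_ge0 p t : 0 <= t -> 0 <= t / T * 2 ^+ p.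
Proof. by move=> t0; rewrite mulr_ge0 ?exprn_ge0// divr_ge0. Qed.

Lemma dyadic_index_le p t : 0 <= t <= T -> (dyadic_index p t <= 2 ^ p)%N.
Proof.
move=> /andP[t0 tT]; rewrite -(ler_nat R) natrX.
apply: le_trans (_ : t / T * 2 ^+ p <= _); first by rewrite truncn_le index_ge0.
by rewrite ler_piMl ?exprn_ge0// ler_pdivrMr// mul1r.
Qed.

Lemma dyadic_index_mono p s t : 0 <= s -> s <= t ->
  (dyadic_index p s <= dyadic_index p t)%N.
Proof.
move=> s0 st; apply: le_truncn.
by rewrite ler_wpM2r ?exprn_ge0// ler_wpM2r// invr_ge0.
Qed.

Lemma dyadic_index_close p t : 0 <= t <= T ->
  `|t - ugrid 0 T p (dyadic_index p t)| <= T / 2 ^+ p.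
Proof.
move=> /andP[t0 tT]; have p0 : (0 : R) < 2 ^+ p by rewrite exprn_gt0.
pose z := t / T * 2 ^+ p.
have jz : (dyadic_index p t)%:R <= z by rewrite /dyadic_index truncn_le index_ge0.
have zj : z < (dyadic_index p t).+1%:R by exact: truncnS_gt.
have tz : t = T * (z / 2 ^+ p).
  by rewrite /z mulfK ?gt_eqF// mulrC divfK// gt_eqF.
rewrite {1}tz /ugrid add0r subr0 -mulrBr -mulrBl normrM gtr0_norm//.
rewrite ler_wpM2l// normrM [X in _ * X]gtr0_norm ?invr_gt0//.
rewrite ger0_norm ?subr_ge0// ler_piMl ?invr_ge0 ?(ltW p0)//.
by move: zj; rewrite -natr1; lra.
Qed.

Definition dyadic_variation p f : R :=
  \sum_(l < 2 ^ p) `|f (ugrid 0 T p l.+1) - f (ugrid 0 T p l)|.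

(** Rounding the times down to a dyadic grid turns [f] into a path controlled by
    its dyadic variation, and leaves each variation unchanged in the limit. *)
Lemma bounded_variation_dyadic f : {within timeset T, continuous f} ->
  bounded_variation 0 T f <->
  exists C : nat, forall p, dyadic_variation p f <= C%:R.
Proof.
move=> cf; split=> [/(bounded_variation_controlled T0)[v fv]|[C CP]].
  exists (Num.truncn (v T - v 0)).+1 => p.
  apply: le_trans (ltW (truncnS_gt _)).
  have gr := @grid_ugrid R 0 T p T0; have [g0 gL gM] := gr.
  have -> : v T - v 0 =
      \sum_(l < 2 ^ p) (v (ugrid 0 T p l.+1) - v (ugrid 0 T p l)).
    by rewrite -(big_mkord xpredT (fun l => v (ugrid 0 T p l.+1) - v (ugrid 0 T p l)))
      (telescope_sumr (fun l => v (ugrid 0 T p l)))// gL g0.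
  apply: ler_sum => l _; apply: fv.
  - by have /andP[] := grid_mem gr (ltnW (ltn_ord l)).
  - by have /andP[] := gM l (ltn_ord l).
  - by have /andP[] := grid_mem gr (ltn_ord l).
pose r p t := ugrid 0 T p (dyadic_index p t).
pose c p t := \sum_(l < dyadic_index p t) `|f (ugrid 0 T p l.+1) - f (ugrid 0 T p l)|.
have ctrl p : controlled_by T (f \o r p) (c p).
  move=> s t s0 st tT; have ij := dyadic_index_mono p s0 st.
  rewrite /= /r /c -(subnKC ij); move: (dyadic_index p t - dyadic_index p s)%N => k.
  elim: k => [|k IH]; first by rewrite addn0 !subrr normr0.
  rewrite addnS big_ord_recr /=.
  have := ler_distD (f (ugrid 0 T p (dyadic_index p s + k))) (f (ugrid 0 T p (dyadic_index p s + k).+1))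
    (f (ugrid 0 T p (dyadic_index p s))).
  lra.
have cC p : c p T - c p 0 <= C%:R.
  have c0 : 0 <= c p 0 by apply: sumr_ge0 => l _.
  have : c p T <= dyadic_variation p f.
    rewrite /c /dyadic_variation -(subnKC (@dyadic_index_le p T ltac:(by rewrite T0 lexx))).
    rewrite big_split_ord /= lerDl; apply: sumr_ge0 => l _; exact: normr_ge0.
  have := CP p; lra.
exists C%:R => _ [s ps <-].
have fr t : 0 <= t <= T -> f (r p t) @[p --> \oo] --> f t.
  move=> tT; apply/cvgrPdist_lt => e e0.
  have /within_contP/(_ t tT e e0)[d d0 dP] := cf.
  have := cvg_half_pow T; move/cvgrPdist_lt => /(_ d d0).
  apply: filterS => p; rewrite sub0r normrN => h.
  apply: dP; first exact: ugrid_mem (dyadic_index_le p tT).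
  apply: le_lt_trans (dyadic_index_close p tT) _; apply: le_lt_trans h; exact: ler_norm.
have pt i : (i <= size s)%N -> 0 <= nth T (0 :: s) i <= T.
  move=> iS; apply/andP; split; first exact: itv_partition_nth_ge ps.
  exact: itv_partition_nth_le ps.
have h : (fun p => variation 0 T (f \o r p) s) @ \oo --> variation 0 T f s.
  rewrite /variation /= !big_mkord; under eq_fun do rewrite big_mkord.
  have H : forall k, (k <= size s)%N ->
    (fun p => \sum_(i < k) `|f (r p (nth T (0 :: s) i.+1)) - f (r p (nth T (0 :: s) i))|)
      @ \oo --> \sum_(i < k) `|f (nth T (0 :: s) i.+1) - f (nth T (0 :: s) i)|.
    elim=> [|k IH] ks.
      by rewrite big_ord0; under eq_fun do rewrite big_ord0; exact: cvg_cst.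
    rewrite big_ord_recr; under eq_fun do rewrite big_ord_recr.
    apply: cvgD; first exact: IH (ltnW ks).
    by apply: cvg_norm; apply: cvgB; apply: fr; apply: pt; rewrite ?(ltnW ks).
  exact: H.
rewrite -(cvg_lim (@Rhausdorff R) h); apply: limr_le.
  by apply/cvg_ex; eexists; exact: h.
apply: nearW => p; apply: le_trans (cC p); exact: variation_controlled (ctrl p) ps.
Qed.

End dyadic_criteria.

(** * Measurability of path-valued maps *)

Section countable_quantifiers.
Context {disp} {Om : measurableType disp}.

Lemma measurable_exists {I : countType} (Q : I -> set Om) :
  (forall i, measurable (Q i)) -> measurable [set w | exists i, Q i w].
Proof.
move=> mQ; rewrite (_ : [set w | _] = \bigcup_i Q i).
  by apply: countable_bigcupT_measurable => //; exact: countableP.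
by apply/seteqP; split => w [i]; [exists i|move=> _; exists i].
Qed.

Lemma measurable_forall {I : countType} (Q : I -> set Om) :
  (forall i, measurable (Q i)) -> measurable [set w | forall i, Q i w].
Proof.
move=> mQ; rewrite (_ : [set w | _] = ~` [set w | exists i, (~` Q i) w]).
  by apply: measurableC; apply: measurable_exists => i; exact: measurableC.
apply/seteqP; split => w /= h; first by move=> [i]; apply.
by move=> i; apply: contrapT => n; apply: h; exists i.
Qed.

Lemma measurable_implies (b : Prop) (Q : set Om) : (b -> measurable Q) ->
  measurable [set w | b -> Q w].
Proof.
have [hb|nb] := pselect b => mQ.
  rewrite (_ : [set w | _] = Q); first exact: mQ.
  by apply/seteqP; split => w /=; [apply|].
rewrite (_ : [set w | _] = setT); first exact: measurableT.
by apply/seteqP; split => // w _ /= /nb.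
Qed.

Lemma measurable_le_cst {R : realType} (D : set Om) (f : Om -> R) r :
  measurable D -> measurable_fun D f -> measurable [set w | D w /\ f w <= r].
Proof.
move=> mD mf; rewrite (_ : [set w | _] = D `&` f @^-1` `]-oo, r]%classic).
  by apply: mf => //; exact: measurable_itv.
by apply/seteqP; split=> w [Dw]; rewrite /= in_itv.
Qed.

End countable_quantifiers.

Section path_measurability.
Context {R : realType} (T : R) (m n : nat).
Hypothesis T_gt0 : 0 < T.

Let T0 : 0 <= T := ltW T_gt0.

(** A tube of width [k.+1%:R^-1] around the rational values [q] prescribed on the
    dyadic grid of order [p]; it is visible from the values at dyadic times. *)
Definition tube (c : nat * nat * seq 'M[rat]_(m, n)) : set (cpath T m n) :=
  let: (p, k, q) := c in
  [set y | forall p' a b i j, (a <= 2 ^ p')%N -> (b <= 2 ^ p)%N ->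
    `|ugrid 0 T p' a - ugrid 0 T p b| <= T / 2 ^+ p ->
    `|at_time y (ugrid 0 T p' a) i j - ratr (nth 0 q b i j)| <= k.+1%:R^-1].

Lemma tube_close p k q (y z : cpath T m n) : tube (p, k, q) y -> tube (p, k, q) z ->
  forall t i j, 0 <= t <= T -> `|at_time y t i j - at_time z t i j| <= 2 * k.+1%:R^-1.
Proof.
move=> ty tz t i j; move: t.
apply: (path_le_dyadic T_gt0 (x := fun t => at_time y t i j - at_time z t i j)).
  by apply: within_continuousB; exact: at_time_continuous.
move=> p' a ap; have uT := ugrid_mem T_gt0 ap.
have bp := dyadic_index_le T_gt0 p uT; have cl := dyadic_index_close T_gt0 p uT.
have h1 := ty _ _ _ i j ap bp cl; have h2 := tz _ _ _ i j ap bp cl.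
set v := ratr _ in h1 h2.
have := ler_distD v (at_time y (ugrid 0 T p' a) i j) (at_time z (ugrid 0 T p' a) i j).
rewrite [`|at_time z (ugrid 0 T p' a) i j - v|]distrC in h2.
move: h1 h2; set e := _^-1; lra.
Qed.

(** Uniform continuity provides the order of the grid, and density of the rationals the
    values on it. *)
Lemma tube_mem (y : cpath T m n) k : exists p q, tube (p, k, q) y.
Proof.
pose e := k.+1%:R^-1 : R; have e0 : 0 < e by rewrite invr_gt0.
have [d d0 dP] := @unif_cont_finite R T ('I_m * 'I_n)%type
  (fun ij t => at_time y t ij.1 ij.2) (e / 2)
  (fun ij => @at_time_continuous R T m n y ij.1 ij.2) ltac:(by rewrite divr_gt0).
have [p pd] : exists p, T / 2 ^+ p <= d.
  have := cvg_half_pow T => /cvgrPdist_lt /(_ d d0)[p _ /(_ p (leqnn p))] /=.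
  by rewrite sub0r normrN ger0_norm ?divr_ge0 ?exprn_ge0// => /ltW; exists p.
have rq (v : R) : exists r : rat, `|v - ratr r| < e / 2.
  have [|r] := @rat_in_itvoo R (v - e / 2) (v + e / 2); first by lra.
  by rewrite in_itv/= => h; exists r; rewrite ltr_norml; lra.
pose val b := \matrix_(i < m, j < n) sval (cid (rq (at_time y (ugrid 0 T p b) i j))).
exists p, (mkseq val (2 ^ p).+1) => p' a b i j ap bp cl.
rewrite nth_mkseq// mxE; case: cid => r /= rP.
have := dP (i, j) _ _ (ugrid_mem T_gt0 ap) (ugrid_mem T_gt0 bp) (le_trans cl pd).
have := ler_distD (at_time y (ugrid 0 T p b) i j) (at_time y (ugrid 0 T p' a) i j) (ratr r).
rewrite -/e; lra.
Qed.

(** Two members of a tube are uniformly closer than a multiple of its width, so that a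
    narrow tube through a point of an open set stays inside it. What matters is that
    tubes, though not open, are countably many. *)
Lemma uniform_open_tubes (U : set (cpath T m n)) : uniform_open U ->
  U = [set y | exists c, tube c `<=` U /\ tube c y].
Proof.
move=> [A oA AU]; apply/seteqP; split=> [y Uy|y [c [cU /cU]]//].
have Ay : nbhs (y : {uniform timeset T -> 'M[R]_(m, n)}) A.
  by apply: open_nbhs_nbhs; split=> //; move: Uy; rewrite -AU.
have /uniform_nbhs[E [entE EA]] := Ay.
have [e e0 eE] : exists2 e : R, 0 < e &
    [set xy : 'M[R]_(m, n) * 'M[R]_(m, n) | ball xy.1 e xy.2] `<=` E.
  by move: entE; rewrite -entourage_ballE => -[e /= e0 eE]; exists e.
have [k ke] := invS_lt (e := e / 2) ltac:(by rewrite divr_gt0).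
have [p [q yq]] := tube_mem y k.
exists (p, k, q); split=> // z zq; rewrite -AU /=; apply: EA => -[t tT] _ /=.
apply: eE; split=> // i j; rewrite /ball/=.
have := tube_close yq zq i j (proj1 (timesetP _ _) tT).
rewrite !(at_timeE _ tT); move: ke; set r := _^-1.
move=> h1 h2; apply: le_lt_trans h2 _; lra.
Qed.

(** Open sets are countable unions of tubes, and tubes are visible from evaluations. *)
Lemma measurable_path {disp} {Om : measurableType disp} (D : set Om)
    (f : Om -> cpath T m n) : measurable D ->
  (forall t i j, 0 <= t <= T -> measurable_fun D (fun w => at_time (f w) t i j)) ->
  measurable_fun D (f : Om -> borel_cpath T m n).
Proof.
move=> mD mf; 
apply: (@measurability _ _ Om (borel_cpath T m n) D f (@uniform_open R T m n)).
  by [].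
move=> _ [U oU <-].
rewrite (uniform_open_tubes oU).
rewrite (_ : _ `&` _ = [set w | exists c, tube c `<=` U /\ (D w /\ tube c (f w))]); last first.
  apply/seteqP; split=> [w [Dw [c [cU cf]]]|w [c [cU [Dw cf]]]]; first by exists c.
  by split=> //; exists c.
apply: measurable_exists => c.
suff : measurable [set w | tube c `<=` U /\ (D w /\ tube c (f w))] by [].
have [cU|ncU] := pselect (tube c `<=` U); last first.
  rewrite (_ : [set w | _] = set0); first exact: measurable0.
  by apply/seteqP; split=> w // -[].
case: c cU => [[p k] q] cU.
rewrite (_ : [set w | _] = [set w | forall p' a b i j, (a <= 2 ^ p')%N -> (b <= 2 ^ p)%N ->
    `|ugrid 0 T p' a - ugrid 0 T p b| <= T / 2 ^+ p -> D w /\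
    `|at_time (f w) (ugrid 0 T p' a) i j - ratr (nth 0 q b i j)| <= k.+1%:R^-1] `&` D).
  apply: measurableI => //; do 5 (apply: measurable_forall => ?).
  apply: measurable_implies => ap; do 2 (apply: measurable_implies => ?).
  apply: measurable_le_cst => //; apply: measurableT_comp; first exact: normr_measurable.
  by apply: measurable_funB; [apply: mf; exact: ugrid_mem|exact: measurable_cst].
apply/seteqP; split=> [w [_ [Dw h]]|w [h Dw]]; split=> //.
  by move=> *; split=> //; exact: h.
by split=> // p' a b i j ap bp cl; have [] := h p' a b i j ap bp cl.
Qed.

End path_measurability.

(** * The covariation map is Borel *)

Section covariation_path.
Context {R : realType} (T : R) (d : nat).
Hypothesis T_gt0 : 0 < T.

Let T0 : 0 <= T := ltW T_gt0.

Implicit Types (x : cpath T d 1) (i j : 'I_d).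

Local Notation X := (@Defs.coord R T d).
Local Notation chiP := (@chi_process R T d).

(** The map [p] will be the identity, from a copy of the path space that carries another
    sigma-algebra: the Borel one, or the completed one of a law. *)
Lemma chi_grid_process {disp} {Om : measurableType disp} (p : Om -> cpath T d 1)
    (F : R -> set (set Om)) i j : right_filtration F ->
  adapted T F (fun t w => X i t (p w)) ->
  grid_process T F (fun t w => chiP i j t (p w)).
Proof.
move=> FF aX l; have E : (fun t (w : Om) => chiP i j t (p w) 0 l) =
    (fun t w => X i t (p w) * (l == j)%:R).
  by apply/funext => t; apply/funext => w; exact: chi_coord.
rewrite E; split.
  have /(adaptedP T FF) a := aX.
  apply/(adaptedP T FF) => t tT; apply: admM; [exact: a|exact: adm_cst].
move=> w; apply: within_continuousM; last by move=> t; exact: cvg_cst.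
exact: at_time_continuous.
Qed.

Lemma chi_is_grid n i j x : is_grid T (grid_time T n (chiP i j ^~ x)).
Proof.
apply: is_grid_grid_time => // l.
rewrite (_ : (fun t => _) = (fun t => X i t x * (l == j)%:R)).
  apply: within_continuousM; last by move=> t; exact: cvg_cst.
  exact: at_time_continuous.
by apply/funext => t; exact: chi_coord.
Qed.

Definition cov_int i j n t x := gint T (chiP i j) (X i) (X j) n t x.

Lemma cov_int_continuous i j n x :
  {within timeset T, continuous (fun t => cov_int i j n t x)}.
Proof.
exact: (@continuous_gsum _ _ _ (chi_is_grid n i j x) _ (X j ^~ x) (@at_time_continuous _ _ _ _ x _ _)).
Qed.

Lemma endo_domainP i j x : endo_domain (chi i j x, x) <->
  dyadic_cauchy T (fun n t => cov_int i j n t x).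
Proof.
rewrite -(dyadic_cauchyP T_gt0 (fun n => @cov_int_continuous i j n x)).
rewrite /endo_domain /=; split=> [[_ [g]]|[g gP]].
  under [X in X @ _]funext do rewrite endo_sumE.
  by exists g.
split; first exact: chi_cadlag.
exists g; under [X in X @ _]funext do rewrite endo_sumE.
exact: gP.
Qed.

Lemma qcov_entryE x t i j : qcov x t i j =
  X i t x * X j t x - X i 0 x * X j 0 x
    - limn (fun n => cov_int i j n t x) - limn (fun n => cov_int j i n t x).
Proof. exact: qcovE. Qed.

Lemma qcov_entry_continuous x i j : Dqv x ->
  {within timeset T, continuous (fun t => qcov x t i j)}.
Proof.
move=> Dx; 
have -> : (fun t => qcov x t i j) = (fun t => X i t x * X j t x - X i 0 x * X j 0 x
    - limn (fun n => cov_int i j n t x) - limn (fun n => cov_int j i n t x)).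
  by apply/funext => t; exact: qcov_entryE.
have c k l := dyadic_cauchy_continuous T_gt0 (fun n => @cov_int_continuous k l n x)
  (proj1 (endo_domainP k l x) (Dx k l)).
apply: within_continuousB; last exact: c.
apply: within_continuousB; last exact: c.
apply: within_continuousB; last by move=> t; exact: cvg_cst.
by apply: within_continuousM; exact: at_time_continuous.
Qed.

Lemma qcov_pathE x t : {within timeset T, continuous (qcov x)} -> 0 <= t <= T ->
  at_time (qcov_path x) t = qcov x t.
Proof.
move=> c tT; have tt : t \in timeset T by apply/timesetP.
rewrite (at_timeE _ tt) /qcov_path; case: pselect => //= nc; exfalso; apply: nc.
exact/subspace_sigL_continuousP.
Qed.


Lemma Gqv_bounded_variation x i j : Dqv x ->
  bounded_variation 0 T (fun t => at_time (qcov_path x) t i j) <->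
  exists C : nat, forall p, dyadic_variation T p (fun t => qcov x t i j) <= C%:R.
Proof.
move=> Dx; have c := within_matrix_continuous (fun k l => @qcov_entry_continuous x k l Dx).
rewrite (bounded_variation_dyadic T_gt0 (@at_time_continuous _ _ _ _ (qcov_path x) i j)).
have E p : dyadic_variation T p (fun t => at_time (qcov_path x) t i j) =
    dyadic_variation T p (fun t => qcov x t i j).
  rewrite /dyadic_variation; apply: eq_bigr => l _.
  by rewrite !qcov_pathE//; apply: ugrid_mem => //; exact: ltnW.
by split=> -[C CP]; exists C => p; [rewrite -E|rewrite E].
Qed.

(** On the domain the covariation is a uniform limit of continuous paths, and the
    dyadic times test its variation. *)
Lemma GqvE : Gqv T d = [set x | Dqv x /\ forall i j, exists C : nat, forall p,
  dyadic_variation T p (fun t => qcov x t i j) <= C%:R].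
Proof.
apply/seteqP; split=> x.
  by move=> [Dx _ bv]; split=> // i j; apply/(Gqv_bounded_variation i j Dx); exact: bv.
move=> [Dx bv]; split=> //.
  exact: within_matrix_continuous (fun k l => @qcov_entry_continuous x k l Dx).
by move=> i j; apply/(Gqv_bounded_variation i j Dx); exact: bv.
Qed.

Local Notation BP := (borel_cpath T d 1).

Lemma borel_filtration : right_filtration (fun _ : R => @measurable _ BP).
Proof.
split; first by move=> _; exact: sigma_algebra_measurable.
- by move=> t E.
- by move=> s t _ E.
- by move=> t E H; apply: (H (t + 1)); rewrite ltrDl.
Qed.

Lemma measurable_coord i t : 0 <= t <= T -> measurable_fun setT (X i t : BP -> R).
Proof.
move=> tT; apply: (measurable_coordinate (G := @uniform_open R T d 1)).
by move=> U; exact: open_evaluation.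
Qed.

Let adapted_coord i : adapted T (fun _ : R => @measurable _ BP) (X i).
Proof.
move=> t; rewrite /timeset/= in_itv/= => tT B mB; rewrite -[_ @^-1` _]setTI.
exact: measurable_coord.
Qed.

Lemma measurable_cov_int i j n t : 0 <= t <= T ->
  measurable_fun setT (cov_int i j n t : BP -> R).
Proof.
move=> tT; have gx := @chi_grid_process _ BP id _ i j borel_filtration (adapted_coord i).
apply: (adm_meas borel_filtration (t := t)); apply: (adm_gsum T_gt0 borel_filtration) => //.
- by move=> l; have [] := gx l.
- by move=> l; have [] := gx l.
- by move=> w; exact: at_time_continuous.
- by move=> w; exact: at_time_continuous.
Qed.

Lemma measurable_Dqv : measurable (@Dqv R T d : set BP).
Proof.
rewrite (_ : @Dqv R T d = [set x | forall i j, dyadic_cauchy T (fun n t => cov_int i j n t x)]); last first.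
  by apply/seteqP; split=> x h i j; apply/endo_domainP.
apply: measurable_forall => i; apply: measurable_forall => j.
apply: measurable_forall => k; apply: measurable_exists => N.
apply: measurable_forall => n; apply: measurable_forall => m.
apply: measurable_forall => p; apply: measurable_forall => l.
do 2 (apply: measurable_implies => ?); apply: measurable_implies => lp.
have uT := ugrid_mem T_gt0 lp.
pose f := cov_int i j n (ugrid 0 T p l) \- cov_int i j m (ugrid 0 T p l).
suff : measurable [set w : BP | setT w /\ `|f w| <= k.+1%:R^-1].
  by congr measurable; apply/seteqP; split=> [w []|w h].
apply: measurable_le_cst => //; apply: measurableT_comp; first exact: normr_measurable.
by apply: measurable_funB; exact: measurable_cov_int.
Qed.

Lemma measurable_qcov i j t : 0 <= t <= T ->
  measurable_fun (@Dqv R T d : set BP) (fun x => qcov x t i j).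
Proof.
move=> tT.
have z0 : 0 <= (0 : R) <= T by rewrite lexx T0.
apply: (@measurable_fun_cvg _ BP R _ (fun n (x : BP) => X i t x * X j t x - X i 0 x * X j 0 x
    - cov_int i j n t x - cov_int j i n t x)).
  move=> n; apply: measurable_funTS.
  repeat (apply: measurable_funB || apply: measurable_funM); 
    by [exact: measurable_coord|exact: measurable_cov_int].
move=> x Dx; rewrite qcov_entryE.
have c k l := dyadic_cauchy_cvg T_gt0 (fun n => @cov_int_continuous k l n x)
  (proj1 (endo_domainP k l x) (Dx k l)) tT.
by apply: cvgB; [apply: cvgB; [exact: cvg_cst|exact: c]|exact: c].
Qed.

Lemma measurable_Gqv : measurable (Gqv T d : set BP).
Proof.
rewrite GqvE.
rewrite (_ : [set x | _] = [set x : BP | forall i j, exists C : nat, forall p, Dqv x /\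
   dyadic_variation T p (fun t => qcov x t i j) <= C%:R] `&` (@Dqv R T d : set BP)).
  apply: measurableI; last exact: measurable_Dqv.
  do 2 (apply: measurable_forall => ?); apply: measurable_exists => C.
  apply: measurable_forall => p.
  apply: measurable_le_cst; first exact: measurable_Dqv.
  apply: measurable_sum => l; apply: measurableT_comp; first exact: normr_measurable.
  apply: measurable_funB; apply: measurable_qcov; apply: ugrid_mem => //; exact: ltnW.
apply/seteqP; split=> [x [Dx h]|x [h Dx]]; split=> // i j.
  by have [C CP] := h i j; exists C.
by have [C CP] := h i j; exists C => p; have [] := CP p.
Qed.

Lemma measurable_qcov_path :
  measurable_fun (Gqv T d : set BP) (@qcov_path R T d : BP -> borel_cpath T d d).
Proof.
apply: (measurable_path T_gt0 measurable_Gqv) => t i j tT.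
apply: (@eq_measurable_fun _ _ BP R _ (fun x => qcov x t i j)).
  by move=> x; rewrite inE => -[_ c _]; rewrite qcov_pathE.
apply: (measurable_funS measurable_Dqv); last exact: measurable_qcov.
by move=> x [].
Qed.

End covariation_path.

(** * Semimartingale laws *)

(** Covers of measure at most [1 / k.+1] intersect in a measurable null set. *)
Lemma mu_ext_eq0_negligible {disp} {Om : measurableType disp} {R : realType}
    (P : {measure set Om -> \bar R}) (A : set Om) :
  mu_ext P A = 0%E -> P.-negligible A.
Proof.
move=> A0.
have cover k : exists B, [/\ measurable B, A `<=` B & (P B <= (k.+1%:R^-1)%:E)%E].
  pose S := [set (\sum_(k <oo) P (F k))%E | F in measurable_cover A].
  have S0 : ereal_inf S = 0%E by exact: A0.
  have e0 : (0 : R) < k.+1%:R^-1 by rewrite invr_gt0.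
  have [x [F [mF AF] <-] Fk] := lb_ereal_inf_adherent e0
    (S := S) ltac:(by rewrite S0).
  exists (\bigcup_n F n); split=> //; first exact: bigcupT_measurable.
  apply: le_trans (measure_sigma_subadditive _ _ _ _) _ => //.
    exact: bigcupT_measurable.
  by move: Fk; rewrite S0 add0e => /ltW.
pose B k := sval (cid (cover k)).
have BP k : [/\ measurable (B k), A `<=` B k & (P (B k) <= (k.+1%:R^-1)%:E)%E].
  by rewrite /B; case: cid.
have mB : measurable (\bigcap_k B k) by apply: bigcapT_measurable => k; case: (BP k).
exists (\bigcap_k B k); split=> //; last by move=> w Aw k _; have [_ AB _] := BP k; exact: AB.
apply/eqP; rewrite eq_le measure_ge0 andbT; apply/lee_addgt0Pr => e e0.
have [k ke] := invS_lt e0; rewrite add0e.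
have [mBk _ Bk] := BP k; apply: le_trans (le_trans Bk _); last by rewrite lee_fin ltW.
by apply: le_measure; rewrite ?inE//; exact: bigcap_inf.
Qed.

Section laws.
Context {R : realType} (T : R) (d : nat).
Hypothesis T_gt0 : 0 < T.
Variable P : law T d.

Let T0 : 0 <= T := ltW T_gt0.

Local Notation cP := (completion P).
Local Notation F := (usual_augmentation P).
Local Notation BP := (borel_cpath T d 1).
Local Notation CP := (caratheodory_type (mu_ext P)).

Lemma completion_setT : cP setT = 1%E.
Proof.
have -> : cP setT = mu_ext P setT by [].
by rewrite measurable_mu_extE//; exact: probability_setT.
Qed.

Lemma completion_negligible (A : set (cpath T d 1)) :
  cP.-negligible A -> P.-negligible A.
Proof.
move=> [B [_ B0 AB]]; have [C [mC C0 BC]] := mu_ext_eq0_negligible B0.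
by exists C; split=> //; exact: subset_trans BC.
Qed.

Lemma negligible_usual (A : set (cpath T d 1)) t : cP.-negligible A -> F t A.
Proof.
by move=> /completion_negligible nA s _; apply: sub_sigma_algebra; right.
Qed.

Lemma canonical_borel t E : canonical_filtration t E -> measurable (E : set BP).
Proof.
apply: smallest_sub; first exact: sigma_algebra_measurable.
move=> _ [s [U [sT _ oU ->]]]; apply: sub_sigma_algebra.
exact: open_evaluation.
Qed.

Lemma usual_filtration : @right_filtration R _ CP F.
Proof.
split.
- move=> t; split=> [s ts|A FA s ts|A FA s ts];
    have [h0 hC hU] := @smallest_sigma_algebra _ setT
      (canonical_filtration s `|` P.-negligible).
  + exact: h0.
  + by apply: hC; exact: FA.
  + by apply: hU => i; exact: FA.
- move=> t E /(_ (t + 1)); rewrite ltrDl => /(_ ltr01).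
  apply: smallest_sub; first exact: sigma_algebra_measurable.
  move=> A [/canonical_borel mA|[B [mB B0 AB]]].
    exact: caratheodory_measurable_mu_ext.
  apply: measure_is_complete_caratheodory; exists B; split=> //.
    exact: caratheodory_measurable_mu_ext.
  by rewrite /= measurable_mu_extE.
- by move=> s t st E FE u tu; apply: FE; exact: le_lt_trans tu.
- move=> t E FE s ts; apply: (FE ((t + s) / 2)); lra.
Qed.


Hypothesis semP : semimartingale_law P.

Local Notation X := (@Defs.coord R T d).
Local Notation chiP := (@chi_process R T d).

Lemma chi_usual i j : @grid_process R T _ CP F _ (chiP i j).
Proof. exact: (@chi_grid_process _ _ _ _ CP id F i j usual_filtration (proj1 (semP i))). Qed.

Lemma chi_diag i j t (x : CP) : chiP i j t x 0 j = X i t x.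
Proof. by rewrite /chi_process chi_coord eqxx mulr1. Qed.

Lemma coord_bracket i j M A N B :
  semimartingale_decomposition T cP F (X i) M A ->
  semimartingale_decomposition T cP F (X j) N B ->
  exists V : R -> CP -> R, [/\ @continuous_fv_process0 R T _ CP F V,
    continuous_local_martingale0 T cP F (fun t w => M t w * N t w - V t w) &
    {ae cP, forall x, @regular R T _ CP (X i) (X j) M N _ _ (chiP i j) (chiP j i) x /\
      forall t, V t x = qcov x t i j}].
Proof.
move=> dX dY.
have [V [fV lV VE]] := bracket_construction T_gt0 completion_setT usual_filtration
  (fun t E => @negligible_usual E t) (chi_usual i j) (chi_usual j i)
  (chi_diag i j) (chi_diag j i) dX dY.
exists V; split=> //; apply: filterS VE => x [reg VQ]; split=> // t.
by rewrite VQ qcovE.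
Qed.

Lemma geometric_dyadic_cauchy (u : nat -> R -> R) :
  (forall n, {within timeset T, continuous (u n)}) -> geometric_steps T u ->
  dyadic_cauchy T u.
Proof.
move=> cu /geometric_unif_cvg[_ H]; apply/(dyadic_cauchyP T_gt0 cu).
by exists (fun t => limn (u ^~ t)); apply/unif_cvgP.
Qed.

Lemma regular_Gqv x : (forall i j, exists M N, 
    @regular R T _ CP (X i) (X j) M N _ _ (chiP i j) (chiP j i) x) -> Gqv T d x.
Proof.
move=> reg; rewrite GqvE//.
have Dx : Dqv x.
  move=> i j; apply/(endo_domainP T_gt0); have [M [N [h _ _ _]]] := reg i j.
  by apply: geometric_dyadic_cauchy => // n; exact: cov_int_continuous.
split=> // i j; apply/(bounded_variation_dyadic T_gt0).
  exact: qcov_entry_continuous.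
have [M [N [_ _ _ bv]]] := reg i j; move: bv; congr (bounded_variation 0 T _).
by apply/funext => t; rewrite qcovE.
Qed.

Lemma ae_Gqv : {ae cP, forall x, Gqv T d x}.
Proof.
have reg : {ae cP, forall x, forall i j, exists M N,
    @regular R T _ CP (X i) (X j) M N _ _ (chiP i j) (chiP j i) x}.
  apply: filter_forall => i; apply: filter_forall => j.
  have [_ [M [A dX]]] := semP i; have [_ [N [B dY]]] := semP j.
  have [V [_ _ VE]] := coord_bracket dX dY.
  by apply: filterS VE => x [h _]; exists M, N.
by apply: filterS reg => x; exact: regular_Gqv.
Qed.

Lemma negligible_GqvC : P (~` Gqv T d) = 0%E.
Proof.
have mG := measurableC (@measurable_Gqv R T d T_gt0).
apply: (proj1 (@negligibleP _ BP R P _ mG)); exact: completion_negligible ae_Gqv.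
Qed.

Lemma probability_Gqv : P (Gqv T d) = 1%E.
Proof.
have mG := @measurable_Gqv R T d T_gt0.
rewrite -[Gqv T d]setCK probability_setC; last exact: measurableC.
by rewrite negligible_GqvC sube0.
Qed.

Lemma exists_bracket i j : exists V, is_coord_bracket P i j V.
Proof.
have [_ [M [A dX]]] := semP i; have [_ [N [B dY]]] := semP j.
have [V [fV lV _]] := coord_bracket dX dY.
by exists V, M, A, N, B.
Qed.

(** A bracket [V] comes with its own decompositions of the coordinates. The construction
    is applied to these, and uniqueness identifies its outcome with [V]. *)
Lemma bracket_qcov i j V : is_coord_bracket P i j V ->
  {ae P, forall x, forall t, timeset T t -> at_time (qcov_path x) t i j = V t x}.
Proof.
move=> [M [A [N [B [dX dY fV lV]]]]].
have [V0 [fV0 lV0 V0E]] := coord_bracket dX dY.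
have VV := bracket_unique T_gt0 completion_setT usual_filtration fV fV0 lV lV0.
apply: completion_negligible.
suff : {ae cP, forall x, forall t, timeset T t -> at_time (qcov_path x) t i j = V t x} by [].
have fae : Filter (almost_everywhere cP) by exact: ae_filter_ringOfSetsType.
apply: filterS3 ae_Gqv V0E VV => x [_ c _] [_ V0x] VVx t tT.
have {}tT : 0 <= t <= T by move: tT; rewrite /timeset/= in_itv.
by rewrite qcov_pathE// VVx// V0x.
Qed.

End laws.

Theorem theorem4p2 (R : realType) (T : R) (d : nat) (T_gt0 : 0 < T)
    (d_gt0 : (0 < d)%N) :
  [/\ measurable (Gqv T d : set (borel_cpath T d 1)),
      (@qcov_path R T d) @` Gqv T d `<=` Cfv T d /\
      measurable_fun (Gqv T d : set (borel_cpath T d 1))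
        (@qcov_path R T d : borel_cpath T d 1 -> borel_cpath T d d),
      forall P : law T d, semimartingale_law P ->
        P (Gqv T d) = 1%E /\
        forall i j : 'I_d,
          (exists V, is_coord_bracket P i j V) /\
          (forall V, is_coord_bracket P i j V ->
            {ae P, forall x, forall t, timeset T t ->
              at_time (qcov_path x) t i j = V t x}) &
      measurable (~` Gqv T d : set (borel_cpath T d 1)) /\
      forall Ps : set (law T d),
        (forall P, Ps P -> semimartingale_law P) ->
        polar Ps (~` Gqv T d)].
Proof.
have mG := @measurable_Gqv R T d T_gt0.
split=> //.
- split; last exact: measurable_qcov_path.
  by move=> _ [x [_ _ bv] <-].
- move=> P semP; split; first exact: probability_Gqv.
  by move=> i j; split; [exact: exists_bracket|move=> V; exact: bracket_qcov].
split; first exact: measurableC mG.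
move=> Ps semPs; rewrite /polar -[RHS]ereal_sup1; congr ereal_sup.
apply/seteqP; split=> [_ [->//|[P PsP <-]]|_ ->]; last by left.
rewrite /= measurable_mu_extE; first exact: negligible_GqvC (semPs P PsP).
exact: measurableC mG.
Qed.
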